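(* Let $p$ be a prime. Let $\mathcal{B}_p$ be the set of balls $\bar B_p(\alpha,\delta)$ with $(\alpha,\delta)$ an admissible pair in $\mathbb{C}_p^{\mathrm{br}}\times(\mathbb{Q}\cup\{\infty\})$, on which $G_p$ acts by $\sigma(\bar B_p(\alpha,\delta))=\bar B_p(\sigma(\alpha),\delta)$, and let $\mathcal{B}_p/G_p$ be the set of orbits. Let $\mathcal{W}_p$ be the set of DVRs $W$ with quotient field $\mathbb{Q}(X)$ and $W\cap\mathbb{Q}=\mathbb{Z}_{(p)}$. Then the map $\Theta_p:\mathcal{B}_p/G_p\to\mathcal{W}_p$, $[\bar B_p(\alpha,\delta)]\mapsto\mathbb{Z}_{(p),\alpha,\delta}$, is well defined and bijective.
   Context: Fix a prime $p$. $\overline{\mathbb{Q}_p}$ is an algebraic closure of $\mathbb{Q}_p$, $v_p$ the unique extension of the $p$-adic valuation, $\mathbb{C}_p$ the completion of $\overline{\mathbb{Q}_p}$. $G_p=\mathrm{Gal}(\overline{\mathbb{Q}_p}/\mathbb{Q}_p)$, identified with the group of continuous $\mathbb{Q}_p$-automorphisms of $\mathbb{C}_p$. $\mathbb{C}_p^{\mathrm{br}}$ is the set of $\alpha\in\mathbb{C}_p$ such that the ramification index of $\mathbb{Q}_p(\alpha)/\mathbb{Q}_p$ (index of $\mathbb{Z}$ in $v_p(\mathbb{Q}_p(\alpha)^* )$) is finite. A pair $(\alpha,\delta)\in\mathbb{C}_p\times(\mathbb{Q}\cup\{\infty\})$ is admissible if: when $\delta\in\mathbb{Q}$, $\alpha\in\overline{\mathbb{Q}_p}$;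 when $\delta=\infty$, $\alpha$ is transcendental over $\mathbb{Q}$. For $\delta\in\mathbb{Q}$, $v_{p,\alpha,\delta}$ is the monomial valuation on $\mathbb{C}_p(X)$ given on polynomials by $v_{p,\alpha,\delta}(\sum_i a_i(X-\alpha)^i)=\min_i\{v_p(a_i)+i\delta\}$; for $\delta=\infty$, $v_{p,\alpha,\infty}(\varphi)=v_p(\varphi(\alpha))$ for $\varphi\in\mathbb{Q}(X)$. $\mathbb{Z}_{(p),\alpha,\delta}=\{\varphi\in\mathbb{Q}(X):v_{p,\alpha,\delta}(\varphi)\ge0\}$. $\bar B_p(\alpha,\delta)=\{x\in\mathbb{C}_p:v_p(x-\alpha)\ge\delta\}$ (equal to $\{\alpha\}$ if $\delta=\infty$). *)

(* Defs.v *)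
From HB Require Import structures.
From mathcomp Require Import all_boot all_order all_algebra.
From mathcomp Require Import fraction.
Set Implicit Arguments. Unset Strict Implicit. Unset Printing Implicit Defensive.
Import Order.TTheory GRing.Theory Num.Theory.
Local Open Scope ring_scope.

Notation "x %:F" := (@FracField.tofrac _ x).

(* The valuation v : K -> rat is only meaningful on nonzero elements;       *)
(* v 0 = +oo is encoded through [vge] below.                                *)

Section Cp.
Variables (p : nat) (K : closedFieldType) (v : K -> rat).

(* "v x >= n", with the convention v 0 = +oo *)
Definition vge (x : K) (n : rat) : Prop := x = 0 \/ n <= v x.

Definition vpQ (q : rat) : rat :=
  ((logn p `|numq q|%N)%:Z - (logn p `|denq q|%N)%:Z)%:~R.

(* (K, v) is (isomorphic as a valued field to) C_p: an algebraically closed *)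
(* field of characteristic 0, with a (Q-valued) valuation extending v_p,    *)
(* complete, in which the algebraic closure of Q is dense (i.e. K is the    *)
(* completion of an algebraic closure of Q_p).                             *)
Definition isCp : Prop :=
  (forall q : rat, q != 0 -> ratr q != 0 :> K) /\
  [/\ (forall x y : K, x != 0 -> y != 0 -> v (x * y) = v x + v y),
      (forall x y : K, x != 0 -> y != 0 -> x + y != 0 ->
          Num.min (v x) (v y) <= v (x + y)),
      (forall q : rat, q != 0 -> v (ratr q) = vpQ q),
      (forall u : nat -> K,
          (forall n : rat, exists N : nat, forall i j : nat,
              (N <= i)%N -> (N <= j)%N -> vge (u i - u j) n) ->
          exists l : K, forall n : rat, exists N : nat, forall i : nat,
              (N <= i)%N -> vge (u i - l) n) &
      (forall (x : K) (n : rat), exists y : K,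
          (exists f : {poly rat}, f != 0 /\ root (map_poly ratr f) y)
          /\ vge (x - y) n)].

(* Q_p inside K: the topological closure of Q *)
Definition inQp (x : K) : Prop :=
  forall n : rat, exists q : rat, vge (x - ratr q) n.

Definition polyOverQp (f : {poly K}) : Prop := forall i : nat, inQp f`_i.

Definition algQp (a : K) : Prop :=
  exists f : {poly K}, f != 0 /\ polyOverQp f /\ root f a.

Definition transcQ (a : K) : Prop :=
  forall f : {poly rat}, f != 0 -> ~ root (map_poly ratr f) a.

(* alpha \in C_p^br: the value group v(Q_p(alpha)^* ) contains Z with finite *)
(* index, i.e. it is contained in (1/e)Z for some e >= 1.  Elements of        *)
(* Q_p(alpha)^* are f(alpha)/g(alpha), f, g in Q_p[X].                        *)
Definition isBr (a : K) : Prop :=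
  exists e : nat, (0 < e)%N /\
    forall f g : {poly K}, polyOverQp f -> polyOverQp g ->
      f.[a] != 0 -> g.[a] != 0 ->
      denq (e%:R * v (f.[a] / g.[a])) = 1.

(* delta \in Q \cup {oo} is encoded as option rat, None = oo *)
Definition admissible (a : K) (d : option rat) : Prop :=
  match d with Some _ => algQp a | None => transcQ a end.

Definition admBr (a : K) (d : option rat) : Prop := isBr a /\ admissible a d.

Definition ball (a : K) (d : option rat) : K -> Prop :=
  fun x => match d with Some r => vge (x - a) r | None => x = a end.

Definition inGp (s : {rmorphism K -> K}) : Prop :=
  [/\ bijective s,
      (forall (x : K) (n : rat), exists m : rat, forall y : K,
          vge (y - x) m -> vge (s y - s x) n) &
      (forall x : K, inQp x -> s x = x)].

Definition sameOrbit (a : K) (d : option rat) (a' : K) (d' : option rat) : Prop :=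
  exists s : {rmorphism K -> K}, inGp s /\
    forall x : K, ball (s a) d x <-> ball a' d' x.

(* monomial valuation v_{p,a,r} on nonzero polynomials of K[X]:            *)
(* min_i { v(c_i) + i r } where h = sum_i c_i (X - a)^i                     *)
Definition vmono (a : K) (r : rat) (h : {poly K}) : rat :=
  let c := h \Po ('X + a%:P) in
  let l := [seq v c`_i + i%:R * r | i <- iota 0 (size c) & c`_i != 0] in
  \big[Num.min/head 0 l]_(x <- l) x.

Local Notation QX := {fraction {poly rat}}.

Definition Zring (a : K) (d : option rat) : QX -> Prop :=
  fun phi => exists f g : {poly rat}, g != 0 /\
    phi = (f%:F) / (g%:F) /\
    let f' := map_poly (ratr : rat -> K) f in
    let g' := map_poly (ratr : rat -> K) g in
    match d with
    | Some r => f = 0 \/ vmono a r g' <= vmono a r f'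
    | None => vge (f'.[a] / g'.[a]) 0
    end.

End Cp.

Section Wp.
Variable p : nat.
Local Notation QX := {fraction {poly rat}}.

Definition subring (W : QX -> Prop) : Prop :=
  [/\ W 1, (forall x y, W x -> W y -> W (x - y)) &
      (forall x y, W x -> W y -> W (x * y))].

Definition unitIn (W : QX -> Prop) (u : QX) : Prop := [/\ W u, u != 0 & W u^-1].

Definition isDVR (W : QX -> Prop) : Prop :=
  subring W /\
  exists t : QX, [/\ W t, t != 0, ~ unitIn W t &
    forall x : QX, W x -> x != 0 -> exists (u : QX) (n : nat),
      unitIn W u /\ x = u * t ^+ n].

Definition isWp (W : QX -> Prop) : Prop :=
  [/\ isDVR W,
      (forall phi : QX, exists a b : QX, [/\ W a, W b, b != 0 & phi = a / b]) &
      (forall q : rat, W ((q%:P)%:F) <-> ~~ (p %| `|denq q|)%N)].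
End Wp.

(* Main.v *)
(** On polynomials over the algebraic numbers both kinds of ball give a valuation: [h |-> v h.[a]]
    for [d = None], the Gauss valuation centred at [a] otherwise.  It is determined by its values
    on constants and on the [X - c], hence by the ball.

    Injectivity.  Over a finite Galois extension [F] of [Q], two extensions to [F[X]] of one
    valuation of [Q[X]] are conjugate under [Gal(F/Q)]: for a single [h] the Newton polygon of
    [\prod_t (T - t h)] recovers the values of the conjugates of [h], and a product of suitable
    powers makes the choice of [t] uniform.  An ultrafilter limit over all [F] gives an
    automorphism of the algebraic numbers carrying one valuation to the other; being an isometry,
    it extends by completeness to an element of [G_p], and density identifies the balls.

    Surjectivity.  The normalised valuation [w] of a DVR [W] is extended (Chevalley) to [W'] over
    the field of rational functions with algebraic coefficients, and by conjugacy the algebraic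
    numbers embed isometrically in [K].  If [W' (X - c)] has a maximum [r] over [c], attained at
    [a], then [w] comes from the ball of centre [a] and radius [r].  Otherwise [W'] is immediate,
    so the residue field of [W] is algebraic over [F_p]; expanding elements of [W] in a
    uniformizer, with digits that are nearly Teichmuller representatives, makes multiplication by
    [X] nearly a matrix of algebraic numbers, whose eigenvalues approximate [X].  Hence
    [W' (X - c)] is unbounded and [w] comes from the limit in [K] of the approximations [c]. *)
Require Import Defs.
From HB Require Import structures.
From mathcomp Require Import all_boot all_order all_algebra all_fingroup all_field.
From mathcomp Require Import fraction.
From mathcomp Require Import ring lra zify.
From mathcomp Require boolp classical_sets filter.
Set Implicit Arguments. Unset Strict Implicit. Unset Printing Implicit Defensive.
Import Order.TTheory GRing.Theory Num.Theory.
Local Open Scope ring_scope.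

(** * Rank one valuations and Gauss extensions *)

(** Galois conjugacy is available over number fields only, whereas the balls live in [K]. All
    valuations are therefore tested on polynomials over [algC], whose image in [K] is dense under
    any embedding. No decomposition group has to be introduced: an automorphism that carries one
    valuation of a ball to the other preserves the values of constants, so it is an isometry of
    [algC] and extends to [K].

    The obstacle to surjectivity is that C_p is not spherically complete: nested balls whose radii
    stay bounded may have empty intersection, and such a nest still defines a valuation of rational
    functions. Completeness alone cannot settle the case without a maximum; the discreteness of [w]
    on Q(X) must exclude these nests. The expansions in a uniformizer do this. Their precision has
    to be tracked, since a polynomial of degree n that is small to order n N at a point has a root
    only to order N from it; the characteristic polynomial used there keeps the ramification index
    as its degree while the precision grows. *)

Definition isVal (R : idomainType) (w : R -> rat) : Prop :=
  (forall x y, x != 0 -> y != 0 -> w (x * y) = w x + w y) /\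
  (forall x y, x != 0 -> y != 0 -> x + y != 0 ->
     Num.min (w x) (w y) <= w (x + y)).

(** The zero clause encodes w 0 = +oo, so that sums and products can be bounded without side
    conditions on vanishing. *)
Definition vleb (R : idomainType) (w : R -> rat) (n : rat) (x : R) : bool :=
  (x == 0) || (n <= w x).

Section ValuationTheory.
Variables (R : idomainType) (w : R -> rat).
Hypothesis Hw : isVal w.
Implicit Types (x y : R) (m n : rat).

Lemma val_mul x y : x != 0 -> y != 0 -> w (x * y) = w x + w y.
Proof. by case: Hw => H _; apply: H. Qed.

Lemma val_one : w 1 = 0.
Proof.
have := val_mul (oner_neq0 R) (oner_neq0 R); rewrite mulr1 => H; lra.
Qed.

Lemma val_exp x k : x != 0 -> w (x ^+ k) = k%:R * w x.
Proof.
move=> x0; elim: k => [|k IH]; first by rewrite expr0 val_one mul0r.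
by rewrite exprS val_mul ?expf_neq0 // IH -natr1; ring.
Qed.

Lemma val_oppr1 : w (-1) = 0.
Proof.
have n0 : (-1 : R) != 0 by rewrite oppr_eq0 oner_neq0.
have := val_mul n0 n0; rewrite mulrNN mulr1 val_one => H; lra.
Qed.

Lemma val_opp x : w (- x) = w x.
Proof.
have [->|x0] := eqVneq x 0; first by rewrite oppr0.
by rewrite -mulN1r val_mul ?oppr_eq0 ?oner_neq0 // val_oppr1 add0r.
Qed.

Lemma val_prod (I : Type) (r : seq I) (P : pred I) (F : I -> R) :
  (forall i, P i -> F i != 0) ->
  w (\prod_(i <- r | P i) F i) = \sum_(i <- r | P i) w (F i).
Proof.
move=> HF; elim: r => [|i r IH]; first by rewrite !big_nil val_one.
rewrite !big_cons; case: ifP => // Pi; rewrite val_mul ?IH ?HF //.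
by elim: (r) => [|j s IHs]; rewrite ?big_nil ?oner_neq0 // big_cons;
  case: ifP => // Pj; rewrite mulf_neq0 ?HF.
Qed.

Lemma vleb0 n : vleb w n 0.
Proof. by rewrite /vleb eqxx. Qed.

Lemma vlebE n x : x != 0 -> vleb w n x = (n <= w x).
Proof. by rewrite /vleb => /negPf->. Qed.

Lemma vleb_refl x : vleb w (w x) x.
Proof. by rewrite /vleb lexx orbT. Qed.

Lemma vlebW m n x : m <= n -> vleb w n x -> vleb w m x.
Proof. by move=> mn /orP[/eqP->|h]; rewrite ?vleb0 // /vleb (le_trans mn h) orbT. Qed.

Lemma vlebN n x : vleb w n (- x) = vleb w n x.
Proof. by rewrite /vleb oppr_eq0 val_opp. Qed.

Lemma vlebD n x y : vleb w n x -> vleb w n y -> vleb w n (x + y).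
Proof.
have [->|x0] := eqVneq x 0; first by rewrite add0r.
have [->|y0] := eqVneq y 0; first by rewrite addr0.
have [->|s0] := eqVneq (x + y) 0; first by rewrite vleb0.
rewrite !vlebE // => hx hy; case: Hw => _ /(_ _ _ x0 y0 s0); apply: le_trans.
by rewrite le_min hx.
Qed.

Lemma vlebB n x y : vleb w n x -> vleb w n y -> vleb w n (x - y).
Proof. by move=> hx hy; rewrite vlebD ?vlebN. Qed.

Lemma vlebBC n x y : vleb w n (x - y) = vleb w n (y - x).
Proof. by rewrite -vlebN opprB. Qed.

Lemma vleb_trans n y x z : vleb w n (x - y) -> vleb w n (y - z) -> vleb w n (x - z).
Proof. by move=> h1 h2; rewrite -[x](subrK y) -addrA vlebD. Qed.

Lemma vleb_sum n (I : Type) (r : seq I) (P : pred I) (F : I -> R) :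
  (forall i, P i -> vleb w n (F i)) -> vleb w n (\sum_(i <- r | P i) F i).
Proof. by move=> HF; elim/big_ind: _ => //; [apply: vleb0 | apply: vlebD]. Qed.

Lemma vlebM m n x y : vleb w m x -> vleb w n y -> vleb w (m + n) (x * y).
Proof.
have [->|x0] := eqVneq x 0; first by rewrite mul0r => *; apply: vleb0.
have [->|y0] := eqVneq y 0; first by rewrite mulr0 => *; apply: vleb0.
rewrite !vlebE ?mulf_neq0 // val_mul //; exact: lerD.
Qed.

Lemma vlebM0l n x y : vleb w 0 x -> vleb w n y -> vleb w n (x * y).
Proof. by move=> hx hy; have := vlebM hx hy; rewrite add0r. Qed.

Lemma vlebM0r n x y : vleb w n x -> vleb w 0 y -> vleb w n (x * y).
Proof. by move=> hx hy; rewrite mulrC vlebM0l. Qed.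

Lemma vleb1 : vleb w 0 1.
Proof. by rewrite vlebE ?oner_neq0 // val_one. Qed.

Lemma vleb_prod0 (I : Type) (r : seq I) (P : pred I) (F : I -> R) :
  (forall i, P i -> vleb w 0 (F i)) -> vleb w 0 (\prod_(i <- r | P i) F i).
Proof. by move=> HF; elim/big_ind: _ => //; [apply: vleb1 | apply: vlebM0l]. Qed.

Lemma vlebX0 x k : vleb w 0 x -> vleb w 0 (x ^+ k).
Proof. by move=> hx; elim: k => [|k IH]; rewrite ?expr0 ?vleb1 // exprS vlebM0l. Qed.

Lemma vleb_nat k : vleb w 0 k%:R.
Proof. by elim: k => [|k IH]; rewrite ?vleb0 // -natr1 vlebD ?vleb1. Qed.

Lemma val_addl x y n : x != 0 -> vleb w n y -> w x < n ->
  x + y != 0 /\ w (x + y) = w x.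
Proof.
move=> x0 hy lt.
have s0 : x + y != 0.
  apply/eqP => /eqP; rewrite addr_eq0 => /eqP xE.
  by move: hy lt; rewrite -vlebN -xE vlebE // => h1 /(le_lt_trans h1); rewrite ltxx.
split=> //; apply/eqP; rewrite eq_le; apply/andP; split.
  (* If the sum had a larger value than [x], so would [x = (x + y) - y]. *)
  rewrite leNgt; apply/negP => lt2.
  have : vleb w (Num.min n (w (x + y))) ((x + y) - y).
    by apply: vlebB; [apply: vlebW (vleb_refl _) | apply: vlebW hy];
      rewrite ge_min lexx ?orbT.
  by rewrite addrK vlebE // ge_min leNgt lt leNgt lt2.
rewrite -vlebE //; apply: vlebD; first exact: vleb_refl.
by apply: vlebW hy; apply: ltW.
Qed.

Lemma val_near x y n : x != 0 -> w x < n -> vleb w n (x - y) -> y != 0 /\ w y = w x.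
Proof.
move=> x0 lt; rewrite vlebBC => h.
by have := val_addl x0 h lt; rewrite [x + _]addrC subrK.
Qed.

End ValuationTheory.

Lemma big_min_seqP (l : seq rat) z :
  let m := \big[Num.min/z]_(x <- l) x in
  m \in z :: l /\ forall x, x \in z :: l -> m <= x.
Proof.
elim: l => [|y l [IH1 IH2]] /=.
  by rewrite big_nil; split=> [|x]; rewrite inE // => /eqP->.
rewrite big_cons; move: IH1 IH2; set m := (\big[_/_]_(_ <- _) _) => IH1 IH2; split.
  by rewrite /Order.min; case: ifP => _; rewrite !inE ?eqxx ?orbT //;
    move: IH1; rewrite inE => /orP[->|->]; rewrite ?orbT.
move=> x; rewrite !inE ge_min => /or3P[/eqP->|/eqP->|xl].
- by rewrite IH2 ?inE ?eqxx ?orbT.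
- by rewrite lexx.
by rewrite (IH2 x) ?orbT // inE xl orbT.
Qed.

(** The default [head 0 l] of the fold in [vmono] belongs to a nonempty list, so it does not disturb
    the minimum. *)
Lemma big_min_headP (l : seq rat) : l != [::] ->
  let m := \big[Num.min/head 0 l]_(x <- l) x in
  m \in l /\ forall x, x \in l -> m <= x.
Proof.
move=> l0; have [H1 H2] := big_min_seqP l (head 0 l).
have hl : head 0 l \in l by case: l l0 {H1 H2} => // a l; rewrite inE eqxx.
split; first by move: H1; rewrite inE => /orP[/eqP->|].
by move=> x xl; rewrite H2 // inE xl orbT.
Qed.

Section Gauss.
Variables (R : idomainType) (w : R -> rat).
Hypothesis Hw : isVal w.

Definition gaussv (r : rat) (c : {poly R}) : rat :=
  let l := [seq w c`_i + i%:R * r | i <- iota 0 (size c) & c`_i != 0] in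
  \big[Num.min/head 0 l]_(x <- l) x.

Lemma gaussvP r (c : {poly R}) : c != 0 ->
  (forall i, c`_i != 0 -> gaussv r c <= w c`_i + i%:R * r) /\
  (exists2 i, c`_i != 0 & gaussv r c = w c`_i + i%:R * r).
Proof.
move=> c0; rewrite /gaussv; set l := [seq _ | i <- _ & _].
have inl i : c`_i != 0 -> w c`_i + i%:R * r \in l.
  move=> ci; apply/mapP; exists i => //; rewrite mem_filter ci mem_iota /=.
  by rewrite add0n ltnNge; apply: contra ci => h; rewrite nth_default.
have l0 : l != [::].
  have := inl (size c).-1; rewrite -lead_coefE lead_coef_eq0 => /(_ c0).
  by case: (l).
have [H1 H2] := big_min_headP l0; split; first by move=> i /inl /H2.
by case/mapP: H1 => i; rewrite mem_filter => /andP[ci _] ->; exists i.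
Qed.

Lemma gaussv_ge r (c : {poly R}) n : c != 0 ->
  (n <= gaussv r c) <-> (forall i, vleb w (n - i%:R * r) c`_i).
Proof.
move=> c0; have [H1 [i ci E]] := gaussvP r c0; split=> [h j|/(_ i)]; last first.
  by rewrite vlebE // lerBlDr E.
have [->|cj] := eqVneq c`_j 0; first exact: vleb0.
by rewrite vlebE // lerBlDr (le_trans h (H1 j cj)).
Qed.

Lemma gaussv_vleb r (c : {poly R}) n :
  vleb (gaussv r) n c <-> (forall i, vleb w (n - i%:R * r) c`_i).
Proof.
have [->|c0] := eqVneq c 0; last by rewrite vlebE //; apply: gaussv_ge.
by split=> [_ i|_]; rewrite ?coef0 vleb0.
Qed.

Lemma gaussvC r (x : R) : x != 0 -> gaussv r x%:P = w x.
Proof.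
move=> x0; have c0 : x%:P != 0 by rewrite polyC_eq0.
have [_ [i]] := gaussvP r c0; rewrite coefC; case: i => [|i] /=; last by rewrite eqxx.
by rewrite mul0r addr0.
Qed.

Lemma gaussvX r : gaussv r 'X = r.
Proof.
have [_ [i]] := gaussvP r (monic_neq0 (monicX R)); rewrite coefX; case: i => [|[|i]] /=; rewrite ?eqxx //.
by rewrite (val_one Hw) mul1r add0r.
Qed.

(* The product coefficient at the sum of the first indices where the two minima
   are attained has no cancellation. *)
Lemma gaussvM r (a b : {poly R}) : a != 0 -> b != 0 -> gaussv r (a * b) = gaussv r a + gaussv r b.
Proof.
move=> a0 b0; have ab0 : a * b != 0 by rewrite mulf_neq0.
pose att (c : {poly R}) i := (c`_i != 0) && (w c`_i + i%:R * r == gaussv r c).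
have exatt c : c != 0 -> exists i, att c i.
  by move=> c0; have [_ [i ci E]] := gaussvP r c0; exists i; rewrite /att ci E eqxx.
have lowatt (c : {poly R}) i0 : c != 0 -> (forall i, att c i -> (i0 <= i)%N) ->
    forall i, (i < i0)%N -> c`_i != 0 -> gaussv r c < w c`_i + i%:R * r.
  move=> c0 m i lt ci; rewrite lt_neqAle; have [-> // _] := gaussvP r c0.
  rewrite andbT eq_sym; apply: contraL lt => E.
  by rewrite -leqNgt m // /att ci.
case: (ex_minnP (exatt a a0)) => i /andP[ai /eqP Ei] mi.
case: (ex_minnP (exatt b b0)) => j /andP[bj /eqP Ej] mj.
have {mi}Li := lowatt _ _ a0 mi; have {mj}Lj := lowatt _ _ b0 mj.
have [Ga _] := gaussvP r a0; have [Gb _] := gaussvP r b0.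
have term k l : a`_k != 0 -> b`_l != 0 ->
    w (a`_k * b`_l) + (k + l)%:R * r = (w a`_k + k%:R * r) + (w b`_l + l%:R * r).
  by move=> ak bl; rewrite (val_mul Hw) // natrD; ring.
apply/eqP; rewrite eq_le; apply/andP; split; last first.
  apply/gaussv_ge => // n; rewrite coefM; apply: (vleb_sum Hw) => k _.
  have [->|ak] := eqVneq a`_k 0; first by rewrite mul0r => *; apply: vleb0.
  have [->|bl] := eqVneq b`_(n - k) 0; first by rewrite mulr0 => *; apply: vleb0.
  rewrite vlebE ?mulf_neq0 // lerBlDr.
  have := term k (n - k)%N ak bl; rewrite (subnKC (leq_ord k)) => ->.
  by rewrite lerD ?Ga ?Gb.
have [_ _] := gaussvP r ab0.
have [G _] := gaussvP r ab0.
have := G (i + j)%N; rewrite coefM.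
have li : (i < (i + j).+1)%N by rewrite ltnS leq_addr.
rewrite (bigD1 (Ordinal li)) //= addKn.
set S := \sum_(_ | _) _ => H.
pose val k := w (a`_k * b`_(i + j - k)).
have [n ltn Hn] : exists2 n, w (a`_i * b`_j) < n & vleb w n S.
  have bnd k : (k < (i+j).+1)%N -> k != i -> a`_k * b`_(i + j - k) != 0 ->
      w (a`_i * b`_j) < val k.
    move=> lek ki; rewrite mulf_eq0 negb_or => /andP[ak bl].
    have E1 := term i j ai bj.
    have := term k _ ak bl; rewrite (subnKC (lek : (k <= i + j)%N)) /val => E2.
    move: (Ga _ ak) (Gb _ bl).
    have [lt|] := ltnP k i; first by have := Li _ lt ak; lra.
    rewrite leq_eqVlt eq_sym (negPf ki) /= => lt.
    have lt2 : (i + j - k < j)%N by lia.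
    by have := Lj _ lt2 bl; lra.
  (* The default [+ 1] keeps the bound strict when every other term vanishes. *)
  pose m := \big[Num.min/(w (a`_i * b`_j) + 1)]_(x <-
     [seq val k | k <- iota 0 (i + j).+1 & (k != i) && (a`_k * b`_(i + j - k) != 0)]) x.
  have [m1 m2] := big_min_seqP [seq val k | k <- iota 0 (i + j).+1 & (k != i) && (a`_k * b`_(i + j - k) != 0)] (w (a`_i * b`_j) + 1).
  exists m.
    move: m1; rewrite inE -/m => /orP[/eqP->|]; first by rewrite ltrDl.
    case/mapP => k; rewrite mem_filter mem_iota => /andP[/andP[ki kn] /andP[_ lk]] ->.
    exact: bnd.
  apply: (vleb_sum Hw) => k ki.
  have [->|kn] := eqVneq (a`_k * b`_(i + j - k)) 0; first exact: vleb0.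
  rewrite vlebE //; apply: m2; rewrite inE; apply/orP; right.
  apply: (map_f val (x := nat_of_ord k)).
  by rewrite mem_filter mem_iota kn andbT /= add0n ltn_ord !andbT.
have abij : a`_i * b`_j != 0 by rewrite mulf_neq0.
have [s0 sE] := val_addl Hw abij Hn ltn.
by move: (H s0); rewrite sE term // Ei Ej.
Qed.

Lemma isVal_gaussv r : isVal (gaussv r).
Proof.
split=> [a b|a b a0 b0 s0]; first exact: gaussvM.
apply/gaussv_ge => // i; rewrite coefD; apply: (vlebD Hw).
  by apply: (proj1 (gaussv_vleb r a _)); rewrite vlebE // ge_min lexx.
by apply: (proj1 (gaussv_vleb r b _)); rewrite vlebE // ge_min lexx orbT.
Qed.

(** As a function of the radius this has its only break at [w y]; this is how values of roots are
    read off a product of linear factors. *)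
Lemma gaussv_XsubC r (y : R) : gaussv r ('X - y%:P) = if y == 0 then r else Num.min (w y) r.
Proof.
have [->|y0] := eqVneq y 0; first by rewrite subr0 gaussvX.
have c0 := monic_neq0 (monicXsubC y).
have [H1 [i ci E]] := gaussvP r c0.
have h0 : gaussv r ('X - y%:P) <= w y.
  by have := H1 0%N; rewrite coefB coefX coefC /= sub0r oppr_eq0 (val_opp Hw) mul0r addr0; apply.
have h1 : gaussv r ('X - y%:P) <= r.
  by have := H1 1%N; rewrite coefB coefX coefC /= subr0 oner_neq0 (val_one Hw) mul1r add0r; apply.
apply/eqP; rewrite eq_le le_min h0 h1 /= E ge_min.
move: ci; rewrite coefB coefX coefC; case: i {E} => [|[|i]] /=.
- by rewrite sub0r (val_opp Hw) mul0r addr0 lexx.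
- by rewrite subr0 (val_one Hw) mul1r add0r lexx orbT.
by rewrite subr0 eqxx.
Qed.

End Gauss.

(** * Conjugacy of valuations over a normal number field *)

Lemma eq_gaussv (R : idomainType) (w1 w2 : R -> rat) r (c : {poly R}) :
  (forall i, c`_i != 0 -> w1 c`_i = w2 c`_i) -> gaussv w1 r c = gaussv w2 r c.
Proof.
move=> H; rewrite /gaussv.
have -> // : [seq w1 c`_i + i%:R * r | i <- iota 0 (size c) & c`_i != 0] =
          [seq w2 c`_i + i%:R * r | i <- iota 0 (size c) & c`_i != 0].
by apply/eq_in_map => i; rewrite mem_filter => /andP[ci _]; rewrite H.
Qed.

(* A break point of the concave function [s |-> \sum_j minr (b j) s] at [b i0]
   must be a break point of [s |-> \sum_j minr (a j) s]. *)
Lemma sum_min_break (I : finType) (P : pred I) (a b : I -> rat) :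
  (forall s, \sum_(i | P i) Num.min (a i) s = \sum_(i | P i) Num.min (b i) s) ->
  forall i0, P i0 -> exists2 j, P j & a j = b i0.
Proof.
move=> H i0 Pi0; set s0 := b i0.
case: (pickP [pred j | P j && (a j == s0)]) => [j /andP[Pj /eqP E]|none].
  by exists j.
exfalso.
have an j : P j -> a j != s0 by move=> Pj; have := none j; rewrite /= Pj /= => ->.
(* No [a j] lies strictly within [e] of [s0], so each [min (a j) s] is affine on [s0 - e, s0 + e],
   whence the midpoint identity [Ha]. For [b] concavity gives an inequality, and the term [i0] makes
   it strict. *)
have [e e0 eP] : exists2 e, 0 < e & forall j, P j -> e <= `|a j - s0|.
  have [] := big_min_seqP [seq `|a j - s0| | j <- enum P] 1.
  set e := (\big[_/_]_(_ <- _) _) => h1 h2; exists e.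
    move: h1; rewrite inE => /orP[/eqP->|/mapP[j]]; first exact: ltr01.
    by rewrite mem_enum => Pj ->; rewrite normr_gt0 subr_eq0 an.
  move=> j Pj; apply: h2; rewrite inE; apply/orP; right.
  by apply/mapP; exists j => //; rewrite mem_enum.
have Ha : \sum_(i | P i) Num.min (a i) (s0 - e) + \sum_(i | P i) Num.min (a i) (s0 + e)
   = \sum_(i | P i) Num.min (a i) s0 + \sum_(i | P i) Num.min (a i) s0.
  rewrite -!big_split; apply: eq_bigr => j Pj /=.
  have := eP j Pj.
  by case: (ltrP (a j) s0) => h h'; case: (ltrP (a j) (s0 - e)) => ?;
    case: (ltrP (a j) (s0 + e)) => ?; lra.
have Hb : \sum_(i | P i) Num.min (b i) (s0 - e) + \sum_(i | P i) Num.min (b i) (s0 + e)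
   < \sum_(i | P i) Num.min (b i) s0 + \sum_(i | P i) Num.min (b i) s0.
  rewrite -!big_split (bigD1 i0) //= [X in _ < X](bigD1 i0) //=.
  apply: ltr_leD; last first.
    apply: ler_sum => j _.
    by case: (ltrP (b j) s0) => ?; case: (ltrP (b j) (s0 - e)) => ?;
      case: (ltrP (b j) (s0 + e)) => ?; lra.
  rewrite -/s0 minxx.
  by case: (ltrP s0 (s0 - e)) => ?; case: (ltrP s0 (s0 + e)) => ?; lra.
by move: Hb; rewrite -!H Ha ltxx.
Qed.

Section ConjLocal.
Variables (L : splittingFieldType rat) (w1 w2 : {poly L} -> rat).
Hypotheses (H1 : isVal w1) (H2 : isVal w2).
Hypothesis Hagree : forall f : {poly rat}, f != 0 ->
  w1 (map_poly (in_alg L) f) = w2 (map_poly (in_alg L) f).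

Local Notation G := 'Gal({:L} / 1%AS)%g.

Definition galchi (h : {poly L}) : {poly {poly L}} :=
  \prod_(t in G) ('X - (map_poly (t : gal_of {:L}) h)%:P).

Lemma galois_rat : galois 1%AS {:L}.
Proof.
rewrite /galois sub1v normalFieldf andbT /=; apply/separableP => y _.
by apply: pcharf0_separable => q; rewrite pchar_lalg pchar_num.
Qed.

Lemma galchi_coef h i : exists q : {poly rat}, (galchi h)`_i = map_poly (in_alg L) q.
Proof.
apply/polyOver1P/polyOverP => j.
have /galois_fixedField <- := galois_rat.
apply/fixedFieldP => [|s sG]; first exact: memvf.
suff E : map_poly (map_poly s) (galchi h) = galchi h.
  by rewrite -{2}E !coef_map.
rewrite /galchi rmorph_prod [RHS](reindex_inj (mulIg s)) /=.
apply: eq_big => [t|t _]; first by rewrite groupMr.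
rewrite map_polyXsubC /= -map_poly_comp; congr ('X - _%:P).
by apply/polyP=> k; rewrite !coef_map /= galM ?memvf.
Qed.

(** The coefficients of [galchi h] are Galois invariant, hence in Q[X] where [w1] and [w2] agree, so
    their Gauss extensions of every radius agree on it. The identity of the group contributes the
    break at [w2 h]. *)
Lemma conj_one h : h != 0 -> exists2 t : gal_of {:L}, t \in G &
  w2 h = w1 (map_poly t h).
Proof.
move=> h0.
have mn t : map_poly (t : gal_of {:L}) h != 0 by rewrite map_poly_eq0.
have gchi w (Hw : isVal w) s : gaussv w s (galchi h) =
    \sum_(t in G) Num.min (w (map_poly (t : gal_of {:L}) h)) s.
  rewrite (val_prod (isVal_gaussv Hw s)) => [|t _]; last exact: monic_neq0 (monicXsubC _).
  by apply: eq_bigr => t _; rewrite gaussv_XsubC // (negPf (mn t)).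
have E s : \sum_(t in G) Num.min (w1 (map_poly (t : gal_of {:L}) h)) s =
           \sum_(t in G) Num.min (w2 (map_poly (t : gal_of {:L}) h)) s.
  rewrite -!gchi //; apply: eq_gaussv => i.
  have [q ->] := galchi_coef h i; rewrite map_poly_eq0; exact: Hagree.
have [t tG Et] := sum_min_break E (group1 G).
exists t => //; rewrite Et; congr (w2 _).
by apply/polyP=> i; rewrite coef_map /= gal_id.
Qed.

Lemma poly_nat_nonroot (P : {poly rat}) : P != 0 -> exists n : nat, P.[n%:R] != 0.
Proof.
move=> P0; case E : (all (root P) [seq i%:R | i <- iota 0 (size P)]).
  have := max_poly_roots P0 E; rewrite size_map size_iota ltnn.
  by rewrite map_inj_uniq ?iota_uniq => [/(_ isT)|? ? /eqP]; rewrite ?eqr_nat // => /eqP.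
by have /allPn[_ /mapP[n _ ->] nr] := negbT E; exists n.
Qed.

Lemma conj_local : exists2 t : gal_of {:L}, t \in G &
  forall h, h != 0 -> w2 h = w1 (map_poly t h).
Proof.
have mn (t : gal_of {:L}) h : h != 0 -> map_poly t h != 0 by rewrite map_poly_eq0.
pose d (t : gal_of {:L}) h := w2 h - w1 (map_poly t h).
have dM t h h' : h != 0 -> h' != 0 -> d t (h * h') = d t h + d t h'.
  by move=> h0 h0'; rewrite /d rmorphM (val_mul H1) ?mn // (val_mul H2) //=; ring.
have dX t h k : h != 0 -> d t (h ^+ k) = k%:R * d t h.
  by move=> h0; rewrite /d rmorphXn (val_exp H1) ?mn // (val_exp H2) //=; ring.
case: (boolp.pselect (exists2 t : gal_of {:L}, t \in G & forall h, h != 0 -> d t h = 0)).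
  by case=> t tG Ht; exists t => // h /Ht /eqP; rewrite subr_eq0 => /eqP.
move=> none; exfalso.
have bad t : t \in G -> exists2 h, h != 0 & d t h != 0.
  move=> tG; apply: boolp.contrapT => H; apply: none; exists t => // h h0.
  by apply/eqP; apply: boolp.contrapT => /negP dn; apply: H; exists h.
have [h h0 hbad] : exists2 h, h != 0 & forall t, t \in enum G -> d t h != 0.
  have : {subset enum G <= G} by move=> t; rewrite mem_enum.
  elim: (enum _) => [|t0 r IH] sub; first by exists 1; rewrite ?oner_neq0.
  have [|h h0 hr] := IH; first by move=> t tr; apply: sub; rewrite inE tr orbT.
  have [h' h0' hb] := bad t0 (sub _ (mem_head _ _)).
  (* As a function of [M], [d t (h * h' ^+ M)] is affine; its constant term is nonzero for [t] in
     [r] and its slope is nonzero for [t0]. The product over the list is a nonzero polynomial, and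
     [M] is a natural number that is not a root. *)
  have [|M HM] := @poly_nat_nonroot (\prod_(t <- t0 :: r) ((d t h)%:P + (d t h') *: 'X)).
    rewrite prodf_seq_neq0; apply/allP => t; rewrite inE => /orP tr /=.
    apply/eqP => /polyP E; case: tr => [/eqP Et|tr].
      by have := E 1%N; rewrite coefD coefC coefZ coefX mulr1 add0r coef0 Et => /eqP; apply/negP.
    by have := E 0%N; rewrite coefD coefC coefZ coefX mulr0 addr0 coef0 => /eqP; apply/negP/hr.
  exists (h * h' ^+ M); first by rewrite mulf_neq0 ?expf_neq0.
  move=> t tr; rewrite dM ?expf_neq0 // dX //.
  move: HM; rewrite horner_prod prodf_seq_neq0 => /allP /(_ t tr) /=.
  by rewrite !hornerE mulrC.
have [t tG Et] := conj_one h0.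
by have := hbad t; rewrite mem_enum /d Et subrr eqxx => /(_ tG).
Qed.

End ConjLocal.

(** * Limits of local morphisms and embeddings of the algebraic numbers *)

Module Compact.
Import classical_sets filter.
Local Open Scope classical_set_scope.

(** Compactness of a product of finite sets: along an ultrafilter containing, for every [t], the
    lists that include [t], one value of [f s x] is taken for almost all [s], because [cand x] is
    finite. *)
Lemma compact_choice (T U : choiceType) (cand : T -> seq U) (f : seq T -> T -> U) :
  (forall s x, x \in s -> f s x \in cand x) ->
  exists g : T -> U, forall t : seq T, exists s : seq T,
    {subset t <= s} /\ forall x, x \in t -> g x = f s x.
Proof.
move=> fc.
pose B (t : seq T) : set (seq T) := [set s : seq T | {subset t <= s}].
have FF : ProperFilter (filter_from setT B).
  apply: filter_from_proper; last by move=> t _; exists t => x.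
  apply: filter_from_filter; first by exists [::].
  move=> s t _ _; exists (s ++ t) => // u st; split => x xs; apply: st;
    by rewrite mem_cat xs ?orbT.
have [G [UG FG]] := ultraFilterLemma FF.
have PG : ProperFilter G by exact: ultra_proper.
have ex x : exists y, G [set s : seq T | f s x = y].
  have : G [set s : seq T | f s x \in cand x].
    by apply: (filterS (P := B [:: x])); [move=> s sx; apply: fc; apply: sx; rewrite inE
      | apply: FG; exists [:: x]].
  elim: (cand x) => [|y l IH].
    by move/filter_ex => [s].
  have [Gy _|Gy Gl] := in_ultra_setVsetC [set s : seq T | f s x = y] UG; first by exists y.
  apply: IH; apply: filterS (filterI Gy Gl) => s [/= ny]; rewrite inE => /orP[/eqP|//].
  by move/ny.
have [g gP] := boolp.choice ex; exists g => t.
suff /filter_ex[s [st sg]] : G (B t `&` [set s : seq T | forall x, x \in t -> g x = f s x]).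
  by exists s; split.
apply: filterI; first by apply: FG; exists t.
elim: t => [|x t IH]; first by apply: filterS (@filterT _ G _) => s _ x.
apply: filterS (filterI (gP x) IH) => s [/= E1 E2] y; rewrite inE => /orP[/eqP->//|].
exact: E2.
Qed.
End Compact.
Notation compact_choice := Compact.compact_choice.

(** A finite list is not closed under the operations, so each law is asked only when its result lies
    in the list. *)
Definition morphic_on (R S : nzRingType) (s : seq R) (f : R -> S) : Prop :=
  forall x y, x \in s -> y \in s ->
    [/\ x - y \in s -> f (x - y) = f x - f y, x * y \in s -> f (x * y) = f x * f y
      & 1 \in s -> f 1 = 1].

(** Each ring law involves at most three elements, and on these the limit coincides with a single
    [f s]. *)
Lemma rmorphism_limit (R S : nzRingType) (cand : R -> seq S) (f : seq R -> R -> S) :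
  (forall s x, x \in s -> f s x \in cand x) -> (forall s, morphic_on s (f s)) ->
  exists g : {rmorphism R -> S}, forall t : seq R, exists s : seq R,
    {subset t <= s} /\ forall x, x \in t -> g x = f s x.
Proof.
move=> fc fP; have [g gP] := compact_choice fc.
have sub : zmod_morphism g.
  move=> x y; have [s [st E]] := gP [:: x; y; x - y].
  have xs : x \in s by apply: st; rewrite !inE eqxx.
  have ys : y \in s by apply: st; rewrite !inE eqxx orbT.
  have zs : x - y \in s by apply: st; rewrite !inE eqxx !orbT.
  have /(_ x y xs ys) [H _ _] := fP s.
  by rewrite !E ?inE ?eqxx ?orbT // H.
have mul : monoid_morphism g.
  split=> [|x y].
    have [s [st E]] := gP [:: 1]; rewrite E ?inE //.
    have os : 1 \in s by apply: st; rewrite inE.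
    by have /(_ 1 1 os os) [_ _ ->] := fP s.
  have [s [st E]] := gP [:: x; y; x * y].
  have xs : x \in s by apply: st; rewrite !inE eqxx.
  have ys : y \in s by apply: st; rewrite !inE eqxx orbT.
  have zs : x * y \in s by apply: st; rewrite !inE eqxx !orbT.
  have /(_ x y xs ys) [_ H _] := fP s.
  by rewrite !E ?inE ?eqxx ?orbT // H.
pose m1 := GRing.isZmodMorphism.Build R S g sub.
pose m2 := GRing.isMonoidMorphism.Build R S g mul.
by exists (HB.pack_for {rmorphism R -> S} g m1 m2).
Qed.

Section Embedding.
Variables (K : closedFieldType).
Hypothesis K0 : forall q : rat, q != 0 -> ratr q != 0 :> K.

Lemma intr_neq0_K (n : int) : n != 0 -> n%:~R != 0 :> K.
Proof.
move=> n0; have := @K0 n%:~R; rewrite intr_eq0 => /(_ n0).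
by rewrite ratr_int.
Qed.

(** [K] carries no order, so the laws come from characteristic zero: [ratr q] may be computed from
    any fraction equal to [q], not only from the reduced one. *)
Lemma ratr_rmorphism : exists rK : {rmorphism rat -> K}, rK =1 ratr.
Proof.
have d0 (q : rat) : (denq q)%:~R != 0 :> K by rewrite intr_neq0_K ?denq_neq0.
have E (q : rat) (a b : int) : b != 0 -> q = a%:~R / b%:~R -> ratr q = a%:~R / b%:~R :> K.
  move=> b0 qE; rewrite /ratr; apply/eqP.
  rewrite eqr_div ?d0 ?intr_neq0_K // -!intrM; apply/eqP; congr (_%:~R).
  apply: (@intr_inj rat); rewrite !intrM.
  have b0' : b%:~R != 0 :> rat by rewrite intr_eq0.
  have d0' : (denq q)%:~R != 0 :> rat by rewrite intr_eq0 denq_neq0.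
  by apply/eqP; rewrite -eqr_div // -qE divq_num_den.
have add : zmod_morphism (ratr : rat -> K).
  move=> x y; rewrite (E _ (numq x * denq y - numq y * denq x) (denq x * denq y)).
  - rewrite !intrM intrB !intrM /ratr; field; rewrite !d0 //.
  - by rewrite mulf_neq0 ?denq_neq0.
  rewrite !intrM intrB !intrM -{1}[x]divq_num_den -{1}[y]divq_num_den; field.
  by rewrite !intr_eq0 !denq_neq0.
have mul : monoid_morphism (ratr : rat -> K).
  split=> [|x y]; first exact: (ratr_int K 1).
  rewrite (E _ (numq x * numq y) (denq x * denq y)).
  - rewrite !intrM /ratr; field; rewrite !d0 //.
  - by rewrite mulf_neq0 ?denq_neq0.
  rewrite !intrM -{1}[x]divq_num_den -{1}[y]divq_num_den; field.
  by rewrite !intr_eq0 !denq_neq0.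
pose m1 := GRing.isZmodMorphism.Build rat K ratr add.
pose m2 := GRing.isMonoidMorphism.Build rat K ratr mul.
by exists (HB.pack_for {rmorphism rat -> K} (ratr : rat -> K) m1 m2).
Qed.

Lemma rmorph_ratrE (F : fieldType) (i : {rmorphism F -> K}) (rF : {rmorphism rat -> F}) q :
  i (rF q) = ratr q.
Proof.
have [rK <-] := ratr_rmorphism.
by rewrite -[q]divq_num_den !fmorph_div !rmorph_int.
Qed.

Definition rootsC (F : closedFieldType) (p : {poly F}) : seq F := sval (closed_field_poly_normal p).

Lemma mem_rootsC (F : closedFieldType) (p : {poly F}) x : p != 0 -> (x \in rootsC p) = root p x.
Proof.
move=> p0; rewrite /rootsC; case: closed_field_poly_normal => r /= E; rewrite [in RHS]E.
by rewrite rootZ ?lead_coef_eq0 // root_prod_XsubC.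
Qed.

(** On a finite list, send a primitive element to any root in [K] of its minimal polynomial. The
    possible images of [x] are roots of the minimal polynomial of [x], finite in number, so these
    local maps have a limit. *)
Lemma algC_embedding : exists i : {rmorphism algC -> K}, True.
Proof.
have [rK rKE] := ratr_rmorphism.
have mp (x : algC) : {p : {poly rat} | p != 0 & forall q, root (map_poly ratr q) x = (p %| q)}.
  have [p [_ /monic_neq0 p0] dv] := minCpolyP x; exists p => // q; exact: dv.
pose mpoly x := s2val (mp x).
have mp0 x : mpoly x != 0 := s2valP (mp x).
have mpd x q : root (map_poly ratr q) x = (mpoly x %| q) := s2valP' (mp x) q.
pose cand x := rootsC (map_poly rK (mpoly x)).
have loc (s : seq algC) : exists f : algC -> K, (forall x, x \in s -> f x \in cand x) /\
  morphic_on s f.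
  have [z _ [ps Es]] := algC_PET s.
  have sz : size (map_poly rK (mpoly z)) != 1%N.
    rewrite size_map_poly; apply/negP => /size_poly1P[c c0 E].
    have : root (map_poly ratr (mpoly z)) z by rewrite mpd.
    by rewrite E map_polyC rootC /= fmorph_eq0 (negPf c0).
  have /closed_rootP[z' rz'] := sz.
  pose P x := nth 0 ps (index x s).
  have szs : size ps = size s by rewrite Es size_map.
  have PE x : x \in s -> (map_poly ratr (P x)).[z] = x.
    move=> xs; have lt : (index x s < size ps)%N by rewrite szs index_mem.
    by rewrite -(nth_map 0 0 (fun p => (map_poly ratr p).[z]) lt) -Es nth_index.
  have tr q : (map_poly ratr q).[z] = 0 -> (map_poly rK q).[z'] = 0.
    move=> /eqP; rewrite -rootE mpd => /dvdpP[c ->].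
    by rewrite rmorphM hornerM /= (rootP rz') mulr0.
  exists (fun x => (map_poly rK (P x)).[z']); split=> [x xs|x y xs ys].
    rewrite mem_rootsC ?map_poly_eq0 // rootE -horner_comp -map_comp_poly.
    apply/eqP/tr; rewrite map_comp_poly horner_comp PE //.
    by apply/eqP; rewrite -rootE mpd.
  have tr2 q1 q2 : (map_poly ratr q1).[z] = (map_poly ratr q2).[z] ->
      (map_poly rK q1).[z'] = (map_poly rK q2).[z'].
    move=> E; apply/eqP; rewrite -subr_eq0 -hornerN -hornerD -rmorphN -rmorphD /=.
    by apply/eqP/tr; rewrite rmorphB /= hornerD hornerN E subrr.
  split=> [zs|zs|os].
  - have := tr2 (P (x - y)) (P x - P y).
    by rewrite !rmorphB /= !(hornerD, hornerN) !PE // => /(_ erefl).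
  - have := tr2 (P (x * y)) (P x * P y).
    by rewrite !rmorphM /= !hornerM !PE // => /(_ erefl).
  by have := tr2 (P 1) 1; rewrite !rmorph1 !hornerC PE // => /(_ erefl).
have [f fP] := boolp.choice loc.
have fc s x : x \in s -> f s x \in cand x by case: (fP s) => H _; apply: H.
have fm s : morphic_on s (f s) by case: (fP s).
by have [g _] := rmorphism_limit fc fm; exists g.
Qed.
End Embedding.

Lemma isVal_map (R S : idomainType) (i : {rmorphism R -> S}) (w : S -> rat) :
  injective i -> isVal w -> isVal (w \o i).
Proof.
move=> inj Hw; have i0 x : x != 0 -> i x != 0.
  by move=> x0; rewrite -(rmorph0 i) (inj_eq inj).
split=> [x y x0 y0|x y x0 y0 s0] /=; first by rewrite rmorphM (val_mul Hw) ?i0.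
by rewrite rmorphD; apply: (proj2 Hw); rewrite -?rmorphD ?i0.
Qed.

Lemma minCpoly_roots x : minCpoly x = \prod_(y <- rootsC (minCpoly x)) ('X - y%:P).
Proof.
rewrite /rootsC; case: closed_field_poly_normal => r /= E.
by rewrite [LHS]E (monicP (minCpoly_monic x)) scale1r.
Qed.

(** Normality is obtained by adjoining all conjugates of the members of [s]: the field splits the
    product of their minimal polynomials. *)
Lemma normal_num_field (s : seq algC) :
  exists (Q : splittingFieldType rat) (QC : {rmorphism Q -> algC}),
    forall x, x \in s -> exists y, QC y = x.
Proof.
pose S := flatten [seq rootsC (minCpoly x) | x <- s].
have [Qs [QsC [s1 Es gen]]] := num_field_exists S.
have /boolp.choice[mp mpE] : forall x, exists q : {poly rat}, minCpoly x = map_poly ratr q.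
  by move=> x; have [q [E _] _] := minCpolyP x; exists q.
have E1 : map_poly QsC (\prod_(r <- s1) ('X - r%:P)) = \prod_(y <- S) ('X - y%:P).
  by rewrite rmorph_prod /= -Es big_map; apply: eq_bigr => r _; rewrite map_polyXsubC.
have QratE : QsC \o in_alg Qs =1 ratr by move=> q; rewrite /= alg_num_field fmorph_rat.
have E2 : map_poly QsC (map_poly (in_alg Qs) (\prod_(x <- s) mp x)) = \prod_(y <- S) ('X - y%:P).
  rewrite -map_poly_comp (eq_map_poly QratE) rmorph_prod /S big_flatten big_map /=.
  by apply: eq_bigr => x _; rewrite -mpE; apply: minCpoly_roots.
have E3 := map_poly_inj _ (etrans E1 (esym E2)).
have ax : FieldExt_isSplittingField _ Qs.
  constructor; exists (\prod_(r <- s1) ('X - r%:P)); first by rewrite E3; apply/polyOver1P; eexists.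
  by exists s1; rewrite ?eqpxx ?gen.
exists (HB.pack_for (splittingFieldType rat) Qs ax), QsC => x xs.
have : x \in S.
  apply/flattenP; exists (rootsC (minCpoly x)); first exact: map_f.
  by rewrite mem_rootsC ?root_minCpoly // monic_neq0 ?minCpoly_monic.
by rewrite -Es => /mapP[y _ ->]; exists y.
Qed.

(** The candidates for the image of [x] are its conjugates. The identity for [h] involves only the
    finitely many coefficients of [h], so it survives the passage to the limit. *)
Theorem conj_global (w1 w2 : {poly algC} -> rat) : isVal w1 -> isVal w2 ->
  (forall f : {poly rat}, f != 0 -> w1 (map_poly ratr f) = w2 (map_poly ratr f)) ->
  exists t : {rmorphism algC -> algC}, forall h, h != 0 -> w2 h = w1 (map_poly t h).
Proof.
move=> H1 H2 agree.
have loc (s : seq algC) : exists f : algC -> algC, 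
  [/\ forall x, x \in s -> f x \in rootsC (minCpoly x),
   morphic_on s f &
   forall h : {poly algC}, h != 0 -> {subset (polyseq h) <= s} -> w2 h = w1 (map_poly f h)].
  have [Q [QC sQ]] := normal_num_field s.
  have inj : injective (map_poly QC) by apply: map_poly_inj.
  have [|t tG Ht] := @conj_local Q _ _ (isVal_map inj H1) (isVal_map inj H2).
    move=> f f0 /=; rewrite -map_poly_comp.
    have E : QC \o in_alg Q =1 ratr by move=> q; rewrite /= alg_num_field fmorph_rat.
    by rewrite !(eq_map_poly E) agree.
  have [CQ CQ0 CQK] := num_field_proj QC.
  have sK x : x \in s -> QC (CQ x) = x by case/sQ => y <-; rewrite CQK.
  exists (fun x => QC (t (CQ x))); split.
  - move=> x xs; rewrite mem_rootsC ?monic_neq0 ?minCpoly_monic //.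
    have [q [E _] _] := minCpolyP x.
    have := root_minCpoly x; rewrite -{2}(sK x xs) E.
    have <- : map_poly QC (map_poly (in_alg Q) q) = map_poly ratr q.
      by rewrite -map_poly_comp; apply: eq_map_poly => a; rewrite /= alg_num_field fmorph_rat.
    rewrite !fmorph_root => rq.
    have <- : map_poly t (map_poly (in_alg Q) q) = map_poly (in_alg Q) q.
  by rewrite -map_poly_comp; apply: eq_map_poly => a; rewrite /= rmorph_alg.
    by rewrite fmorph_root.
  - move=> x y /sQ[x' <-] /sQ[y' <-]; split; last by move=> _; rewrite -{1}(rmorph1 QC) CQK !rmorph1.
      by move=> _; rewrite -rmorphB !CQK !rmorphB.
    by move=> _; rewrite -rmorphM !CQK !rmorphM.
  move=> h h0 hs.
  have hE : map_poly QC (map_poly CQ h) = h.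
    apply/polyP => i; rewrite coef_map /= coef_map_id0 ?CQ0 //.
    have [lt|ge] := ltnP i (size h); first by rewrite sK // hs // mem_nth.
    by rewrite nth_default // CQ0 rmorph0.
  have h0' : map_poly CQ h != 0 by apply: contraNneq h0 => E; rewrite -hE E rmorph0.
  rewrite -{1}hE; have /= -> := Ht _ h0'; congr (w1 _).
  apply/polyP => i; rewrite !coef_map /= !coef_map_id0 ?CQ0 ?rmorph0 //.
have [f fP] := boolp.choice loc.
have fc s x : x \in s -> f s x \in rootsC (minCpoly x) by case: (fP s) => H _ _; apply: H.
have fm s : morphic_on s (f s) by case: (fP s).
have [g gP] := rmorphism_limit fc fm.
exists g => h h0; have [s [st E]] := gP h; have [_ _ ->] := fP s => //; congr (w1 _).
by rewrite !map_polyE; congr Poly; apply/eq_in_map => x xh; rewrite E.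
Qed.

(** * Discrete valuations and their rings *)

Section FieldVal.
Variables (F : fieldType) (w : F -> rat).
Hypothesis Hw : isVal w.

Lemma val_inv x : x != 0 -> w x^-1 = - w x.
Proof.
move=> x0; have := val_mul Hw x0 (invr_neq0 x0); rewrite divff // (val_one Hw) => H.
by rewrite -[LHS]addr0 -[0](subrr (w x)) addrA [_ + w x]addrC -H sub0r.
Qed.

Lemma val_div x y : x != 0 -> y != 0 -> w (x / y) = w x - w y.
Proof. by move=> x0 y0; rewrite (val_mul Hw) ?invr_neq0 // val_inv. Qed.

Lemma val_exprz x (m : int) : x != 0 -> w (x ^ m) = m%:~R * w x.
Proof.
move=> x0; case: m => k; first by rewrite -exprnP (val_exp Hw).
by rewrite NegzE -exprnN val_inv ?expf_neq0 // (val_exp Hw) // mulrNz mulNr.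
Qed.
End FieldVal.

Lemma fracE (R : idomainType) (x : {fraction R}) :
  exists f g : R, g != 0 /\ x = f%:F / g%:F.
Proof.
elim/quotW: x => r; exists (\n_r), (\d_r); have d0 := denom_ratioP r; split=> //.
have D0 : (\d_r)%:F != 0 by rewrite tofrac_eq0.
apply: (mulIf D0); rewrite divfK //; unlock FracField.tofrac.
rewrite -[LHS]FracField.pi_mul; apply/generic_quotient.eqmodP.
rewrite /= FracField.equivfE /FracField.mulf !numden_Ratio ?mulf_neq0 ?oner_neq0 //.
by rewrite !mulr1 mulrC.
Qed.

Section FractionVal.
Variables (R : idomainType) (w : R -> rat).
Hypothesis Hw : isVal w.

Definition valF (x : {fraction R}) : rat :=
  let: exist f H := boolp.cid (fracE x) in
  let: exist g _ := boolp.cid H in w f - w g.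

Lemma valFE f g : f != 0 -> g != 0 -> valF (f%:F / g%:F) = w f - w g.
Proof.
move=> f0 g0; rewrite /valF; case: boolp.cid => h H; case: boolp.cid => k [k0 E].
have h0 : h != 0.
  apply/eqP => h0; move/eqP: E; rewrite h0 tofrac0 mul0r mulf_eq0 invr_eq0 !tofrac_eq0.
  by rewrite (negPf f0) (negPf g0).
move/eqP: E; rewrite eqr_div ?tofrac_eq0 // -!tofracM tofrac_eq => /eqP E.
have := congr1 w E; rewrite !(val_mul Hw) // => ?; lra.
Qed.

Lemma valF_tofrac f : f != 0 -> valF f%:F = w f.
Proof. by move=> f0; rewrite -[f%:F]divr1 -tofrac1 valFE ?oner_neq0 // (val_one Hw) subr0. Qed.

Lemma frac_neq0E (x : {fraction R}) : x != 0 ->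
  exists f g : R, [/\ f != 0, g != 0 & x = f%:F / g%:F].
Proof.
move=> x0; have [f [g [g0 E]]] := fracE x; exists f, g; split=> //.
by apply: contraNneq x0 => f0; rewrite E f0 tofrac0 mul0r.
Qed.

Lemma isVal_valF : isVal valF.
Proof.
split=> x y /frac_neq0E[f [g [f0 g0 ->]]] /frac_neq0E[h [k [h0 k0 ->]]].
  by rewrite mulf_div -!tofracM !valFE ?mulf_neq0 // !(val_mul Hw) //; ring.
have gF : g%:F != 0 by rewrite tofrac_eq0.
have kF : k%:F != 0 by rewrite tofrac_eq0.
rewrite addf_div // -!tofracM -tofracD => s0.
have s1 : f * k + h * g != 0 by apply: contraNneq s0 => ->; rewrite tofrac0 mul0r.
have fk0 : f * k != 0 by rewrite mulf_neq0.
have hg0 : h * g != 0 by rewrite mulf_neq0.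
rewrite !valFE ?mulf_neq0 // (val_mul Hw) // ge_min.
have := proj2 Hw _ _ fk0 hg0 s1; rewrite ge_min !(val_mul Hw) //.
by case/orP => H; apply/orP; [left|right]; lra.
Qed.
End FractionVal.

Local Notation QX := {fraction {poly rat}}.

(** This has the shape of [Zring] with the valuation left abstract, so that finite and infinite
    radii are treated together. *)
Definition Zw (w : {poly rat} -> rat) (phi : QX) : Prop :=
  exists f g : {poly rat}, g != 0 /\ phi = f%:F / g%:F /\ (f = 0 \/ w g <= w f).

Definition extends_vpQ (p : nat) (w : {poly rat} -> rat) : Prop :=
  forall q : rat, q != 0 -> w q%:P = vpQ p q.

Lemma ZwE w : isVal w -> Zw w = (fun phi => vleb (valF w) 0 phi).
Proof.
move=> Hw; apply: boolp.funext => phi; apply: boolp.propext; split.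
  case=> f [g [g0 [-> [->|le]]]]; first by rewrite tofrac0 mul0r vleb0.
  have [->|f0] := eqVneq f 0; first by rewrite tofrac0 mul0r vleb0.
  by rewrite vlebE ?valFE ?subr_ge0 // mulf_neq0 ?invr_neq0 ?tofrac_eq0.
have [f [g [g0 ->]]] := fracE phi.
move=> h; exists f, g; do 2!split=> //.
have [->|f0] := eqVneq f 0; [by left|right].
by move: h; rewrite vlebE ?valFE ?subr_ge0 // mulf_neq0 ?invr_neq0 ?tofrac_eq0.
Qed.

(** * Normalisation on the constants, and discrete value groups *)

Section PadicConstants.
Variable p : nat.
Hypothesis pp : prime p.

Lemma vpQ_ge0 q : q != 0 -> (0 <= vpQ p q) = ~~ (p %| `|denq q|)%N.
Proof.
move=> q0; rewrite /vpQ ler0z subr_ge0 lez_nat.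
have d0 : (0 < `|denq q|)%N by rewrite absz_gt0 denq_neq0.
have n0 : (0 < `|numq q|)%N by rewrite absz_gt0 numq_eq0.
have [pd|pd] /= := boolP (p %| _)%N; last by rewrite lognE (negPf pd) !andbF.
have pn : ~~ (p %| `|numq q|)%N.
  apply/negP => pn; have := coprime_num_den q; rewrite /coprime => /eqP E.
  have : (p %| 1)%N by rewrite -E dvdn_gcd pn pd.
  by rewrite dvdn1 => /eqP E1; move: pp; rewrite E1.
by rewrite [logn p `|numq q|]lognE (negPf pn) !andbF leqNgt logn_gt0 mem_primes pp d0 pd.
Qed.

Lemma vpQ_p : vpQ p p%:R = 1.
Proof.
by rewrite /vpQ (numq_int p) (denq_int p) /= logn1 subr0 logn_prime // eqxx.
Qed.

(** An integer prime to [p] and its inverse are both [p]-integral, so it has value zero; all values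
    then follow from [u p%:R = 1]. *)
Lemma vpQ_unique (u : rat -> rat) : isVal u -> u p%:R = 1 ->
  (forall q, q != 0 -> ~~ (p %| `|denq q|)%N -> 0 <= u q) ->
  forall q, q != 0 -> u q = vpQ p q.
Proof.
move=> Hu up1 Hq.
have p0 : p%:R != 0 :> rat by rewrite lt0r_neq0 // ltr0n prime_gt0.
have unat n : (0 < n)%N -> u n%:R = (logn p n)%:R.
  move=> n0; have [m cop E] := pfactor_coprime pp n0.
  have m0 : (0 < m)%N by move: n0; rewrite E muln_gt0 => /andP[].
  have m0' : m%:R != 0 :> rat by rewrite lt0r_neq0 // ltr0n.
  have um : u m%:R = 0.
    apply/eqP; rewrite eq_le; apply/andP; split.
      rewrite -oppr_ge0 -(val_inv Hu) // Hq ?invr_neq0 //.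
      rewrite pmulrn denqVz; last by case: (m) m0.
      by rewrite -prime_coprime.
    by rewrite Hq // pmulrn denq_int dvdn1; apply/eqP => E1; move: pp; rewrite E1.
  have -> : (n%:R : rat) = m%:R * p%:R ^+ logn p n by rewrite -natrX -natrM -E.
  rewrite (val_mul Hu) ?expf_neq0 // um (val_exp Hu) // up1; ring.
have uint (z : int) : z != 0 -> u z%:~R = (logn p `|z|)%:R.
  move=> z0; rewrite -unat ?absz_gt0 //.
  case: (intP z) => [|n|n]; rewrite ?absz_nat ?abszN //.
  by rewrite mulrNz (val_opp Hu).
move=> q q0; rewrite -[in LHS](divq_num_den q) (val_div Hu) ?intr_eq0 ?numq_eq0 ?denq_neq0 //.
by rewrite !uint ?numq_eq0 ?denq_neq0 // /vpQ intrB.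
Qed.

(** The ring knows only comparisons of values. The powers of [p] supply the scale: if [w1 f] is
    [a / n] then [f ^+ n] and [p ^ a] have equal value for [w1], hence for [w2], and both valuations
    give [p] the value 1. *)
Lemma Zw_inj w1 w2 : isVal w1 -> isVal w2 -> extends_vpQ p w1 -> extends_vpQ p w2 ->
  (forall phi, Zw w1 phi <-> Zw w2 phi) -> forall f, f != 0 -> w1 f = w2 f.
Proof.
move=> H1 H2 E1 E2 EZ f f0.
have Zfg w : isVal w -> forall f g, f != 0 -> g != 0 -> Zw w (f%:F / g%:F) <-> w g <= w f.
  move=> Hw {f0}f g f0 g0; rewrite ZwE // vlebE ?valFE ?subr_ge0 //.
  by rewrite mulf_neq0 ?invr_neq0 ?tofrac_eq0.
have le g h : g != 0 -> h != 0 -> (w1 g <= w1 h) <-> (w2 g <= w2 h).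
  by move=> g0 h0; rewrite -!Zfg.
have eqv g h : g != 0 -> h != 0 -> w1 g = w1 h -> w2 g = w2 h.
  move=> g0 h0 E; apply/eqP; rewrite eq_le.
  by apply/andP; split; apply/le => //; rewrite E.
have p0 : p%:R != 0 :> rat by rewrite lt0r_neq0 // ltr0n prime_gt0.
pose c : rat := p%:R ^ numq (w1 f).
have c0 : c != 0 by rewrite expfz_neq0.
have cP w : isVal w -> extends_vpQ p w -> w c%:P = (numq (w1 f))%:~R.
  move=> Hw Ew; rewrite -[w _]/((w \o polyC) c).
  rewrite (val_exprz (isVal_map (@polyC_inj _) Hw)) //= Ew // vpQ_p; ring.
pose n := `|denq (w1 f)|%N.
have nE : n%:R = (denq (w1 f))%:~R :> rat by rewrite /n -[LHS]/(n%:~R) gez0_abs.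
have n0 : n%:R != 0 :> rat by rewrite nE intr_eq0 denq_neq0.
have fn0 : f ^+ n != 0 by rewrite expf_neq0.
have c0' : c%:P != 0 by rewrite polyC_eq0.
have : w2 (f ^+ n) = w2 c%:P.
  by apply: eqv => //; rewrite cP // (val_exp H1) // nE mulrC -numqE.
rewrite cP // (val_exp H2) // numqE -nE mulrC => /(mulIf n0) -> //.
Qed.

(** Choose [t] with [e%:R * V t] minimal among positive values ([n.+1] in the search keeps it
    positive); a nonzero remainder of a Euclidean division would give a smaller one. [S] is a
    predicate because the lemma serves both a whole field and the copy of Q(X) inside a larger
    field, where the full value group need not be discrete. *)
Lemma discrete_uniformizer (F : fieldType) (V : F -> rat) (S : F -> Prop) (e : nat) :
  isVal V -> (0 < e)%N -> (forall x y, S x -> S y -> S (x * y)) -> (forall x, S x -> S x^-1) ->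
  (exists x, [/\ S x, x != 0 & 0 < V x]) ->
  (forall x, S x -> x != 0 -> e%:R * V x \is a Num.int) ->
  exists t, [/\ S t, t != 0, 0 < V t &
    forall x, S x -> x != 0 -> exists m : int, V x = m%:~R * V t].
Proof.
move=> HV e0 SM SV [x0 [Sx0 x00 Vx0]] He.
have e0' : 0 < e%:R :> rat by rewrite ltr0n.
pose Q n := boolp.asbool (exists t : F, [/\ S t, t != 0 & e%:R * V t = n.+1%:R]).
have exQ : exists n, Q n.
  have /intrP[m mE] := He x0 Sx0 x00.
  have m0 : 0 < m by rewrite -(ltr0z rat) -mE mulr_gt0.
  exists `|m|.-1; apply/boolp.asboolP; exists x0; split=> //.
  by rewrite prednK ?absz_gt0 ?gt_eqF // mE -{1}(gez0_abs (ltW m0)) -pmulrn.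
case: (ex_minnP exQ) => n /boolp.asboolP[t [St t0 tE]] nmin.
have Vt : 0 < V t by rewrite -(pmulr_rgt0 _ e0') tE ltr0Sn.
have SX k : S (t ^+ k.+1).
  by elim: k => [|k IH]; rewrite ?expr1 // exprS; apply: SM.
have S1 : S 1 by rewrite -(divff t0); apply: SM => //; apply: SV.
have Sz (m : int) : S (t ^ m).
  by case: m => [[|k]|k]; rewrite ?NegzE -?exprnN -?exprnP ?expr0 //; apply: SV.
exists t; split=> // x Sx xn0; have /intrP[m mE] := He x Sx xn0.
have n0 : n.+1%:Z != 0 by [].
have [q [r [mD r0 rn]]] : exists q r : int, [/\ m = q * n.+1%:Z + r, 0 <= r & r < n.+1%:Z].
  exists (m %/ n.+1)%Z, (m %% n.+1)%Z; split; first exact: divz_eq.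
    exact: modz_ge0.
  exact: ltz_pmod.
have tq0 : t ^ q != 0 by apply: expfz_neq0.
have u0 : x / t ^ q != 0 by apply: mulf_neq0 => //; apply: invr_neq0.
have uE : e%:R * V (x / t ^ q) = r%:~R.
  rewrite (val_div HV) // mulrBr mE mD (val_exprz HV) // mulrCA tE.
  by rewrite intrD intrM -pmulrn addrC addKr.
exists q; move: uE; rewrite (val_div HV) // (val_exprz HV) //.
have [->|rn0] := eqVneq r 0.
  move/eqP; rewrite mulf_eq0 gt_eqF //= subr_eq0 => /eqP //.
move=> uE; exfalso; have rp : (0 < `|r|)%N by rewrite absz_gt0.
have := nmin `|r|.-1; rewrite leqNgt => /implyP; rewrite implybN.
have -> : Q `|r|.-1.
  apply/boolp.asboolP; exists (x / t ^ q); split=> //; first by apply: SM => //; apply: SV.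
  rewrite (val_div HV) // (val_exprz HV) // uE prednK // -{1}(gez0_abs r0) -pmulrn //.
by rewrite -ltnS prednK // -ltz_nat gez0_abs // rn.
Qed.

Lemma discrete_DVR (F : fieldType) (V : F -> rat) (e : nat) : isVal V -> (0 < e)%N ->
  (exists2 x, x != 0 & 0 < V x) -> (forall x, x != 0 -> e%:R * V x \is a Num.int) ->
  exists t, [/\ vleb V 0 t, t != 0, ~~ vleb V 0 t^-1,
    forall x, vleb V 0 x -> x != 0 ->
      exists u n, [/\ vleb V 0 u, u != 0, vleb V 0 u^-1 & x = u * t ^+ n] &
    forall x, exists k, vleb V 0 (x * t ^+ k)].
Proof.
move=> HV e0 ex eV; have ex' : exists x, [/\ True, x != 0 & 0 < V x] by have [x x0 Vx] := ex; exists x.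
have [t [_ t0 Vt tV']] := @discrete_uniformizer F V (fun=> True) e HV e0
  (fun _ _ _ _ => I) (fun _ _ => I) ex' (fun x _ => eV x).
have tV x : x != 0 -> exists m : int, V x = m%:~R * V t by apply: tV'.
exists t; split=> //.
- by rewrite vlebE // ltW.
- by rewrite vlebE ?invr_neq0 // (val_inv HV) // oppr_ge0 -ltNge.
- move=> x + x0; rewrite vlebE // => Vx0; have [m mE] := tV x x0.
  have m0 : 0 <= m by move: Vx0; rewrite mE pmulr_lge0 // ler0z.
  have tm0 : t ^+ `|m| != 0 by apply: expf_neq0.
  have u0 : x / t ^+ `|m| != 0 by apply: mulf_neq0 => //; apply: invr_neq0.
  have uE : V (x / t ^+ `|m|) = 0.
    by rewrite (val_div HV) // (val_exp HV) // mE -{1}(gez0_abs m0) -pmulrn subrr.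
  exists (x / t ^+ `|m|), `|m|%N; split; rewrite ?divfK //.
    by rewrite vlebE // uE.
  by rewrite vlebE ?invr_neq0 // (val_inv HV) // uE oppr0.
move=> x; have [->|x0] := eqVneq x 0; first by exists 0%N; rewrite mul0r vleb0.
exists (Num.bound `|- V x / V t|).
rewrite vlebE ?mulf_neq0 ?expf_neq0 // (val_mul HV) ?expf_neq0 //.
rewrite (val_exp HV) // -lerBlDl sub0r -ler_pdivrMr //.
exact: le_trans (ler_norm _) (ltW (archi_boundP (normr_ge0 _))).
Qed.

Theorem Zw_isWp w e : isVal w -> extends_vpQ p w -> (0 < e)%N ->
  (forall f, f != 0 -> e%:R * w f \is a Num.int) -> isWp p (Zw w).
Proof.
move=> Hw Ew e0 He; rewrite ZwE //; set V := valF w; have HV : isVal V := isVal_valF Hw.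
have eV x : x != 0 -> e%:R * V x \is a Num.int.
  move=> /frac_neq0E[f [g [f0 g0 ->]]]; rewrite /V valFE // mulrBr.
  by rewrite rpredB ?He.
have p0 : p%:R != 0 :> rat by rewrite lt0r_neq0 // ltr0n prime_gt0.
have Vc q : q != 0 -> V (q%:P)%:F = vpQ p q.
  by move=> q0; rewrite /V valF_tofrac ?polyC_eq0 // Ew.
have [|t [Wt t0 Wti tU tD]] := discrete_DVR HV e0 _ eV.
  exists ((p%:R : rat)%:P)%:F; first by rewrite tofrac_eq0 polyC_eq0.
  by rewrite Vc // vpQ_p.
split.
- split; first split.
  + exact: (vleb1 HV).
  + by move=> x y; apply: (vlebB HV).
  + by move=> x y; apply: (vlebM0l HV).
  exists t; split; [exact: Wt | exact: t0 | by case=> _ _; apply/negP |].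
  move=> x Wx x0; have [u [n [Wu u0 Wui E]]] := tU x Wx x0.
  by exists u, n; split; [split; [exact: Wu | exact: u0 | exact: Wui] | exact: E].
- move=> phi; have [k Hk] := tD phi; exists (phi * t ^+ k), (t ^+ k).
  have tk0 : t ^+ k != 0 := expf_neq0 k t0.
  split; [exact: Hk | exact: (vlebX0 HV k Wt) | exact: tk0 |].
  by rewrite (mulfK tk0).
move=> q; have [->|q0] := eqVneq q 0.
  rewrite tofrac0 vleb0 /= dvdn1; split=> // _.
  by apply/eqP => p1; move: pp; rewrite p1.
by rewrite vlebE ?tofrac_eq0 ?polyC_eq0 // Vc // vpQ_ge0.
Qed.

End PadicConstants.

(** Every nonzero element is a unit times an integral power of [t], and the exponent is unique
    because a power of [t] is a unit only for exponent zero. *)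
Lemma DVR_ord (F : fieldType) (W : F -> Prop) (t : F) :
  W 1 -> (forall x y, W x -> W y -> W (x - y)) -> (forall x y, W x -> W y -> W (x * y)) ->
  W t -> t != 0 -> ~ W t^-1 ->
  (forall x, W x -> x != 0 ->
     exists u n, [/\ W u, u != 0, W u^-1 & x = u * t ^+ n]) ->
  (forall x, exists a b, [/\ W a, W b, b != 0 & x = a / b]) ->
  exists ord : F -> int,
    [/\ forall x y, x != 0 -> y != 0 -> ord (x * y) = ord x + ord y,
        forall x, x != 0 -> W x <-> 0 <= ord x &
        forall x y, x != 0 -> y != 0 -> x + y != 0 ->
          Num.min (ord x) (ord y) <= ord (x + y)].
Proof.
move=> W1 WB WM Wt t0 Wti dvr quo.
have WX x n : W x -> W (x ^+ n) by move=> Wx; elim: n => [|n IH]; rewrite ?expr0 // exprS; apply: WM.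
pose un u := [/\ W u, u != 0 & W u^-1].
have unM u u' : un u -> un u' -> un (u * u').
  by case=> a b c [a' b' c']; split; [exact: WM | exact: mulf_neq0 | rewrite invfM; exact: WM].
have unV u : un u -> un u^-1.
  by case=> a b c; split; rewrite ?invrK ?invr_eq0.
have tz m : t ^ m != 0 by apply: expfz_neq0.
have un_t (m : int) : un (t ^ m) -> m = 0.
  have pos k : ~ un (t ^ k.+1%:Z).
    case=> _ _; rewrite -exprnP => h; apply: Wti.
    have := WM _ _ (WX t k Wt) h; rewrite exprS invfM mulrCA divff ?mulr1 //.
    exact: expf_neq0.
  case: m => [[|k]|k] // h; exfalso; first exact: (pos k).
  by apply: (pos k); have := unV _ h; rewrite NegzE -exprnN invrK.
have /boolp.choice[ord ordP] : forall x, exists m : int, x != 0 -> un (x / t ^ m).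
  move=> x; have [->|x0] := eqVneq x 0; first by exists 0.
  have [a [b [Wa Wb b0 E]]] := quo x.
  have a0 : a != 0 by apply: contraNneq x0 => a0; rewrite E a0 mul0r.
  have [u [n [Wu u0 Wui aE]]] := dvr a Wa a0.
  have [u' [n' [Wu' u0' Wui' bE]]] := dvr b Wb b0.
  exists (n%:Z - n'%:Z) => _.
  have -> : x / t ^ (n%:Z - n'%:Z) = u / u'.
    rewrite E aE bE expfzDr // -invr_expz -!exprnP.
    by field; rewrite u0' !expf_neq0.
  by apply: unM => //; apply: unV.
have uniq x m : x != 0 -> un (x / t ^ m) -> ord x = m.
  move=> x0 h; apply/eqP; rewrite -subr_eq0; apply/eqP/un_t.
  have -> : t ^ (ord x - m) = (x / t ^ m) / (x / t ^ ord x).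
    by rewrite expfzDr // -invr_expz; field; rewrite x0 !tz.
  by apply: unM h (unV _ (ordP x x0)).
have ordM x y : x != 0 -> y != 0 -> ord (x * y) = ord x + ord y.
  move=> x0 y0; apply: uniq; first exact: mulf_neq0.
  rewrite expfzDr // invfM mulrACA; apply: unM; exact: ordP.
have ordW x : x != 0 -> W x <-> 0 <= ord x.
  move=> x0; have [a b c] := ordP x x0; split.
    case E : (ord x) a b c => [k|k] // a b c Wx; exfalso; apply: Wti.
    have : W (t ^- k.+1).
      have := WM _ _ Wx c; rewrite invf_div mulrCA mulfV // mulr1.
      by rewrite NegzE -exprnN.
    move=> h; have := WM _ _ (WX t k Wt) h; rewrite exprS invfM mulrCA divff ?mulr1 //.
    exact: expf_neq0.
  move=> h; have := WM _ _ a (WX t `|ord x|%N Wt).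
  by rewrite exprnP gez0_abs // divfK.
(* Factor [x + y = x * (1 + y / x)]: the second factor lies in [W], so its order is nonnegative. *)
have le x y : x != 0 -> y != 0 -> x + y != 0 -> ord x <= ord y -> ord x <= ord (x + y).
  move=> x0 y0 s0 le; have z0 : y / x != 0 by rewrite mulf_neq0 ?invr_neq0.
  have e : ord (y / x) = ord y - ord x.
    by apply/eqP; rewrite eq_sym subr_eq -ordM // divfK.
  have Wz : W (y / x) by apply/ordW; rewrite // e subr_ge0.
  have sE : x + y = x * (1 + y / x) by rewrite mulrDr mulr1 mulrCA divff // mulr1.
  have n0 : 1 + y / x != 0 by apply: contraNneq s0 => h; rewrite sE h mulr0.
  rewrite sE ordM // lerDl; apply/ordW => //.
  have W0 : W 0 by rewrite -(subrr 1); apply: WB.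
  have -> : 1 + y / x = 1 - (0 - y / x) by rewrite sub0r opprK.
  by apply: (WB _ _ W1); apply: (WB _ _ W0).
exists ord; split=> // x y x0 y0 s0.
have [h|/ltW h] := lerP (ord x) (ord y); first exact: le.
by rewrite addrC le // addrC.
Qed.

(** The order function of [W] is divided by [e], the order of [p], so that [p] gets value 1; the
    condition on constants then forces the p-adic valuation by [vpQ_unique]. *)
Theorem isWp_val (p : nat) (W : QX -> Prop) : prime p -> isWp p W ->
  exists (w : {poly rat} -> rat) (e : nat),
    [/\ isVal w, extends_vpQ p w, (0 < e)%N,
      forall f, f != 0 -> e%:R * w f \is a Num.int & forall phi, W phi <-> Zw w phi].
Proof.
move=> pp [[[W1 WB WM] [t [Wt t0 Wtu dvr]]] quo WQ].
have [||ord [oM oW oD]] := @DVR_ord _ W t W1 WB WM Wt t0 _ _ quo.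
- by move=> Wti; apply: Wtu; split.
- by move=> x Wx x0; have [u [n [[Wu u0 Wui] E]]] := dvr x Wx x0; exists u, n; split.
have p0 : p%:R != 0 :> rat by rewrite lt0r_neq0 // ltr0n prime_gt0.
have dp : ~~ (p %| `|denq p%:R|)%N.
  by rewrite pmulrn denq_int dvdn1; apply/eqP => E1; move: pp; rewrite E1.
have dpi : (p %| `|denq p%:R^-1|)%N.
  rewrite pmulrn denqVz ?normr_nat ?absz_nat ?dvdnn //.
  by rewrite -(intr_eq0 rat) -pmulrn.
pose cst (q : rat) : QX := (q%:P)%:F.
have cF (q : rat) : q != 0 -> cst q != 0 by rewrite tofrac_eq0 polyC_eq0.
have cM q r : cst (q * r) = cst q * cst r by rewrite /cst polyCM tofracM.
have WQ' q : q != 0 -> 0 <= ord (cst q) <-> ~~ (p %| `|denq q|)%N.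
  move=> q0; split=> [h|/WQ h]; first by apply/WQ/(oW _ (cF _ q0)).
  exact/(oW _ (cF _ q0)).
have o1 : ord 1 = 0.
  have := oM _ _ (oner_neq0 QX) (oner_neq0 QX).
  by rewrite mulr1 => /eqP; rewrite -subr_eq0 opprD addNKr oppr_eq0 => /eqP.
(* If [p] had order zero, [1 / p] would also lie in [W], whose constants are [p]-integral. *)
have op1 : 0 < ord (cst p%:R).
  rewrite lt_neqAle (WQ' _ p0).2 // andbT; apply/negP => /eqP E.
  have := oM _ _ (cF _ p0) (cF _ (invr_neq0 p0)).
  rewrite -cM divff; last exact: p0.
  rewrite [cst 1]tofrac1 o1 -E add0r => E2.
  by have := (WQ' _ (invr_neq0 p0)).1; rewrite -E2 lexx dpi => /(_ isT).
pose e := `|ord (cst p%:R)|%N.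
have e0 : (0 < e)%N by rewrite absz_gt0 gt_eqF.
have eE : ord (cst p%:R) = e%:Z by rewrite /e gez0_abs // ltW.
have e0' : e%:R != 0 :> rat by rewrite lt0r_neq0 // ltr0n.
have e0p : 0 < e%:R^-1 :> rat by rewrite invr_gt0 ltr0n.
pose w (f : {poly rat}) : rat := (ord f%:F)%:~R / e%:R.
have Hw : isVal w.
  split=> [f g f0 g0|f g f0 g0 s0]; rewrite /w.
    by rewrite tofracM oM ?tofrac_eq0 // intrD mulrDl.
  rewrite ge_min !ler_pM2r // !ler_int -ge_min.
  by rewrite tofracD; apply: oD; rewrite -?tofracD tofrac_eq0.
exists w, e; split=> //.
- have Hc : isVal (w \o polyC) := isVal_map (@polyC_inj _) Hw.
  apply: (vpQ_unique pp Hc); first by rewrite /w /= -/(cst _) eE -pmulrn divff.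
  by move=> q q0 /(WQ' _ q0) h; rewrite /w /= -/(cst _) divr_ge0 ?ler0n // ler0z h.
- by move=> f f0; rewrite /w mulrC divfK // intr_int.
have W0 : W 0 by rewrite -(subrr 1); apply: WB.
move=> phi; rewrite ZwE //.
have [->|] := eqVneq phi 0; first by rewrite vleb0.
move/frac_neq0E => [f [g [f0 g0 ->]]].
have fg0 : f%:F / g%:F != 0 by rewrite mulf_neq0 ?invr_eq0 ?tofrac_eq0.
have gF : g%:F != 0 by rewrite tofrac_eq0.
apply: (iff_trans (oW _ fg0)).
rewrite (vlebE _ _ fg0) (valFE Hw f0 g0) subr_ge0 /w (ler_pM2r e0p) ler_int.
have := oM _ _ fg0 gF; rewrite (divfK gF) => ->.
by rewrite lerDr.
Qed.

(** * Monomial valuations and isometries of the completion *)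

Lemma closed_val_eq (F : closedFieldType) (w1 w2 : {poly F} -> rat) :
  isVal w1 -> isVal w2 -> (forall c, c != 0 -> w1 c%:P = w2 c%:P) ->
  (forall c, w1 ('X - c%:P) = w2 ('X - c%:P)) -> forall h, h != 0 -> w1 h = w2 h.
Proof.
move=> H1 H2 Hc Hl h h0; have [r ->] := closed_field_poly_normal h.
have l0 : lead_coef h != 0 by rewrite lead_coef_eq0.
have X0 (c : F) : true -> 'X - c%:P != 0 by rewrite monic_neq0 ?monicXsubC.
have P0 : \prod_(z <- r) ('X - z%:P) != 0 by rewrite monic_neq0 ?monic_prod_XsubC.
rewrite -mul_polyC (val_mul H1) ?polyC_eq0 // (val_mul H2) ?polyC_eq0 // Hc //.
rewrite (val_prod H1) // (val_prod H2) //; congr (_ + _).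
by apply: eq_bigr => z _; rewrite Hl.
Qed.

Section Vmono.
Variables (K : closedFieldType) (v : K -> rat).
Hypothesis Hv : isVal v.

Lemma vmonoE a r h : vmono v a r h = gaussv v r (h \Po ('X + a%:P)).
Proof. by []. Qed.

Lemma comp_polyXaddC_inj (a : K) : injective (comp_poly ('X + a%:P)).
Proof.
apply: (can_inj (g := comp_poly ('X - a%:P))) => h.
by rewrite -comp_polyA comp_polyD comp_polyX comp_polyC subrK comp_polyXr.
Qed.

Lemma isVal_vmono a r : isVal (vmono v a r).
Proof. exact: (isVal_map (@comp_polyXaddC_inj a) (isVal_gaussv Hv r)). Qed.

Lemma vmonoC a r c : c != 0 -> vmono v a r c%:P = v c.
Proof. by move=> c0; rewrite vmonoE comp_polyC gaussvC. Qed.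

Definition vmin (r : rat) (x : K) : rat := if x == 0 then r else Num.min (v x) r.

Lemma vmin_ge r n x : n <= r -> (n <= vmin r x) = vleb v n x.
Proof.
by rewrite /vmin /vleb => nr; case: eqP => //= _; rewrite le_min nr andbT.
Qed.

Lemma vmin_le r x : vmin r x <= r.
Proof. by rewrite /vmin; case: eqP => // _; rewrite ge_min lexx orbT. Qed.

Lemma vmin_vleb r x : vleb v (vmin r x) x.
Proof. by rewrite -(@vmin_ge r) ?vmin_le. Qed.

Lemma vmono_XsubC a r c : vmono v a r ('X - c%:P) = vmin r (a - c).
Proof.
rewrite vmonoE comp_polyB comp_polyX comp_polyC -addrA -opprB -polyCB.
rewrite gaussv_XsubC // /vmin !subr_eq0 eq_sym; case: eqP => // _.
by rewrite -(val_opp Hv) opprB.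
Qed.

(** Both sides are at most [r], and for thresholds up to [r] every point of the ball serves as its
    centre. *)
Lemma vmin_ball r a b c : vleb v r (a - b) -> vmin r (a - c) = vmin r (b - c).
Proof.
move=> ab.
have H x y : vleb v r (x - y) -> forall n, n <= r -> vleb v n (x - c) -> vleb v n (y - c).
  move=> xy n nr h; apply: (vleb_trans Hv _ h); rewrite (vlebBC Hv).
  exact: vlebW nr xy.
have ba : vleb v r (b - a) by rewrite (vlebBC Hv).
apply/eqP; rewrite eq_le; apply/andP; split.
  by rewrite vmin_ge ?vmin_le //; apply: (H a); rewrite ?vmin_le ?vmin_vleb.
by rewrite vmin_ge ?vmin_le //; apply: (H b); rewrite ?vmin_le ?vmin_vleb.
Qed.

Lemma vmono_ball r a b h : vleb v r (a - b) -> h != 0 -> vmono v a r h = vmono v b r h.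
Proof.
move=> ab; apply: closed_val_eq; try exact: isVal_vmono.
  by move=> c c0; rewrite !vmonoC.
by move=> c; rewrite !vmono_XsubC; apply: vmin_ball.
Qed.

Lemma gaussv_map (s : {rmorphism K -> K}) r c : (forall x, x != 0 -> v (s x) = v x) ->
  gaussv v r (map_poly s c) = gaussv v r c.
Proof.
move=> Hs; rewrite /gaussv size_map_poly.
have -> // : [seq v (map_poly s c)`_i + i%:R * r | i <- iota 0 (size c) & (map_poly s c)`_i != 0]
  = [seq v c`_i + i%:R * r | i <- iota 0 (size c) & c`_i != 0].
have -> : [seq i <- iota 0 (size c) | (map_poly s c)`_i != 0] =
          [seq i <- iota 0 (size c) | c`_i != 0].
  by apply: eq_filter => i; rewrite coef_map fmorph_eq0.
by apply/eq_in_map => i; rewrite mem_filter => /andP[ci _]; rewrite coef_map Hs.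
Qed.
End Vmono.

(** * Density of the algebraic numbers and extension of isometries to the completion *)

Section CpTheory.
Variables (p : nat) (K : closedFieldType) (v : K -> rat).
Hypotheses (pp : prime p) (HC : isCp p v).

Lemma Cp_isVal : isVal v.
Proof. by case: HC => _ [H1 H2 _ _ _]; split. Qed.
Let Hv := Cp_isVal.

Lemma Cp_ratr0 (q : rat) : q != 0 -> ratr q != 0 :> K.
Proof. by case: HC => H _; apply: H. Qed.

Lemma Cp_ratr q : q != 0 -> v (ratr q) = vpQ p q.
Proof. by case: HC => _ [_ _ H _ _]; apply: H. Qed.

Lemma vgeP x n : vge v x n <-> vleb v n x.
Proof. by split=> [[->|h]|/orP[/eqP|]]; [exact: vleb0 | rewrite /vleb h orbT | left | right]. Qed.

Lemma Cp_complete (u : nat -> K) :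
  (forall n : rat, exists N : nat, forall i j : nat,
     (N <= i)%N -> (N <= j)%N -> vleb v n (u i - u j)) ->
  exists l : K, forall n : rat, exists N : nat, forall i : nat,
     (N <= i)%N -> vleb v n (u i - l).
Proof.
move=> H; case: HC => _ [_ _ _ /(_ u) cpl _]; case: cpl.
  move=> n; have [N HN] := H n; exists N => i j Ni Nj; apply/vgeP; exact: HN.
move=> l Hl; exists l => n; have [N HN] := Hl n; exists N => i Ni; apply/vgeP; exact: HN.
Qed.

Lemma vleb_all0 x : (forall n, vleb v n x) -> x = 0.
Proof.
move=> H; apply/eqP; apply: contraT => x0.
by have := H (v x + 1); rewrite vlebE // leNgt ltrDl ltr01.
Qed.

Implicit Types (i : {rmorphism algC -> K}).

Lemma embed_ratr i q : i (ratr q) = ratr q.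
Proof. exact: (rmorph_ratrE Cp_ratr0). Qed.

Lemma embed_map_ratr i (f : {poly rat}) : map_poly i (map_poly ratr f) = map_poly ratr f.
Proof. by rewrite -map_poly_comp; apply: eq_map_poly => q; apply: embed_ratr. Qed.

Lemma root_embed i (f : {poly algC}) y : f != 0 -> root (map_poly i f) y -> exists c, y = i c.
Proof.
move=> f0; have [r ->] := closed_field_poly_normal f.
rewrite linearZ /= rootZ ?fmorph_eq0 ?lead_coef_eq0 // rmorph_prod.
rewrite (eq_bigr (fun z => 'X - (i z)%:P)); last by move=> z _; rewrite /= map_polyXsubC.
rewrite -(big_map i predT (fun z => 'X - z%:P)) root_prod_XsubC.
by case/mapP => c _ ->; exists c.
Qed.

(** The algebraic approximations provided by [isCp] are roots of rational polynomials, and [algC]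
    already contains all such roots; so every embedding of [algC] has dense image. *)
Lemma embed_dense i x n : exists c, vleb v n (x - i c).
Proof.
case: HC => _ [_ _ _ _ /(_ x n)[y [[f [f0 rf]] /vgeP h]]].
have [||c yE] := @root_embed i (map_poly ratr f) y.
- by rewrite map_poly_eq0.
- by rewrite embed_map_ratr.
by exists c; rewrite -yE.
Qed.

Section Extend.
Variables (i1 i2 : {rmorphism algC -> K}).
Hypothesis Hiso : forall c, c != 0 -> v (i1 c) = v (i2 c).

Lemma iso_vleb n c : vleb v n (i1 c) = vleb v n (i2 c).
Proof.
have [->|c0] := eqVneq c 0; first by rewrite !rmorph0.
by rewrite !vlebE ?fmorph_eq0 // Hiso.
Qed.

(** The limit is characterised by all approximations of [x] at once rather than by the chosen
    sequence; uniqueness and the ring laws of the extension follow from this form. *)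
Lemma extend_limit x : exists l, forall n c, vleb v n (x - i1 c) -> vleb v n (l - i2 c).
Proof.
have /boolp.choice[c cP] : forall k : nat, exists c, vleb v k%:R (x - i1 c).
  by move=> k; apply: embed_dense.
have near n : exists N, forall k, (N <= k)%N -> vleb v n (x - i1 (c k)).
  exists (Num.bound `|n|) => k Nk; apply: vlebW (cP k).
  apply: le_trans (ler_norm _) _; apply: le_trans (ltW (archi_boundP (normr_ge0 _))) _.
  by rewrite ler_nat.
have [|l lP] := @Cp_complete (fun k => i2 (c k)).
  move=> n; have [N HN] := near n; exists N => k k' Nk Nk'.
  rewrite -rmorphB -iso_vleb rmorphB.
  by apply: (vleb_trans Hv (y := x)); rewrite ?(vlebBC Hv _ _ x) HN.
exists l => n b xb; have [N HN] := near n; have [M HM] := lP n.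
pose k := maxn N M.
apply: (vleb_trans Hv (y := i2 (c k))).
  by rewrite (vlebBC Hv) HM // leq_maxr.
rewrite -rmorphB -iso_vleb rmorphB; apply: (vleb_trans Hv (y := x)) => //.
by rewrite (vlebBC Hv) HN // leq_maxl.
Qed.

Lemma extend_isometry : exists s : {rmorphism K -> K},
  (forall c, s (i1 c) = i2 c) /\ (forall x, x != 0 -> v (s x) = v x).
Proof.
have [s sP] := boolp.choice extend_limit.
(* To identify [s z] with [l] it suffices to approximate [z] and [l] simultaneously by images of the
   same algebraic numbers. *)
have uniq z l : (forall n, exists2 c, vleb v n (z - i1 c) & vleb v n (l - i2 c)) -> s z = l.
  move=> H; apply/eqP; rewrite -subr_eq0; apply/eqP/vleb_all0 => n.
  have [c h1 h2] := H n; apply: (vleb_trans Hv (sP _ _ _ h1)).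
  by rewrite (vlebBC Hv).
have sC c : s (i1 c) = i2 c.
  by apply: uniq => n; exists c; rewrite subrr vleb0.
have sB : zmod_morphism s.
  move=> x y; apply: uniq => n; have [a ha] := embed_dense i1 x n.
  have [b hb] := embed_dense i1 y n; exists (a - b).
    have -> : x - y - i1 (a - b) = (x - i1 a) - (y - i1 b) by rewrite rmorphB; ring.
    exact: (vlebB Hv).
  have -> : s x - s y - i2 (a - b) = (s x - i2 a) - (s y - i2 b) by rewrite rmorphB; ring.
  by apply: (vlebB Hv); apply: sP.
have sM : monoid_morphism s.
  split=> [|x y]; first by rewrite -{1}(rmorph1 i1) sC rmorph1.
  apply: uniq => n.
  have [B [Bx By Bsx Bsy]] : exists B, [/\ vleb v B x, vleb v B y, vleb v B (s x) & vleb v B (s y)].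
    exists (Num.min (Num.min (v x) (v y)) (Num.min (v (s x)) (v (s y)))).
    by split; apply: vlebW (vleb_refl _ _); rewrite !ge_min lexx ?orbT.
  (* [B] bounds the four factors from below. Precision [n - B] on each factor gives [n] on the
     product, and precision [B] keeps the approximants themselves above [B]. *)
  pose m := Num.max B (n - B).
  have mB : B <= m by rewrite le_max lexx.
  have mn : n <= B + m by rewrite -lerBlDl le_max lexx orbT.
  have [a ha] := embed_dense i1 x m; have [b hb] := embed_dense i1 y m.
  have key z t z' t' : vleb v B z -> vleb v B t -> vleb v m (z - z') -> vleb v m (t - t') ->
      vleb v n (z * t - z' * t').
    move=> Bz Bt hz ht; have Bt' : vleb v B t'.
      by rewrite -[t'](subKr t) (vlebB Hv) // (vlebW mB).
    have -> : z * t - z' * t' = z * (t - t') + t' * (z - z') by ring.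
    by apply: (vlebD Hv); apply: (vlebW mn); apply: (vlebM Hv).
  by exists (a * b); rewrite rmorphM; apply: key => //; apply: sP.
pose m1 := GRing.isZmodMorphism.Build K K s sB.
pose m2 := GRing.isMonoidMorphism.Build K K s sM.
exists (HB.pack_for {rmorphism K -> K} s m1 m2); split=> //= x x0.
(* Beyond precision [v x] the approximation has the same value as [x]. *)
have [c hc] := embed_dense i1 x (v x + 1).
have lt : v x < v x + 1 by rewrite ltrDl.
have [c0 E] := val_near Hv x0 lt hc.
have c0' : i2 c != 0 by rewrite fmorph_eq0 -(fmorph_eq0 i1).
have := sP x _ _ hc; rewrite (vlebBC Hv) => hs.
have cv : v (i2 c) < v x + 1 by rewrite -Hiso ?E // -(fmorph_eq0 i1).
have [_ ->] := val_near Hv c0' cv hs; rewrite -Hiso ?E //.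
by rewrite -(fmorph_eq0 i1).
Qed.
End Extend.

(** Exchanging the two embeddings yields the inverse. Elements of Q_p are fixed because both
    embeddings agree on Q, which is dense in Q_p. *)
Lemma extend_inGp (i1 i2 : {rmorphism algC -> K}) :
  (forall c, c != 0 -> v (i1 c) = v (i2 c)) -> exists s : {rmorphism K -> K},
  [/\ inGp v s, forall c, s (i1 c) = i2 c & forall x, x != 0 -> v (s x) = v x].
Proof.
move=> Hiso; have [s [sC sV]] := extend_isometry Hiso.
have [s' [sC' sV']] := extend_isometry (fun c c0 => esym (Hiso c c0)).
have svleb n x : vleb v n x -> vleb v n (s x).
  have [->|x0] := eqVneq x 0; first by rewrite rmorph0.
  by rewrite !vlebE ?fmorph_eq0 // sV.
have svleb' n x : vleb v n x -> vleb v n (s' x).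
  have [->|x0] := eqVneq x 0; first by rewrite rmorph0.
  by rewrite !vlebE ?fmorph_eq0 // sV'.
exists s; split=> //; split.
- exists s' => x; apply/eqP; rewrite -subr_eq0; apply/eqP/vleb_all0 => n.
    have [c hc] := embed_dense i1 x n.
    apply: (vleb_trans Hv (y := i1 c)); last by rewrite (vlebBC Hv).
    by rewrite -[i1 c]sC' -sC -!rmorphB; apply/svleb'/svleb.
  have [c hc] := embed_dense i2 x n.
  apply: (vleb_trans Hv (y := i2 c)); last by rewrite (vlebBC Hv).
  by rewrite -[i2 c]sC -sC' -!rmorphB; apply/svleb/svleb'.
- move=> x n; exists n => y /vgeP h; apply/vgeP; rewrite -rmorphB; exact: svleb.
move=> x Qx; apply/eqP; rewrite -subr_eq0; apply/eqP/vleb_all0 => n.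
have [q /vgeP hq] := Qx n; apply: (vleb_trans Hv (y := ratr q)); last by rewrite (vlebBC Hv).
rewrite -[X in _ - X](embed_ratr i2) -sC -rmorphB embed_ratr; apply: svleb.
exact: hq.
Qed.

(** [inGp] asks for continuity only. Positivity of a value means that the powers tend to zero, so
    continuity at 0 preserves it. Applied to [y ^+ k * p] and to [y^-1] this preserves value zero,
    and for general [x] some [x ^+ n / p ^ m] has value zero. *)
Lemma inGp_isometry (s : {rmorphism K -> K}) : inGp v s -> forall x, x != 0 -> v (s x) = v x.
Proof.
case=> _ cont _.
have s0 x : x != 0 -> s x != 0 by rewrite fmorph_eq0.
have arch (a b : rat) : 0 < a -> exists k : nat, b <= k%:R * a.
  move=> a0; exists (Num.bound `|b / a|); rewrite -ler_pdivrMr //.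
  exact: le_trans (ler_norm _) (ltW (archi_boundP (normr_ge0 _))).
have pos x : x != 0 -> 0 < v x -> 0 < v (s x).
  move=> x0 vx; have [m Hm] := cont 0 1.
  have [k Hk] := arch (v x) m vx.
  have := Hm (x ^+ k); rewrite rmorph0 !subr0 rmorphXn => /(_ _)/vgeP.
  rewrite vlebE ?expf_neq0 ?s0 // (val_exp Hv) ?s0 //.
  rewrite ltNge => H; apply/negP => le.
  have : 1 <= k%:R * v (s x) by apply: H; apply/vgeP; rewrite vlebE ?expf_neq0 // (val_exp Hv).
  by rewrite leNgt (le_lt_trans (mulr_ge0_le0 (ler0n _ _) le)).
have P0 : ratr p%:R != 0 :> K by rewrite Cp_ratr0 // lt0r_neq0 // ltr0n prime_gt0.
have Pv : v (ratr p%:R) = 1 by rewrite Cp_ratr ?(vpQ_p pp) // lt0r_neq0 // ltr0n prime_gt0.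
have Ps : s (ratr p%:R) = ratr p%:R by rewrite ratr_nat rmorph_nat.
have nneg y : y != 0 -> v y = 0 -> 0 <= v (s y).
  move=> y0 vy; rewrite leNgt; apply/negP => lt.
  have [|k Hk] := arch (- v (s y)) 1; first by rewrite oppr_gt0.
  have yk0 : y ^+ k != 0 := expf_neq0 k y0.
  have syk0 : s y ^+ k != 0 := expf_neq0 k (s0 y y0).
  have := pos _ (mulf_neq0 yk0 P0); rewrite rmorphM rmorphXn /= Ps.
  rewrite (val_mul Hv yk0 P0) (val_mul Hv syk0 P0) (val_exp Hv k y0) (val_exp Hv k (s0 y y0)).
  by rewrite vy Pv mulr0 add0r => /(_ ltr01); move: Hk; rewrite mulrN; lra.
have zero y : y != 0 -> v y = 0 -> v (s y) = 0.
  move=> y0 vy; apply/eqP; rewrite eq_le nneg // andbT -oppr_ge0 -(val_inv Hv) ?s0 //.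
  by rewrite -fmorphV nneg ?invr_neq0 // (val_inv Hv) // vy oppr0.
move=> x x0.
pose n := `|denq (v x)|%N; pose m := numq (v x).
have nE : n%:R = (denq (v x))%:~R :> rat by rewrite /n -[LHS]/(n%:~R) gez0_abs.
have n0 : n%:R != 0 :> rat by rewrite nE intr_eq0 denq_neq0.
have Pm0 : ratr p%:R ^ m != 0 :> K by apply: expfz_neq0.
have xn0 : x ^+ n != 0 := expf_neq0 n x0.
have sxn0 : s x ^+ n != 0 := expf_neq0 n (s0 x x0).
have := zero _ (mulf_neq0 xn0 (invr_neq0 Pm0)).
rewrite rmorphM fmorphV rmorphXn /= fmorphXz Ps (val_div Hv xn0 Pm0) (val_div Hv sxn0 Pm0).
rewrite (val_exp Hv n x0) (val_exp Hv n (s0 x x0)) (val_exprz Hv _ P0) Pv mulr1.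
rewrite {1}nE [_ * v x]mulrC -numqE subrr => /(_ erefl).
move/eqP; rewrite subr_eq0 /m numqE -nE mulrC => /eqP /(mulIf n0) //.
Qed.
End CpTheory.

(** * The map Theta: values, orbits and injectivity *)

Section Admissible.
Variables (p : nat) (K : closedFieldType) (v : K -> rat).
Hypotheses (pp : prime p) (HC : isCp p v).
Variable i : {rmorphism algC -> K}.
Let Hv := Cp_isVal HC.

Definition wA (a : K) (d : option rat) (h : {poly algC}) : rat :=
  match d with
  | Some r => vmono v a r (map_poly i h)
  | None => v (map_poly i h).[a]
  end.

Definition wQ (a : K) (d : option rat) (f : {poly rat}) : rat :=
  match d with
  | Some r => vmono v a r (map_poly ratr f)
  | None => v (map_poly ratr f).[a]
  end.

Definition transc_if_infinite (a : K) (d : option rat) : Prop :=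
  if d is None then transcQ a else True.

Lemma admBr_transc a d : admBr v a d -> transc_if_infinite a d.
Proof. by case=> _; case: d. Qed.

Lemma wA_ratr a d f : wA a d (map_poly ratr f) = wQ a d f.
Proof. by case: d => [r|]; rewrite /wA (embed_map_ratr HC). Qed.

Lemma transc_embed a c : transcQ a -> a - i c != 0.
Proof.
move=> ta; rewrite subr_eq0; apply/eqP => E.
have [q [Eq /monic_neq0 q0] _] := minCpolyP c.
apply: (ta q q0); rewrite E -(embed_map_ratr HC i) fmorph_root -Eq.
exact: root_minCpoly.
Qed.

Lemma transc_horner a (h : {poly algC}) : transcQ a -> h != 0 -> (map_poly i h).[a] != 0.
Proof.
move=> ta h0; apply/negP => r; have [c E] := root_embed h0 r.
by have := transc_embed c ta; rewrite E subrr eqxx.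
Qed.

Lemma isVal_wA a d : transc_if_infinite a d -> isVal (wA a d).
Proof.
case: d => [r _|/= ta].
  exact: (isVal_map (map_poly_inj i) (isVal_vmono Hv a r)).
have inj : injective (horner_eval a \o map_poly i).
  move=> f g E; apply/eqP; rewrite -subr_eq0; apply: contraT => h0.
  have := transc_horner ta h0; rewrite rmorphB hornerD hornerN.
  by move: E; rewrite /= /horner_eval => ->; rewrite subrr eqxx.
exact: (isVal_map inj Hv).
Qed.

Lemma isVal_wQ a d : transc_if_infinite a d -> isVal (wQ a d).
Proof.
move=> ta; have -> : wQ a d = wA a d \o map_poly ratr.
  by apply: boolp.funext => f; rewrite /= wA_ratr.
exact: (isVal_map (map_poly_inj _) (isVal_wA ta)).
Qed.

Lemma wA_C a d c : c != 0 -> wA a d c%:P = v (i c).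
Proof.
move=> c0; rewrite /wA map_polyC /=; case: d => [r|]; last by rewrite hornerC.
by rewrite vmonoC // fmorph_eq0.
Qed.

Definition vlin (d : option rat) (x : K) : rat := if d is Some r then vmin v r x else v x.

Lemma wA_XsubC a d c : wA a d ('X - c%:P) = vlin d (a - i c).
Proof.
rewrite /wA map_polyXsubC; case: d => [r|] /=; first by rewrite vmono_XsubC.
by rewrite !hornerE.
Qed.

Lemma wQ_extends a d : extends_vpQ p (wQ a d).
Proof.
move=> q q0; rewrite -wA_ratr map_polyC wA_C; last by rewrite fmorph_eq0.
by rewrite /= (embed_ratr HC) (Cp_ratr HC).
Qed.

Lemma Zring_Zw a d : transc_if_infinite a d -> Zring v a d = Zw (wQ a d).
Proof.
move=> ta; apply: boolp.funext => phi; apply: boolp.propext.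
suff H (f g : {poly rat}) : g != 0 ->
    match d with
    | Some r => f = 0 \/ vmono v a r (map_poly ratr g) <= vmono v a r (map_poly ratr f)
    | None => vge v ((map_poly ratr f).[a] / (map_poly ratr g).[a]) 0
    end <-> (f = 0 \/ wQ a d g <= wQ a d f).
  by split=> -[f [g [g0 [E h]]]]; exists f, g; do 2!split=> //; apply/H.
move=> g0; case: d ta => [r|] //= ta.
have nz (h : {poly rat}) : h != 0 -> (map_poly ratr h).[a] != 0.
  move=> h0; rewrite -(embed_map_ratr HC i); apply: transc_horner => //.
  by rewrite map_poly_eq0.
have [->|f0] := eqVneq f 0.
  rewrite -(embed_map_ratr HC i) !rmorph0 horner0 mul0r.
  by split=> _; left.
have f0' := nz f f0; have g0' := nz g g0; split.
  case=> [/eqP|]; first by rewrite mulf_eq0 invr_eq0 (negPf f0') (negPf g0').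
  by rewrite (val_div Hv) // subr_ge0; right.
case=> [/eqP|h]; first by rewrite (negPf f0).
by right; rewrite (val_div Hv) // subr_ge0.
Qed.

(** Up to factorials the Taylor coefficients at [a] are derivatives of [f] evaluated at [a], hence
    values of rational polynomials; the finite ramification of [a] thus controls all of them. *)
Lemma taylor_coef_ratr a (f : {poly rat}) j : exists g : {poly rat},
  ((map_poly ratr f : {poly K}) \Po ('X + a%:P))`_j = (map_poly ratr g).[a].
Proof.
have E g : map_poly ratr g = map_poly i (map_poly ratr g) by rewrite (embed_map_ratr HC).
rewrite E; suff [g Hg] : exists g : {poly rat},
    ((map_poly i (map_poly ratr f)) \Po ('X + a%:P))`_j = (map_poly i (map_poly ratr g)).[a].
  by exists g; rewrite E.
elim/poly_ind: f j => [|f c IH] j.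
  by exists 0; rewrite !rmorph0 /= coef0 horner0.
have [g Hg] := IH j; have [g' Hg'] := IH j.-1.
(* Since ['X] becomes [X + a], coefficient [j] of the shifted product is [a] times coefficient [j]
   plus coefficient [j - 1]; the constant [c] enters only for [j = 0]. *)
exists (g * 'X + (if j is 0%N then c%:P else g')).
rewrite rmorphD rmorphM /= map_polyX map_polyC /= rmorphD rmorphM /= map_polyX map_polyC /=.
rewrite comp_polyD comp_polyM comp_polyX comp_polyC mulrDr !coefD coefMX coefMC coefC Hg.
rewrite !(rmorphD, rmorphM) /= !map_polyX hornerD hornerMX.
case: (j) Hg' => [|k] /= Hg'; first by rewrite !map_polyC /= hornerC add0r /ratr rmorphM.
by rewrite Hg' addr0 addrC.
Qed.

Lemma wQ_in_br a d : admBr v a d -> exists2 e : nat, (0 < e)%N &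
  forall f, f != 0 -> e%:R * wQ a d f \is a Num.int.
Proof.
move=> adm; have ta := admBr_transc adm.
case: adm => -[e [e0 He]] _.
have polyQ (f : {poly algC}) : (forall j, exists q : rat, f`_j = ratr q) -> polyOverQp v (map_poly i f).
  move=> H j; rewrite coef_map /=; have [q ->] := H j.
  by move=> n; exists q; rewrite (embed_ratr HC) subrr; left.
have eint (f : {poly rat}) : (map_poly ratr f).[a] != 0 -> e%:R * v (map_poly ratr f).[a] \is a Num.int.
  move=> fa; rewrite Qint_def; apply/eqP.
  have := He (map_poly ratr f) 1; rewrite hornerC divr1; apply=> //; rewrite ?oner_neq0 //.
    rewrite -(embed_map_ratr HC i); apply: polyQ => j; exists f`_j.
    by rewrite coef_map.
  rewrite -(rmorph1 (map_poly i)); apply: polyQ => j; exists (1 : {poly rat})`_j.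
  by rewrite !coef1 rmorph_nat.
case: d ta => [r|] ta; last first.
  exists e => // f f0; apply: eint.
  by rewrite -(embed_map_ratr HC i) transc_horner ?map_poly_eq0.
(* [e] clears the values of the Taylor coefficients and the denominator of [r] clears the terms
   [j * r]. *)
exists (e * `|denq r|)%N; first by rewrite muln_gt0 e0 absz_gt0 denq_neq0.
move=> f f0; rewrite /wQ vmonoE.
have f0' : (map_poly ratr f : {poly K}) \Po ('X + a%:P) != 0.
  rewrite -(embed_map_ratr HC i); apply: contraNneq f0 => E.
  rewrite -(map_poly_eq0 (ratr : {rmorphism rat -> algC})) -(map_poly_eq0 i).
  by apply/eqP/(comp_polyXaddC_inj (a := a)); rewrite E comp_poly0.
have [_ [j cj ->]] := gaussvP v r f0'.
have [g cjE] := taylor_coef_ratr a f j.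
move: cj; rewrite cjE => cj.
have dE : `|denq r|%:R * r \is a Num.int.
  have -> : `|denq r|%:R = (denq r)%:~R :> rat by rewrite pmulrn gez0_abs.
  by rewrite mulrC -numqE intr_int.
rewrite mulrDr natrM mulrAC.
have -> : e%:R * `|denq r|%:R * (j%:R * r) = (e * j)%:R * (`|denq r|%:R * r).
  by rewrite natrM; ring.
by rewrite rpredD // rpredM ?eint ?natr_int.
Qed.

Lemma Zring_isWp a d : admBr v a d -> isWp p (Zring v a d).
Proof.
move=> adm; have ta := admBr_transc adm; rewrite Zring_Zw //.
have [e e0 He] := wQ_in_br adm.
exact: (Zw_isWp pp (isVal_wQ ta) (@wQ_extends a d) e0 He).
Qed.

(** A root of order [denq r] of [p ^ numq r] exists in a closed field. A point at distance exactly
    [r] from the centre is what lets the radius be read off the ball as a set. *)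
Lemma Cp_val_surj r : exists2 x, x != 0 & v x = r.
Proof.
pose n := `|denq r|%N.
have nE : n%:R = (denq r)%:~R :> rat by rewrite /n -[LHS]/(n%:~R) gez0_abs.
have n0 : (0 < n)%N by rewrite absz_gt0 denq_neq0.
pose c : K := ratr p%:R ^ numq r.
have pr0 : p%:R != 0 :> rat by rewrite lt0r_neq0 // ltr0n prime_gt0.
have P0 : ratr p%:R != 0 :> K by rewrite (Cp_ratr0 HC).
have c0 : c != 0 by rewrite expfz_neq0.
have [x xP] := solve_monicpoly (fun k => if k == 0%N then c else 0) n0.
have xE : x ^+ n = c.
  rewrite xP; case: (n) n0 => // m _; rewrite big_ord_recl /= expr0 mulr1.
  by rewrite big1 ?addr0 // => k _; rewrite mul0r.
have x0 : x != 0 by apply: contraNneq c0 => E; rewrite -xE E expr0n gtn_eqF.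
exists x => //; have := congr1 v xE; rewrite (val_exp Hv) // (val_exprz Hv) //.
rewrite (Cp_ratr HC) // vpQ_p // mulr1 numqE -nE mulrC => /(mulIf _); apply.
by rewrite pnatr_eq0 gtn_eqF.
Qed.

Definition same_center (a b : K) (d : option rat) : Prop :=
  if d is Some r then is_true (vleb v r (a - b)) else a = b.

Lemma ball_eqP a d b d' : (forall x, ball v a d x <-> ball v b d' x) ->
  d = d' /\ same_center a b d.
Proof.
have some_none c c' r : (forall x, vge v (x - c) r <-> x = c') -> False.
  move=> H; have E1 : c = c' by apply/H; left; rewrite subrr.
  have [y y0 vy] := Cp_val_surj r.
  have : c + y = c' by apply/H; right; rewrite addrC addKr vy.
  by rewrite -E1 => /eqP; rewrite -subr_eq0 addrC addKr (negPf y0).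
have sub_some c c' r r' : (forall x, vge v (x - c) r -> vge v (x - c') r') -> r' <= r.
  move=> H; have [y y0 vy] := Cp_val_surj r.
  have h1 : vleb v r' (c + y - c') by apply/vgeP/H; right; rewrite addrC addKr vy.
  have h2 : vleb v r' (c - c') by apply/vgeP/H; left; rewrite subrr.
  have : vleb v r' y.
    have -> : y = (c + y - c') - (c - c') by ring.
    exact: (vlebB Hv).
  by rewrite vlebE // vy.
case: d d' => [r|] [r'|] H /=.
- have E : r = r'.
    by apply/eqP; rewrite eq_le; apply/andP; split; apply: sub_some => x h; apply/H; exact: h.
  split; first by rewrite E.
  rewrite E; apply/vgeP/(H a).1; left; by rewrite subrr.
- by exfalso; apply: (some_none a b r); exact: H.
- by exfalso; apply: (some_none b a r') => x; split=> /H.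
by split=> //; apply/H.
Qed.

Lemma wQ_ball a b d f : transc_if_infinite a d ->
  same_center a b d -> f != 0 ->
  wQ a d f = wQ b d f.
Proof.
case: d => [r|] ta ab f0; last by rewrite ab.
rewrite /wQ; apply: vmono_ball => //.
by rewrite -(embed_map_ratr HC i) !map_poly_eq0.
Qed.

Lemma wQ_aut (s : {rmorphism K -> K}) a d f : (forall x, x != 0 -> v (s x) = v x) ->
  wQ (s a) d f = wQ a d f.
Proof.
move=> Hs; have sf : map_poly s (map_poly ratr f) = map_poly ratr f.
  rewrite -{1}(embed_map_ratr HC i) -map_poly_comp.
  exact: (embed_map_ratr HC (s \o i : {rmorphism algC -> K})).
rewrite /wQ; case: d => [r|].
  rewrite !vmonoE -[RHS](gaussv_map r _ Hs) map_comp_poly rmorphD /= map_polyX map_polyC.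
  by rewrite sf.
have [E|h0] := eqVneq (map_poly ratr f).[a] 0.
  by rewrite -{1}sf horner_map /= E rmorph0.
by rewrite -{1}sf horner_map /= Hs.
Qed.

Lemma Zring_orbit a a' d d' : admBr v a d -> admBr v a' d' -> sameOrbit v a d a' d' ->
  Zring v a d = Zring v a' d'.
Proof.
move=> adm adm' [s [sG sB]]; have Hs := inGp_isometry pp HC sG.
have [dE ab] := ball_eqP sB.
have ta := admBr_transc adm; have ta' := admBr_transc adm'.
rewrite -dE in ta' *; rewrite !Zring_Zw //.
have wE f : f != 0 -> wQ a d f = wQ a' d f.
  move=> f0; rewrite -(wQ_aut a d f Hs); apply: wQ_ball => //.
  by case: (d) ta' ab => //= ta' ->.
apply: boolp.funext => phi; apply: boolp.propext.
split=> -[f [g [g0 [E h]]]]; exists f, g; do 2!split=> //;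
  have [->|f0] := eqVneq f 0; [by left | | by left |];
  by case: h => [|h]; [left|right]; rewrite ?wE // -?wE.
Qed.

(** By density [r] is the largest value of [vmin v r (a - i c)] over algebraic [c], so the radii
    agree; a [c] reaching it is close to [a] and, by the equality, to [b]. *)
Lemma vmin_sup (r : rat) (a b : K) r' :
  (forall c : algC, vmin v r (a - i c) = vmin v r' (b - i c)) -> r = r' /\ vleb v r (a - b).
Proof.
move=> H.
have le (x y : K) s s' : (forall c : algC, vmin v s (x - i c) = vmin v s' (y - i c)) -> s <= s'.
  move=> H'; have [c hc] := embed_dense HC i x s.
  by have := vmin_le v s' (y - i c); rewrite -H'; apply: le_trans; rewrite vmin_ge.
have E : r = r'.
  by apply/eqP; rewrite eq_le (le _ _ _ _ H) (le b a _ _ (fun c => esym (H c))).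
split=> //; have [c hc] := embed_dense HC i a r.
apply: (vleb_trans Hv hc); rewrite (vlebBC Hv) -(@vmin_ge _ v r') -?E //.
by rewrite E -H -E vmin_ge.
Qed.

(** Only algebraic [c] are tested, which density makes sufficient. An infinite radius is recognised
    by unbounded values; the first two hypotheses keep [v] away from its meaningless value at
    zero. *)
Lemma vlin_all_eq a b d d' :
  (forall c, a - i c != 0 \/ d <> None) -> (forall c, b - i c != 0 \/ d' <> None) ->
  (forall c : algC, vlin d (a - i c) = vlin d' (b - i c)) ->
  forall x, ball v a d x <-> ball v b d' x.
Proof.
have none x y r : (forall c, y - i c != 0 \/ None <> None :> option rat) ->
    ~ (forall c : algC, vmin v r (x - i c) = v (y - i c)).
  move=> ny H; have [c hc] := embed_dense HC i y (r + 1).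
  have y0 : y - i c != 0 by case: (ny c).
  move: hc; rewrite vlebE // -H leNgt => /negP; apply.
  by apply: (le_lt_trans (vmin_le _ _ _)); rewrite ltrDl.
case: d d' => [r|] [r'|] na nb H x.
- have [E ab] := vmin_sup H; rewrite /= -E; split=> /vgeP h; apply/vgeP.
    exact: (vleb_trans Hv h).
  by apply: (vleb_trans Hv h); rewrite (vlebBC Hv).
- by exfalso; apply: (none _ _ _ nb H).
- by exfalso; apply: (none b _ r' na) => c; exact: esym (H c).
rewrite /=; suff -> : a = b by [].
apply/eqP; rewrite -subr_eq0; apply/eqP/(vleb_all0 (v := v)) => n.
have [c hc] := embed_dense HC i a n.
apply: (vleb_trans Hv hc); rewrite (vlebBC Hv).
have a0 : a - i c != 0 by case: (na c).
have b0 : b - i c != 0 by case: (nb c).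
by move: hc; rewrite !vlebE // -[v (b - _)]/(vlin None _) -H.
Qed.

Lemma Zring_inj a a' d d' : admBr v a d -> admBr v a' d' ->
  (forall phi, Zring v a d phi <-> Zring v a' d' phi) -> sameOrbit v a d a' d'.
Proof.
move=> adm adm'; have ta := admBr_transc adm; have ta' := admBr_transc adm'.
rewrite !Zring_Zw // => HZ.
have agree := Zw_inj pp (isVal_wQ ta) (isVal_wQ ta') (@wQ_extends a d) (@wQ_extends a' d') HZ.
have [|t Ht] := conj_global (isVal_wA ta) (isVal_wA ta').
  by move=> f f0; rewrite !wA_ratr agree.
(* On constants the conjugacy says that [i \o t] and [i] induce the same valuation of [algC]. The
   resulting [s] sends [i (t c)] to [i c], which transports the values at [X - t c] to those at
   [X - c]. *)
have [|s [sG sC sV]] := @extend_inGp p K v HC (i \o t : {rmorphism algC -> K}) i.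
  move=> c c0; have := Ht c%:P; rewrite polyC_eq0 map_polyC /= !wA_C ?fmorph_eq0 // => ->//.
exists s; split=> //.
have nt x e c : transc_if_infinite x e -> x - i c != 0 \/ e <> None.
  by case: e => [r|] h; [right | left; apply: transc_embed].
have svlin e x : vlin e (s x) = vlin e x.
  have [->|x0] := eqVneq x 0; first by rewrite rmorph0.
  by rewrite /vlin /vmin fmorph_eq0 sV.
apply: vlin_all_eq => [c|c|c].
- case: (d) ta => [r|] h; [by right | left].
  by rewrite -sC -rmorphB fmorph_eq0; apply: (transc_embed (t c)).
- exact: nt.
rewrite -[RHS]wA_XsubC Ht ?monic_neq0 ?monicXsubC //.
by rewrite map_polyXsubC wA_XsubC -sC -rmorphB svlin.
Qed.

End Admissible.

(** * Extension of valuations *)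

Definition is_subring (L : fieldType) (A : L -> Prop) : Prop :=
  [/\ A 1, forall x y, A x -> A y -> A (x - y) & forall x y, A x -> A y -> A (x * y)].

Section SubringTheory.
Variables (L : fieldType) (A : L -> Prop).
Hypothesis sA : is_subring A.

Lemma subring0 : A 0.
Proof. by case: sA => A1 AB _; rewrite -(subrr 1); apply: (AB _ _). Qed.

Lemma subringN x : A x -> A (- x).
Proof. by case: sA => _ AB _ Ax; rewrite -sub0r; apply: (AB _ _) => //; apply: subring0. Qed.

Lemma subringD x y : A x -> A y -> A (x + y).
Proof. by case: sA => _ AB _ Ax Ay; rewrite -[y]opprK; apply: (AB _ _) => //; apply: subringN. Qed.

Lemma subring_sum (I : Type) (r : seq I) (P : pred I) (F : I -> L) :
  (forall i, P i -> A (F i)) -> A (\sum_(i <- r | P i) F i).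
Proof. by move=> H; elim/big_ind: _ => //; [apply: subring0 | apply: subringD]. Qed.

Lemma subringX x n : A x -> A (x ^+ n).
Proof.
by case: sA => A1 _ AM Ax; elim: n => [|n IH]; rewrite ?expr0 // exprS; apply: (AM _ _).
Qed.

Definition adjoin (x y : L) : Prop := exists p : {poly L}, (forall i, A p`_i) /\ y = p.[x].

Lemma is_subring_adjoin x : is_subring (adjoin x).
Proof.
have [A1 AB AM] := sA; split.
- exists 1; rewrite hornerC; split=> // i; rewrite coef1; case: eqP => _ //; exact: subring0.
- move=> _ _ [p [Ap ->]] [q [Aq ->]]; exists (p - q); rewrite hornerD hornerN; split=> // i.
  by rewrite coefB; apply: (AB _ _).
move=> _ _ [p [Ap ->]] [q [Aq ->]]; exists (p * q); rewrite hornerM; split=> // i.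
by rewrite coefM; apply: subring_sum => k _; apply: (AM _ _).
Qed.

Lemma adjoin_sub x y : A y -> adjoin x y.
Proof.
move=> Ay; exists y%:P; rewrite hornerC; split=> // i.
by rewrite coefC; case: eqP => _ //; exact: subring0.
Qed.

Lemma adjoin_gen x : adjoin x x.
Proof.
exists 'X; rewrite hornerX; split=> // i; have [A1 _ _] := sA.
by rewrite coefX; case: eqP => _ //; exact: subring0.
Qed.

Variable q : L.
Hypotheses (q0 : q != 0) (Aq : A q) (Aqi : ~ A q^-1).

(** [n] counts terms rather than the degree: [n = 0] contradicts [q^-1 != 0] and [n = 1] contradicts
    [Aqi]. *)
Definition inv_in (x : L) (n : nat) : Prop :=
  exists a : nat -> L, (forall i, A (a i)) /\ q^-1 = \sum_(i < n) a i * x ^+ i.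

Lemma inv_inW x m n : (m <= n)%N -> inv_in x m -> inv_in x n.
Proof.
move=> mn [a [Aa E]]; exists (fun i => if (i < m)%N then a i else 0); split.
  by move=> i; case: ifP => // _; apply: subring0.
rewrite E (big_ord_widen n (fun i => a i * x ^+ i) mn) big_mkcond /=.
by apply: eq_bigr => i _; case: ifP => _ //; rewrite mul0r.
Qed.

(* Chevalley's argument: the top term of one relation is eliminated with the
   other one, lowering the degree. *)
Lemma inv_in_contra N n m x : (n + m <= N)%N -> x != 0 -> inv_in x n -> inv_in x^-1 m -> False.
Proof.
elim: N n m x => [|N IH] n m x.
  rewrite leqn0 addn_eq0 => /andP[/eqP-> _] _ [a [_]].
  by rewrite big_ord0 => /eqP; rewrite invr_eq0 (negPf q0).
wlog mn : n m x / (m <= n)%N => [H|].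
  move=> le x0 Hn Hm; have [mn|/ltnW nm] := leqP m n; first exact: (H n m x).
  by apply: (H m n x^-1); rewrite ?invrK ?invr_eq0 // addnC.
case: n mn => [|n] mn le x0.
  by case=> a [_]; rewrite big_ord0 => /eqP; rewrite invr_eq0 (negPf q0).
case: n mn le => [|n] mn le.
  case=> a [Aa]; rewrite big_ord1 expr0 mulr1 => E _; apply: Aqi; rewrite E; exact: Aa.
move=> [a [Aa Ea]] Hm; apply: (IH n.+1 m x) => //.
have [b [Ab Eb]] := inv_inW mn Hm.
have [A1 AB AM] := sA.
(* Write [q^-1 = b 0 + (1 - q * b 0) * q^-1] and expand the last [q^-1] by the first relation. In
   its top term, [1 - q * b 0] is replaced by [q] times the terms of positive index of the second
   relation, which lowers the power of [x]. *)
exists (fun i => (if i == 0%N then b 0%N else 0) + (1 - q * b 0%N) * a i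
   + q * a n.+1 * b (n.+1 - i)%N); split.
  move=> i; apply: subringD; last by apply: (AM _ _) => //; apply: (AM _ _).
  apply: subringD; first by case: ifP => // _; apply: subring0.
  by apply: (AM _ _) => //; apply: (AB _ _) => //; apply: (AM _ _).
under eq_bigr => i _ do rewrite 2!mulrDl.
rewrite !big_split /=.
have -> : \sum_(i < n.+1) (if i == 0%N :> nat then b 0%N else 0) * x ^+ i = b 0%N.
  by rewrite big_ord_recl /= expr0 mulr1 big1 ?addr0 // => i _; rewrite mul0r.
have -> : \sum_(i < n.+1) (1 - q * b 0%N) * a i * x ^+ i =
    (1 - q * b 0%N) * (q^-1 - a n.+1 * x ^+ n.+1).
  rewrite Ea [in RHS]big_ord_recr /= addrK mulr_sumr; apply: eq_bigr => i _; ring.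
have -> : \sum_(i < n.+1) q * a n.+1 * b (n.+1 - i)%N * x ^+ i =
    q * a n.+1 * (x ^+ n.+1 * (q^-1 - b 0%N)).
  rewrite Eb [in RHS]big_ord_recl /= expr0 mulr1 [X in X - _]addrC addrK (reindex_inj rev_ord_inj) /=.
  rewrite !mulr_sumr; apply: eq_bigr => i _.
  rewrite subSS (subKn (ltn_ord i : i < n.+1)%N) /bump add1n.
  have -> : x ^+ n.+1 * (b i.+1 * x^-1 ^+ i.+1) = b i.+1 * x ^+ (n - i).
    have -> : x ^+ n.+1 = x ^+ (n - i) * x ^+ i.+1.
      by rewrite -exprD -subSS subnK // ltnS ltnW // ltnS.
    by rewrite exprVn; field; rewrite expf_neq0.
  ring.
by field.
Qed.

Lemma adjoin_inv_in x : adjoin x q^-1 -> exists n, inv_in x n.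
Proof.
case=> p [Ap E]; exists (size p), (fun i => p`_i); split=> //.
by rewrite E horner_coef.
Qed.
End SubringTheory.

Module Chevalley.
Import classical_sets.
Local Open Scope classical_set_scope.

(** A subring maximal among those containing [W] and missing [q^-1] is a valuation ring: if it
    contained neither [x] nor [x^-1], adjoining either one would produce [q^-1], against
    [inv_in_contra]. *)
Theorem valuation_ring_exists (L : fieldType) (W : L -> Prop) (q : L) :
  is_subring W -> W q -> q != 0 -> ~ W q^-1 ->
  exists V : L -> Prop, [/\ is_subring V, forall x, W x -> V x, ~ V q^-1 &
    forall x, V x \/ V x^-1].
Proof.
move=> sW Wq q0 Wqi.
pose good (V : set L) := [/\ is_subring V, forall x, W x -> V x & ~ V q^-1].
pose P (V : set L) := (forall x, ~ V x) \/ good V.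
have [|A [PA Amax]] := @Zorn_bigcup L P.
  move=> F FP Ftot; case: (boolp.pselect (exists X, F X /\ exists x, X x)) => [[X0 [FX0 [x0 Xx0]]]|no].
    right.
    have gF X x : F X -> X x -> good X.
      by move=> FX Xx; case: (FP X FX) => // /(_ x).
    have [[s1 sB sM] WX0 _] := gF _ _ FX0 Xx0.
    have join x y : (\bigcup_(X in F) X) x -> (\bigcup_(X in F) X) y ->
        exists X, [/\ F X, X x, X y & good X].
      move=> [X FX Xx] [Y FY Yy]; case: (Ftot X Y FX FY) => sub.
        by exists Y; split=> //; [exact: sub | exact: gF Yy].
      by exists X; split=> //; [exact: sub | exact: gF Xx].
    split.
    - split; first by exists X0.
        by move=> x y /join H /H[X [FX Xx Xy [[_ XB _] _ _]]]; exists X => //; apply: XB.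
      by move=> x y /join H /H[X [FX Xx Xy [[_ _ XM] _ _]]]; exists X => //; apply: XM.
    - by move=> x Wx; exists X0 => //; apply: WX0.
    - by move=> [X FX Xq]; have [_ _] := gF _ _ FX Xq; apply.
  left => x [X FX Xx]; apply: no; exists X; split=> //; by exists x.
have gW : good W by split.
have gA : good A.
  case: PA => // empty; exfalso.
  apply: (Amax W); last by right.
  split; first by move=> x /empty.
  by move=> sub; apply: (empty 1); apply: sub; case: sW.
have [sA WA Aqi] := gA.
exists A; split=> // x.
have [->|x0] := eqVneq x 0; first by left; apply: subring0.
apply: boolp.contrapT => /boolp.not_orP[nx nxi].
have adj y : ~ A y -> adjoin A y q^-1.
  move=> ny; apply: boolp.contrapT => nq; apply: (Amax (adjoin A y)).
    split; first by move=> z; apply: adjoin_sub.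
    by move=> sub; apply/ny/sub/adjoin_gen.
  right; split=> //; first exact: is_subring_adjoin.
  by move=> z Wz; apply: adjoin_sub => //; apply: WA.
have [n Hn] := adjoin_inv_in (adj x nx).
have [m Hm] := adjoin_inv_in (adj _ nxi).
exact: (inv_in_contra sA q0 (WA q Wq) Aqi (leqnn _) x0 Hn Hm).
Qed.
End Chevalley.

(** * From a valuation ring to a rational-valued valuation *)

Section ExtendVal.
Variables (R0 : idomainType) (L : fieldType) (J : {rmorphism R0 -> L}).
Hypothesis Jinj : injective J.
Variables (w : R0 -> rat) (q : R0).
Hypotheses (Hw : isVal w) (wq : w q = 1) (q0 : q != 0).

Definition alg_over (y : L) : Prop := exists2 P : {poly R0}, P != 0 & root (map_poly J P) y.

Hypothesis Halg : forall x : L, x != 0 ->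
  exists y z, [/\ y != 0, z != 0, alg_over y, alg_over z & x = y / z].

Lemma J_neq0 f : f != 0 -> J f != 0.
Proof. by move=> f0; rewrite -(rmorph0 J) (inj_eq Jinj). Qed.

Definition base_ring (x : L) : Prop :=
  exists f g, [/\ g != 0, vleb w (w g) f & x = J f / J g].

Lemma base_ring_subring : is_subring base_ring.
Proof.
split.
- by exists 1, 1; rewrite oner_neq0 rmorph1 divr1 vleb_refl.
- move=> _ _ [f [g [g0 fg ->]]] [h [k [k0 hk ->]]].
  exists (f * k - h * g), (g * k); split; first exact: mulf_neq0.
    rewrite (val_mul Hw) //; apply: (vlebB Hw).
      exact: (vlebM Hw fg (vleb_refl _ _)).
    by rewrite addrC; apply: (vlebM Hw hk (vleb_refl _ _)).
  by rewrite rmorphB !rmorphM /=; field; rewrite !J_neq0.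
move=> _ _ [f [g [g0 fg ->]]] [h [k [k0 hk ->]]].
exists (f * h), (g * k); split; first exact: mulf_neq0.
  by rewrite (val_mul Hw) //; apply: (vlebM Hw).
by rewrite !rmorphM /=; field; rewrite !J_neq0.
Qed.

Lemma base_ring_inv : ~ base_ring (J q)^-1.
Proof.
move=> [f [g [g0 fg E]]].
have gE : g = f * q.
  apply: Jinj; have fE : J f = (J q)^-1 * J g by rewrite E divfK ?J_neq0.
  by rewrite rmorphM fE mulrAC mulVf ?mul1r ?J_neq0.
have f0 : f != 0 by apply: contraNneq g0 => f0; rewrite gE f0 mul0r.
by move: fg; rewrite vlebE // gE (val_mul Hw) // wq; lra.
Qed.

Variable V : L -> Prop.
Hypotheses (sV : is_subring V) (WV : forall x, base_ring x -> V x)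
  (Vqi : ~ V (J q)^-1) (totV : forall x, V x \/ V x^-1).

Let V1 : V 1. Proof. by case: sV. Qed.
Let VM x y : V x -> V y -> V (x * y). Proof. by case: sV => _ _; apply. Qed.
Let VD x y : V x -> V y -> V (x + y). Proof. exact: subringD. Qed.

(** Equality up to a unit of [V] for nonzero elements. As division by zero gives zero, [assoc x 0]
    always holds, so transitivity asks for a nonzero middle term. *)
Definition assoc (x y : L) : Prop := V (x / y) /\ V (y / x).

Lemma assoc_sym x y : assoc x y -> assoc y x.
Proof. by case. Qed.

Lemma assocM x y z t : assoc x y -> assoc z t -> assoc (x * z) (y * t).
Proof. by case=> a b [c d]; split; rewrite -mulf_div; apply: VM. Qed.

Lemma assocV x y : assoc x y -> assoc x^-1 y^-1.
Proof. by case=> a b; split; rewrite invrK mulrC. Qed.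

Lemma assocX x y n : assoc x y -> assoc (x ^+ n) (y ^+ n).
Proof. by case=> a b; split; rewrite -expr_div_n; apply: subringX. Qed.

Lemma assoc_trans y x z : y != 0 -> assoc x y -> assoc y z -> assoc x z.
Proof.
move=> y0 [a b] [c d]; split.
  by have := VM a c; rewrite mulrA divfK.
by have := VM d b; rewrite mulrA divfK.
Qed.

(** If [x^-1] is in [V], then so is [x = x ^+ n * x^-1 ^+ n.-1]. *)
Lemma integrally_closed x n : (0 < n)%N -> V (x ^+ n) -> V x.
Proof.
move=> n0 H; have [//|Vi] := totV x.
have [->|x0] := eqVneq x 0; first exact: subring0.
have := VM H (subringX sV n.-1 Vi); case: n n0 {H} => // n _ /=.
by rewrite exprS exprVn mulfK // expf_neq0.
Qed.

Lemma base_val f g : f != 0 -> g != 0 -> w g <= w f -> V (J f / J g).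
Proof. by move=> f0 g0 le; apply: WV; exists f, g; rewrite vlebE. Qed.

Lemma base_assoc f g : f != 0 -> g != 0 -> w f = w g -> assoc (J f) (J g).
Proof. by move=> f0 g0 E; split; apply: base_val; rewrite ?E. Qed.

Let Q := J q.
Let Q0 : Q != 0 := J_neq0 q0.

Lemma V_Qz (m : int) : V (Q ^ m) <-> 0 <= m.
Proof.
have VQ : V Q.
  have := base_val q0 (oner_neq0 _); rewrite rmorph1 divr1; apply.
  by rewrite (val_one Hw) wq.
case: m => m; first by split=> // _; rewrite -exprnP; apply: subringX.
split=> // H; exfalso; apply: Vqi.
have := VM H (subringX sV m VQ); rewrite NegzE -exprnN exprS invfM -mulrA mulVf ?mulr1 //.
exact: expf_neq0.
Qed.

(* [hasval x r] says that [r] is the value of [x] for the rational rank one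
   valuation attached to [V] and normalised by [q]. *)
Definition hasval (x : L) (r : rat) : Prop :=
  x != 0 /\ exists (n : nat) (m : int), [/\ (0 < n)%N, n%:R * r = m%:~R & assoc (x ^+ n) (Q ^ m)].

Lemma hasval_V x r : hasval x r -> V x <-> 0 <= r.
Proof.
move=> [x0 [n [m [n0 nr [a b]]]]].
have xn0 : x ^+ n != 0 by apply: expf_neq0.
have Qm0 : Q ^ m != 0 by apply: expfz_neq0.
have np : 0 < n%:R :> rat by rewrite ltr0n.
have -> : (0 <= r) = (0 <= m) by rewrite -(pmulr_rge0 r np) nr ler0z.
rewrite -V_Qz; split=> [Vx|VQ].
  by have := VM b (subringX sV n Vx); rewrite divfK.
by apply: (integrally_closed n0); have := VM a VQ; rewrite divfK.
Qed.

Lemma hasvalM x y r s : hasval x r -> hasval y s -> hasval (x * y) (r + s).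
Proof.
move=> [x0 [n [m [n0 nr xm]]]] [y0 [n' [m' [n0' nr' ym]]]].
split; first exact: mulf_neq0.
exists (n * n')%N, (m * n'%:Z + m' * n%:Z); split; first by rewrite muln_gt0 n0.
  by rewrite natrM intrD !intrM -!pmulrn -nr -nr'; ring.
rewrite exprMn expfzDr //; apply: assocM.
  by rewrite exprM -exprz_exp -exprnP; apply: assocX.
by rewrite mulnC exprM -exprz_exp -exprnP; apply: assocX.
Qed.

Lemma hasvalV x r : hasval x r -> hasval x^-1 (- r).
Proof.
move=> [x0 [n [m [n0 nr xm]]]]; split; first exact: invr_neq0.
exists n, (- m); split=> //; first by rewrite mulrN nr intrN.
by rewrite exprVn -invr_expz; apply: assocV.
Qed.

(** [x / x = 1] has both values [r - s] and [s - r], and it lies in [V], so both are nonnegative. *)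
Lemma hasval_uniq x r s : hasval x r -> hasval x s -> r = s.
Proof.
have le t u : hasval x t -> hasval x u -> u <= t.
  move=> h1 h2; rewrite -subr_ge0; apply/(hasval_V (hasvalM h1 (hasvalV h2))).
  by case: h1 => x0 _; rewrite divff.
by move=> h1 h2; apply/eqP; rewrite eq_le !le.
Qed.

Lemma hasval_assoc x y r : x != 0 -> assoc x y -> hasval y r -> hasval x r.
Proof.
move=> x0 xy [y0 [n [m [n0 nr ym]]]]; split=> //; exists n, m; split=> //.
by apply: (assoc_trans (y := y ^+ n)) => //; [apply: expf_neq0 | apply: assocX].
Qed.

Lemma hasval_root x k r : (0 < k)%N -> x != 0 -> hasval (x ^+ k) r -> hasval x (r / k%:R).
Proof.
move=> k0 x0 [_ [n [m [n0 nr xm]]]]; split=> //; exists (k * n)%N, m; split.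
- by rewrite muln_gt0 k0.
- by rewrite natrM -nr; field; rewrite pnatr_eq0 -lt0n.
by rewrite exprM.
Qed.

Lemma hasval_base f : f != 0 -> hasval (J f) (w f).
Proof.
move=> f0; split; first exact: J_neq0.
pose n := `|denq (w f)|%N; pose m := numq (w f).
have nE : n%:R = (denq (w f))%:~R :> rat by rewrite /n pmulrn gez0_abs.
exists n, m; split; first by rewrite absz_gt0 denq_neq0.
  by rewrite nE mulrC -numqE.
have nw : n%:R * w f = m%:~R by rewrite nE mulrC -numqE.
clearbody n m; case: m nw => m nw.
  rewrite -exprnP -!rmorphXn; apply: base_assoc; try exact: expf_neq0.
  by rewrite !(val_exp Hw) // nw wq mulr1.
have : assoc (J (f ^+ n * q ^+ m.+1)) (J 1).
  apply: base_assoc; rewrite ?oner_neq0 ?mulf_neq0 ?expf_neq0 //.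
  rewrite (val_mul Hw) ?expf_neq0 // !(val_exp Hw) // (val_one Hw) nw wq mulr1.
  by rewrite NegzE mulrNz -pmulrn addNr.
rewrite rmorph1 rmorphM !rmorphXn NegzE -exprnN /assoc !divr1 div1r invrK.
by case=> a b; split=> //; rewrite mulrC -invfM.
Qed.

Lemma nonunitD x y : V x -> V y -> ~ V x^-1 -> ~ V y^-1 -> x + y = 0 \/ ~ V (x + y)^-1.
Proof.
have key z t : z != 0 -> V z -> ~ V z^-1 -> V (t / z) -> z + t != 0 -> ~ V (z + t)^-1.
  move=> z0 Vz nz Vt s0 h; apply: nz.
  have := VM h (VD V1 Vt).
  have -> : 1 + t / z = (z + t) / z by rewrite mulrDl divff.
  by rewrite mulrA mulVf // mul1r.
move=> Vx Vy nx ny; have [s0|s0] := eqVneq (x + y) 0; [by left|right].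
have x0 : x != 0 by apply: contra_notN nx => /eqP->; rewrite invr0; apply: subring0.
have y0 : y != 0 by apply: contra_notN ny => /eqP->; rewrite invr0; apply: subring0.
have [h|h] := totV (y / x); first exact: key.
by rewrite addrC; apply: key; rewrite // ?(addrC y) //; move: h; rewrite invf_div.
Qed.

(** Divide by a term of least value. If no other term matched it, the quotient would read 1 plus a
    nonunit equals zero. *)
Lemma sum_assoc (n : nat) (t : 'I_n -> L) : \sum_i t i = 0 -> (exists i, t i != 0) ->
  exists i j, [/\ i != j, t i != 0, t j != 0 & assoc (t i) (t j)].
Proof.
move=> sum0 [i0 ti0].
have [i ti imin] : exists2 i, t i != 0 & forall k, V (t k / t i).
  have : forall s : seq 'I_n, i0 \in s -> exists2 i, t i != 0 & forall k, k \in s -> V (t k / t i).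
    move=> s is0; have : exists2 i, t i != 0 & forall k, k \in rcons s i0 -> V (t k / t i).
      elim: s {is0} => [|a s [i ti H]].
        by exists i0 => // k; rewrite inE => /eqP->; rewrite divff.
      have [h|h] := totV (t a / t i).
        by exists i => // k; rewrite inE => /orP[/eqP->|/H].
      have [ta|ta] := eqVneq (t a) 0.
        exists i => // k; rewrite inE => /orP[/eqP->|/H //].
        by rewrite ta mul0r; apply: subring0.
      exists a => // k; rewrite inE => /orP[/eqP->|/H h']; first by rewrite divff.
      move: h; rewrite invf_div => h; have := VM h' h.
      by rewrite mulrA divfK.
    case=> i ti H; exists i => // k ks; apply: H; by rewrite mem_rcons inE ks orbT.
  move/(_ (enum 'I_n)); rewrite mem_enum => /(_ isT) [i ti H]; exists i => // k.
  by apply: H; rewrite mem_enum.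
apply: boolp.contrapT => none.
have nu k : k != i -> ~ V (t k / t i)^-1 \/ t k = 0.
  move=> ki; have [->|tk] := eqVneq (t k) 0; [by right | left => h].
  apply: none; exists k, i; split=> //; split; first exact: imin.
  by move: h; rewrite invf_div.
have m : forall s : seq 'I_n, let S := \sum_(k <- s | k != i) (t k / t i) in
    V S /\ (S = 0 \/ ~ V S^-1).
  elim=> [|k s [VS IH]] /=; first by rewrite big_nil; split; [exact: subring0|left].
  rewrite big_cons; case: ifP => // ki; split; first exact: VD (imin k) VS.
  case: (nu k ki) => [nk|->]; last by rewrite mul0r add0r.
  case: IH => [->|nS]; first by rewrite addr0; right.
  exact: nonunitD.
have [_] := m (index_enum 'I_n); set S := \sum_(k <- _ | _) _.
have E : \sum_k t k / t i = 0 by rewrite -mulr_suml sum0 mul0r.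
rewrite (bigD1 i) //= divff // in E.
have -> : S = -1 by apply: (addrI 1); rewrite subrr -E.
case=> [/eqP|]; first by rewrite oppr_eq0 oner_eq0.
by rewrite invrN invr1; apply; apply: subringN.
Qed.

(** Two terms of the algebraic relation are associate, so a positive power of [x] is associate to a
    quotient of coefficients. This is why the value is rational and the extension stays of rank
    one. *)
Lemma hasval_alg x : x != 0 -> alg_over x -> exists r, hasval x r.
Proof.
move=> x0 [P P0 rP].
pose t (i : 'I_(size P)) := J P`_i * x ^+ i.
have sum0 : \sum_i t i = 0.
  have : (map_poly J P).[x] = 0 by apply/rootP.
  rewrite horner_coef size_map_inj_poly ?rmorph0 // => E; rewrite -[RHS]E.
  by apply: eq_bigr => i _; rewrite coef_map.
have ex : exists i, t i != 0.
  have lt : ((size P).-1 < size P)%N by rewrite prednK // size_poly_gt0.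
  exists (Ordinal lt); rewrite /t /= mulf_neq0 ?expf_neq0 // J_neq0 //.
  by rewrite -lead_coefE lead_coef_eq0.
have [i [j [ij ti tj a]]] := sum_assoc sum0 ex.
wlog lt : i j ij ti tj a / (i < j)%N => [H|].
  have [lt|lt|/val_inj E] := ltngtP i j.
  - exact: (H i j).
  - by apply: (H j i) => //; [rewrite eq_sym | exact: assoc_sym].
  by rewrite E eqxx in ij.
have ci : P`_i != 0 by apply: contraNneq ti => E; rewrite /t E rmorph0 mul0r.
have cj : P`_j != 0 by apply: contraNneq tj => E; rewrite /t E rmorph0 mul0r.
have xk0 : x ^+ (j - i) != 0 by apply: expf_neq0.
exists ((w P`_i - w P`_j) / (j - i)%:R); apply: hasval_root; rewrite ?subn_gt0 //.
apply: (hasval_assoc (y := J P`_i / J P`_j)) => //; last first.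
  exact: hasvalM (hasval_base ci) (hasvalV (hasval_base cj)).
have E : x ^+ j = x ^+ (j - i) * x ^+ i by rewrite -exprD subnK // ltnW.
move: a; rewrite /assoc /t E => -[a b]; split.
  move: b; congr V; by field; rewrite !J_neq0 // !expf_neq0.
move: a; congr V; by field; rewrite !J_neq0 // !expf_neq0.
Qed.

Theorem valuation_of_ring : exists w' : L -> rat,
  isVal w' /\ forall f, f != 0 -> w' (J f) = w f.
Proof.
have /boolp.choice[w' w'P] : forall x, exists r, x != 0 -> hasval x r.
  move=> x; have [->|x0] := eqVneq x 0; first by exists 0.
  have [y [z [y0 z0 ay az ->]]] := Halg x0.
  have [r Hr] := hasval_alg y0 ay; have [s Hs] := hasval_alg z0 az.
  by exists (r - s) => _; apply: hasvalM Hr (hasvalV Hs).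
exists w'; split; last first.
  move=> f f0; apply: (@hasval_uniq (J f)); last exact: hasval_base.
  by apply: w'P; apply: J_neq0.
have wM x y : x != 0 -> y != 0 -> w' (x * y) = w' x + w' y.
  move=> x0 y0; apply: (@hasval_uniq (x * y)); first by apply/w'P/mulf_neq0.
  by apply: hasvalM; apply: w'P.
split=> // x y x0 y0 s0.
have key z t : z != 0 -> t != 0 -> z + t != 0 -> w' z <= w' t -> w' z <= w' (z + t).
  move=> z0 t0 zt le; have q0' : t / z != 0 by rewrite mulf_neq0 ?invr_neq0.
  have sE : z + t = z * (1 + t / z) by rewrite mulrDr mulr1 mulrCA divff ?mulr1.
  have n0 : 1 + t / z != 0 by apply: contraNneq zt => E; rewrite sE E mulr0.
  rewrite sE wM // lerDl; apply/(hasval_V (w'P _ n0))/VD => //.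
  apply/(hasval_V (w'P _ q0')).
  have := wM _ _ q0' z0; rewrite divfK // => E; lra.
have [h|/ltW h] := lerP (w' x) (w' y); first exact: key.
by rewrite addrC key // addrC.
Qed.
End ExtendVal.

Theorem extend_valuation (R0 : idomainType) (L : fieldType) (J : {rmorphism R0 -> L})
    (w : R0 -> rat) (q : R0) :
  injective J -> isVal w -> w q = 1 -> q != 0 ->
  (forall x : L, x != 0 -> exists y z,
     [/\ y != 0, z != 0, alg_over J y, alg_over J z & x = y / z]) ->
  exists w' : L -> rat, isVal w' /\ forall f, f != 0 -> w' (J f) = w f.
Proof.
move=> Jinj Hw wq q0 Halg.
have [|V [sV WV Vqi totV]] := Chevalley.valuation_ring_exists
    (base_ring_subring Jinj Hw) _ (J_neq0 Jinj q0) (base_ring_inv Jinj Hw wq q0).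
  by exists q, 1; rewrite oner_neq0 rmorph1 divr1 vlebE // wq (val_one Hw) ler01.
exact: (valuation_of_ring Jinj Hw wq q0 Halg sV WV Vqi totV).
Qed.

(** Polynomials over [algC] are integral over Q[X], being built from ['X] and algebraic constants,
    so every rational function is a quotient of elements algebraic over Q[X]. *)
Theorem extend_to_algC_poly (w : {poly rat} -> rat) (q : {poly rat}) :
  isVal w -> w q = 1 -> q != 0 ->
  exists W : {fraction {poly algC}} -> rat,
    isVal W /\ forall f : {poly rat}, f != 0 -> W (map_poly ratr f)%:F = w f.
Proof.
move=> Hw wq q0.
pose j : {rmorphism {poly rat} -> {poly algC}} := map_poly (ratr : rat -> algC).
pose J : {rmorphism {poly rat} -> {fraction {poly algC}}} := @FracField.tofrac _ \o j.
have Jinj : injective J.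
  move=> f g /eqP; rewrite /J /= tofrac_eq => /eqP; exact: map_poly_inj.
have Hint (h : {poly algC}) : integralOver j h.
  elim/poly_ind: h => [|h c IH]; first exact: integral0.
  apply: integral_add; first apply: integral_mul => //.
    by rewrite -(map_polyX (ratr : {rmorphism rat -> algC})); apply: (integral_id j).
  have [m [E mon] _] := minCpolyP c.
  exists (map_poly polyC m); first by rewrite map_monic.
  rewrite -map_poly_comp (eq_map_poly (g := polyC \o ratr)); last by move=> a; rewrite /= /j map_polyC.
  rewrite map_poly_comp /= rootE horner_map /=.
  by rewrite -[map_poly ratr m]E; have /rootP -> := root_minCpoly c.
have Hal (h : {poly algC}) : alg_over J h%:F.
  have [P Pm rP] := Hint h; exists P; first exact: monic_neq0.
  by rewrite map_poly_comp rootE horner_map (rootP rP) /= tofrac0.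
apply: (@extend_valuation _ _ J w q Jinj Hw wq q0) => x /frac_neq0E[f [g [f0 g0 ->]]].
by exists f%:F, g%:F; rewrite !tofrac_eq0.
Qed.

(** * Residues and approximation by algebraic numbers *)

(** Membership in the maximal ideal; [vpos W (x - y)] is used as equality of residues. *)
Definition vpos (R : idomainType) (w : R -> rat) (x : R) : bool := (x == 0) || (0 < w x).

Section Residue.
Variables (L : fieldType) (W : L -> rat) (p : nat).
Hypotheses (HW : isVal W) (pp : prime p) (Wp : W p%:R = 1) (p0 : p%:R != 0 :> L).
Implicit Types x y z : L.

Lemma vpos0 : vpos W 0. Proof. by rewrite /vpos eqxx. Qed.

Lemma vposP x : vpos W x <-> exists2 n, 0 < n & vleb W n x.
Proof.
rewrite /vpos /vleb; have [->|x0] := eqVneq x 0; first by split=> // _; exists 1.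
by split=> /= [h|[n n0 /(lt_le_trans n0)//]]; exists (W x); rewrite ?lexx.
Qed.

Lemma vpos_vleb x : vpos W x -> vleb W 0 x.
Proof. by case/vposP => n n0; apply: vlebW; apply: ltW. Qed.

Lemma vposN x : vpos W (- x) = vpos W x.
Proof. by rewrite /vpos oppr_eq0 val_opp. Qed.

Lemma vposD x y : vpos W x -> vpos W y -> vpos W (x + y).
Proof.
case/vposP => m m0 hx /vposP[n n0 hy]; apply/vposP; exists (Num.min m n).
  by rewrite lt_min m0.
by apply: (vlebD HW); [apply: vlebW hx | apply: vlebW hy]; rewrite ge_min lexx ?orbT.
Qed.

Lemma vposBC x y : vpos W (x - y) = vpos W (y - x).
Proof. by rewrite -vposN opprB. Qed.

Lemma vpos_trans y x z : vpos W (x - y) -> vpos W (y - z) -> vpos W (x - z).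
Proof. by move=> h1 h2; rewrite -[x](subrK y) -addrA vposD. Qed.

Lemma vposMl x y : vleb W 0 x -> vpos W y -> vpos W (x * y).
Proof.
by move=> hx /vposP[n n0 hy]; apply/vposP; exists n => //; apply: (vlebM0l HW).
Qed.

Lemma vposMr x y : vpos W x -> vleb W 0 y -> vpos W (x * y).
Proof. by move=> hx hy; rewrite mulrC vposMl. Qed.

Lemma vpos_sum (I : Type) (r : seq I) (P : pred I) (F : I -> L) :
  (forall i, P i -> vpos W (F i)) -> vpos W (\sum_(i <- r | P i) F i).
Proof. by move=> HF; elim/big_ind: _ => //; [apply: vpos0 | apply: vposD]. Qed.

Lemma vpos_root x n : vpos W (x ^+ n) -> vpos W x.
Proof.
rewrite /vpos; have [//|x0] := eqVneq x 0.
rewrite expf_eq0 (negPf x0) andbF /= (val_exp HW) //.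
by case: n => [|n]; rewrite ?mul0r ?ltxx // pmulr_rgt0 ?ltr0Sn.
Qed.

Lemma vpos_p : vpos W p%:R.
Proof. by rewrite /vpos Wp ltr01 orbT. Qed.

Lemma vposX x y n : vleb W 0 x -> vleb W 0 y -> vpos W (x - y) -> vpos W (x ^+ n - y ^+ n).
Proof.
move=> hx hy h; rewrite subrXX vposMr //; apply: (vleb_sum HW) => i _.
by apply: (vlebM0l HW); apply: vlebX0.
Qed.

Lemma vpos_one_false : ~~ vpos W 1.
Proof. by rewrite /vpos oner_eq0 (val_one HW) ltxx. Qed.

Lemma frobenius1 x y : vleb W 0 x -> vleb W 0 y ->
  vpos W ((x + y) ^+ p - (x ^+ p + y ^+ p)).
Proof.
move=> hx hy; rewrite exprDn.
case: p pp Wp p0 vpos_p => [|q] // pq _ _ vp.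
rewrite big_ord_recl big_ord_recr /= bin0 mulr1n !subn0 expr0 mulr1.
rewrite /bump /= add1n binn mulr1n subnn expr0 mul1r.
have -> : forall S a b : L, a + (S + b) - (a + b) = S by move=> *; ring.
apply: vpos_sum => i _; rewrite add1n -mulr_natr.
have /dvdnP[k ->] : (q.+1 %| 'C(q.+1, i.+1))%N.
  by apply: prime_dvd_bin => //=; rewrite ltnS ltn_ord.
rewrite natrM mulrA; apply: vposMl => //; apply: (vlebM0l HW); last exact: vleb_nat.
by apply: (vlebM0l HW); apply: vlebX0.
Qed.

Lemma frobenius x y i : vleb W 0 x -> vleb W 0 y ->
  vpos W ((x + y) ^+ (p ^ i) - (x ^+ (p ^ i) + y ^+ (p ^ i))).
Proof.
move=> hx hy; elim: i => [|i IH]; first by rewrite expn0 !expr1 subrr vpos0.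
rewrite expnS mulnC !exprM.
have hX z k : vleb W 0 z -> vleb W 0 (z ^+ k) by exact: vlebX0.
have h := frobenius1 (hX _ (p ^ i)%N hx) (hX _ (p ^ i)%N hy).
apply: vpos_trans h; apply: vposX => //; first by apply: hX; apply: (vlebD HW).
by apply: (vlebD HW); apply: hX.
Qed.

(* Frobenius is injective on the residue field. *)
Lemma frobenius_period b i j : vleb W 0 b -> (i < j)%N ->
  vpos W (b ^+ (p ^ i) - b ^+ (p ^ j)) -> vpos W (b ^+ (p ^ (j - i)) - b).
Proof.
move=> hb ij h; set s := (j - i)%N.
have hx : vleb W 0 (b ^+ (p ^ s) - b) by apply: (vlebB HW) => //; apply: vlebX0.
apply: (@vpos_root _ (p ^ i)%N).
have := frobenius i hx hb; rewrite subrK -exprM -expnD subnK; last exact: ltnW.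
move=> h2; have := vposD h2 h.
set A := b ^+ (p ^ j)%N; set B := b ^+ (p ^ i)%N; set D := (_ - _) ^+ _.
have -> : A - (D + B) + (B - A) = - D by ring.
by rewrite vposN.
Qed.

Section AlgebraicResidue.
Variable r : {rmorphism rat -> L}.
Hypothesis Wr : forall a, a != 0 -> W (r a) = vpQ p a.

Lemma rat_residue a : vleb W 0 (r a) -> exists k : 'I_p, vpos W (r a - k%:R).
Proof.
have [->|a0] := eqVneq a 0.
  by move=> _; exists (Ordinal (prime_gt0 pp)); rewrite rmorph0 subrr vpos0.
rewrite vlebE ?fmorph_eq0 // Wr // vpQ_ge0 // => pd.
set d := `|denq a|%N in pd; have dE : d%:Z = denq a by rewrite /d gez0_abs.
have cop : coprime d p by rewrite coprime_sym prime_coprime.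
have d0 : (0 < d)%N by rewrite absz_gt0 denq_neq0.
have [u v uv _] := egcdnP p d0; move: uv; rewrite (eqP cop) => uv.
have p0' : p%:Z != 0 by rewrite gt_eqF // ltz_nat prime_gt0.
(* By the Bezout relation [u] inverts the denominator modulo [p], so [k] is the residue of [a] in
   the prime field. *)
pose k := (numq a * u%:Z %% p%:Z)%Z.
have k0 : 0 <= k by exact: modz_ge0.
have kp : (`|k| < p)%N by rewrite -ltz_nat gez0_abs // ltz_pmod // ltz_nat prime_gt0.
exists (Ordinal kp) => /=.
have kE : `|k|%:R = k%:~R :> L by rewrite pmulrn gez0_abs.
pose m := (numq a * u%:Z %/ p%:Z)%Z.
have nE : numq a * u%:Z = m * p%:Z + k by exact: divz_eq.
have dr : r d%:R = d%:R by rewrite rmorph_nat.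
have ad : a * d%:R = (numq a)%:~R by rewrite -[d%:R]/(d%:Z%:~R) dE -numqE.
have hz (z : int) : vleb W 0 (z%:~R : L).
  by case: z => z; [exact: vleb_nat | rewrite NegzE mulrNz (vlebN HW); exact: vleb_nat].
have ha : vleb W 0 (r a) by rewrite vlebE ?fmorph_eq0 // Wr // vpQ_ge0.
have -> : r a - `|k|%:R = p%:R * (m%:~R - r a * v%:R).
  have e1 : (u * d)%:R = v%:R * p%:R + 1 :> L by rewrite uv natrD natrM.
  have e2 : (numq a)%:~R * u%:R = m%:~R * p%:R + k%:~R :> L.
    have := congr1 (fun z : int => z%:~R : L) nE; rewrite /= intrD !intrM //.
  have e3 : r a * d%:R = (numq a)%:~R.
    by rewrite -dr -rmorphM ad rmorph_int.
  rewrite kE; move: e1 e2; rewrite -e3 natrM => e1 e2.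
  have -> : k%:~R = r a * d%:R * u%:R - m%:~R * p%:R by rewrite e2; ring.
  have -> : r a * d%:R * u%:R = r a * (u%:R * d%:R) by ring.
  by rewrite e1; ring.
rewrite mulrC; apply: vposMl vpos_p; apply: (vlebB HW) => //.
by apply: (vlebM0l HW) => //; apply: vleb_nat.
Qed.

Definition lowcomb (b : L) (n : nat) (y : L) : Prop :=
  exists d : nat -> rat, (forall i, vleb W 0 (r (d i))) /\
    vpos W (y - \sum_(i < n) r (d i) * b ^+ i).

(** The residue of [b] satisfies a monic equation over the prime field, so its powers have finitely
    many residues; two Frobenius iterates coincide, and injectivity of Frobenius brings [b] itself
    back. *)
Lemma algebraic_residue (f : {poly rat}) (b : L) : f != 0 -> root (map_poly r f) b ->
  vleb W 0 b -> exists2 s, (0 < s)%N & vpos W (b ^+ (p ^ s) - b).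
Proof.
move=> f0 rf hb.
have Hr : isVal (W \o r) := isVal_map (fmorph_inj r) HW.
have [G1 [i0 fi0 G2]] := gaussvP (W \o r) 0 f0.
(* Dividing by a coefficient of least value makes all coefficients integral and one of them equal to
   1. *)
pose a i := f`_i / f`_i0.
have ai0 : a i0 = 1 by rewrite /a divff.
have ha i : vleb W 0 (r (a i)).
  have [E|fi] := eqVneq f`_i 0; first by rewrite /a E mul0r rmorph0 vleb0.
  rewrite /a fmorph_div vlebE ?mulf_neq0 ?invr_eq0 ?fmorph_eq0 // (val_div HW) ?fmorph_eq0 // subr_ge0.
  by have := G1 i fi; rewrite G2 /= !mulr0 !addr0.
have rel : \sum_(i < size f) r (a i) * b ^+ i = 0.
  have : (map_poly r f).[b] = 0 by apply/rootP.
  rewrite horner_coef size_map_poly => E.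
  rewrite -[RHS](mulr0 (r f`_i0)^-1) -[X in _ = _ * X]E mulr_sumr.
  by apply: eq_bigr => i _; rewrite coef_map /a fmorph_div /= mulrAC mulrC mulrA.
have i0s : (i0 < size f)%N by rewrite ltnNge; apply: contra fi0 => h; rewrite nth_default.
(* The largest index with a unit coefficient is the degree [n] of the relation modulo the maximal
   ideal. *)
pose Q i := (i < size f)%N && ~~ vpos W (r (a i)).
have exQ : exists i, Q i by exists i0; rewrite /Q i0s ai0 rmorph1 vpos_one_false.
have boundQ i : Q i -> (i <= size f)%N by case/andP => /ltnW.
case: (ex_maxnP exQ boundQ) => n /andP[ns nn] nmax.
have an0 : r (a n) != 0 by apply: contraNneq nn => ->; exact: vpos0.
have hai : vleb W 0 (r (a n))^-1.
  rewrite vlebE ?invr_eq0 // (val_inv HW) // oppr_ge0 leNgt; apply: contra nn => h.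
  by rewrite /vpos h orbT.
pose T i := r (a i) * b ^+ i.
have top : vpos W (T n + \sum_(i < n) T i).
  have hs : vpos W (\sum_(i < size f | ~~ (i < n.+1)%N) T i).
    apply: vpos_sum => i ni; apply: vposMr; last exact: vlebX0.
    apply: contraT => h; have := nmax i; rewrite /Q ltn_ord h => /(_ isT).
    by rewrite -ltnS (negPf ni).
  have := rel; rewrite -/(T _) (bigID (fun i : 'I_(size f) => (i < n.+1)%N)) /=.
  rewrite -(big_ord_widen _ T ns) big_ord_recr /= addrC [X in _ + X]addrC => /eqP.
  by rewrite addr_eq0 => /eqP E; rewrite -vposN -E.
have n0 : (0 < n)%N.
  by case: (n) top nn => //; rewrite big_ord0 addr0 /T expr0 mulr1 => ->.
pose e i := - (a i / a n).
have he i : vleb W 0 (r (e i)).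
  by rewrite rmorphN (vlebN HW) fmorph_div; apply: (vlebM0l HW).
have bn : vpos W (b ^+ n - \sum_(i < n) r (e i) * b ^+ i).
  have -> : b ^+ n - \sum_(i < n) r (e i) * b ^+ i = (r (a n))^-1 * (T n + \sum_(i < n) T i).
    rewrite mulrDr mulr_sumr /T mulKf // -sumrN; congr (_ + _); apply: eq_bigr => i _.
    by rewrite /e rmorphN fmorph_div mulNr opprK; ring.
  exact: vposMl.
have combM y : lowcomb b n y -> lowcomb b n (b * y).
  case: (n) n0 bn => // m _ bm [d [hd hy]].
  exists (fun i => (if i is k.+1 then d k else 0) + d m * e i); split.
    move=> i; rewrite rmorphD rmorphM; apply: (vlebD HW); last exact: (vlebM0l HW).
    by case: i => [|i] //; rewrite rmorph0 vleb0.
  have -> : \sum_(i < m.+1) r ((if nat_of_ord i is k.+1 then d k else 0) + d m * e i) * b ^+ i =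
      b * (\sum_(i < m) r (d i) * b ^+ i) + r (d m) * (\sum_(i < m.+1) r (e i) * b ^+ i).
    under eq_bigr => i _ do rewrite rmorphD rmorphM /= mulrDl -mulrA.
    rewrite big_split /= -mulr_sumr big_ord_recl /= rmorph0 mul0r add0r [b * _]mulr_sumr.
    by congr (_ + _); apply: eq_bigr => i _; rewrite /bump add1n exprS; ring.
  have := vposD (vposMl hb hy) (vposMl (hd m) bm); congr (vpos W _).
  rewrite big_ord_recr /= exprS; ring.
have combX k : lowcomb b n (b ^+ k).
  elim: k => [|k IH]; last by rewrite exprS; apply: combM.
  exists (fun i => (i == 0%N)%:R); split=> [i|]; first by rewrite rmorph_nat; apply: vleb_nat.
  case: (n) n0 => // m _; rewrite big_ord_recl /= rmorph1 mul1r expr0 big1 ?addr0 ?subrr ?vpos0 //.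
  by move=> i _; rewrite rmorph0 mul0r.
have fin k : exists c : {ffun 'I_n -> 'I_p}, vpos W (b ^+ k - \sum_(i < n) (c i)%:R * b ^+ i).
  have [d [hd hy]] := combX k.
  have /fin_all_exists[c cP] : forall i : 'I_n, exists k : 'I_p, vpos W (r (d i) - k%:R).
    by move=> i; apply: rat_residue.
  exists (finfun c); apply: vpos_trans hy _; rewrite -sumrB; apply: vpos_sum => i _.
  by rewrite ffunE -mulrBl; apply: vposMr => //; apply: vlebX0.
have /boolp.choice[c cP] := fun j : nat => fin (p ^ j)%N.
pose N := #|{ffun 'I_n -> 'I_p}|.
have [i [j [ij cij]]] : exists i j : 'I_N.+1, (i < j)%N /\ c i = c j.
  have ninj : ~~ injectiveb (fun i : 'I_N.+1 => c i).
    by apply/negP => /injectiveP/leq_card; rewrite card_ord ltnn.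
  have /injectivePn[i [j ij E]] := ninj.
  have [lt|lt|/val_inj E'] := ltngtP i j; first by exists i, j.
    by exists j, i; rewrite E.
  by rewrite E' eqxx in ij.
exists (j - i)%N; first by rewrite subn_gt0.
apply: frobenius_period => //; apply: vpos_trans (cP i) _.
by rewrite vposBC cij.
Qed.
End AlgebraicResidue.
End Residue.

Section RootApprox.
Variables (L : fieldType) (W : L -> rat).
Hypothesis HW : isVal W.

Lemma sum_lt_bound (I : Type) (s : seq I) (F : I -> rat) (N : rat) : (0 < size s)%N ->
  (forall i, F i < N) -> \sum_(i <- s) F i < (size s)%:R * N.
Proof.
move=> + H; case: s => // a s _; elim: s a => [|c s IH] a.
  by rewrite big_seq1 mul1r.
by rewrite big_cons /= -addn1 natrD mulrDl mul1r addrC; apply: ltrD.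
Qed.

(** The [n] factors [t - k z] have total value at least [n * N], so one of them reaches [N]. *)
Lemma root_approx (C : closedFieldType) (k : {rmorphism C -> L}) (P : {poly C}) (n : nat) t N :
  P \is monic -> size P = n.+1 -> (0 < n)%N -> vleb W (n%:R * N) (map_poly k P).[t] ->
  exists2 z, root P z & vleb W N (t - k z).
Proof.
move=> mon sz n0; have [r Er] := closed_field_poly_normal P.
rewrite (monicP mon) scale1r in Er.
have szr : size r = n by move: sz; rewrite Er size_prod_XsubC => -[].
have evE : (map_poly k P).[t] = \prod_(z <- r) (t - k z).
  rewrite Er rmorph_prod horner_prod; apply: eq_bigr => z _.
  by rewrite /= map_polyXsubC !hornerE.
rewrite evE => h.
have rt z : z \in r -> root P z by rewrite Er root_prod_XsubC.
apply: boolp.contrapT => none.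
have bad z : z \in r -> ~~ vleb W N (t - k z).
  by move=> zr; apply/negP => hz; apply: none; exists z => //; apply: rt.
have t0 z : z \in r -> t - k z != 0.
  by move=> zr; apply: contraNneq (bad z zr) => ->; apply: vleb0.
(* The value [N - 1] off the list only serves to make the strict bound unconditional. *)
pose F z := if z \in r then W (t - k z) else N - 1.
have Flt z : F z < N.
  rewrite /F; case: ifP => zr; last by rewrite ltrBlDr ltrDl.
  by have := bad z zr; rewrite vlebE ?t0 // -ltNge.
have := sum_lt_bound (s := r) _ Flt; rewrite szr => /(_ n0); apply/negP; rewrite -leNgt.
move: h; rewrite vlebE; last by rewrite prodf_seq_neq0; apply/allP => z zr; apply: t0.
rewrite big_seq_cond (val_prod HW); last by move=> z /andP[zr _]; apply: t0.
rewrite -big_seq_cond big_seq (eq_bigr F); last by move=> z zr; rewrite /F zr.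
by rewrite -big_seq.
Qed.
End RootApprox.

(** * Expansions in a uniformizer and approximation by algebraic numbers *)

Section Approximation.
Variables (L : fieldType) (W : L -> rat) (p : nat).
Hypotheses (HW : isVal W) (pp : prime p) (Wp : W p%:R = 1) (p0 : p%:R != 0 :> L).
Variable k : {rmorphism algC -> L}.
Variable S : L -> Prop.
Hypotheses (S1 : S 1) (SB : forall x y, S x -> S y -> S (x - y))
  (SM : forall x y, S x -> S y -> S (x * y)) (SV : forall x, S x -> S x^-1).
Variables (pi : L) (e : nat).
Hypotheses (Spi : S pi) (pi0 : pi != 0) (Wpi : W pi = e.+1%:R^-1).
Hypothesis Sdisc : forall x, S x -> x != 0 -> exists m : int, W x = m%:~R / e.+1%:R.
Hypothesis Sres : forall y, S y -> vleb W 0 y -> exists2 s, (0 < s)%N & vpos W (y ^+ (p ^ s) - y).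

(** The value of [pi], least positive value on [S]; as [W p = 1], the ramification index is
    [e.+1]. *)
Let eta : rat := e.+1%:R^-1.
Let eta0 : 0 < eta. Proof. by rewrite invr_gt0 ltr0Sn. Qed.
Let eta1 : eta <= 1. Proof. by rewrite invf_le1 ?ltr0Sn // ler1n. Qed.

Lemma S_X x n : S x -> S (x ^+ n).
Proof. by move=> Sx; elim: n => [|n IH]; rewrite ?expr0 // exprS; apply: SM. Qed.

Lemma S_nat n : S n%:R.
Proof.
have S0 : S 0 by rewrite -(subrr 1); apply: SB.
elim: n => [//|n IH]; rewrite -natr1 -[X in _ + X]opprK; apply: (SB IH).
by rewrite -sub0r; apply: SB.
Qed.

Lemma S_vpos x : S x -> vpos W x -> vleb W eta x.
Proof.
rewrite /vpos /vleb; have [//|x0] := eqVneq x 0 => Sx /= h.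
have [m mE] := Sdisc Sx x0; move: h; rewrite mE.
rewrite pmulr_lgt0 ?invr_gt0 ?ltr0Sn // ltr0z => m0.
by rewrite /eta ler_pMl ?invr_gt0 ?ltr0Sn // ler1z -gtz0_ge1.
Qed.

(** [A ^+ p - B ^+ p] is [A - B] times a sum congruent to [p * B ^+ p.-1] modulo [A - B]; that sum
    has value at least [eta] because [eta <= 1 = W p]. *)
Lemma pow_p_lift A B a : vleb W 0 A -> vleb W 0 B -> vleb W a (A - B) -> vleb W eta (A - B) ->
  vleb W (a + eta) (A ^+ p - B ^+ p).
Proof.
move=> hA hB ha he; rewrite subrXX; apply: (vlebM HW) => //.
have -> : \sum_(i < p) A ^+ (p.-1 - i) * B ^+ i =
   \sum_(i < p) (A ^+ (p.-1 - i) - B ^+ (p.-1 - i)) * B ^+ i + p%:R * B ^+ p.-1.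
  rewrite -[in p%:R](card_ord p) -sumr_const mulr_suml -big_split /=.
  apply: eq_bigr => i _; rewrite mulrBl mul1r -exprD subnK ?subrK //.
  by case: (p) i => [[]|q i] //=; rewrite -ltnS.
apply: (vlebD HW); last first.
  apply: (vlebM0r HW); last exact: vlebX0.
  by rewrite vlebE // Wp.
apply: (vleb_sum HW) => i _; apply: (vlebM0r HW); last exact: vlebX0.
rewrite subrXX; apply: (vlebM0r HW) => //; apply: (vleb_sum HW) => j _.
by apply: (vlebM0l HW); apply: vlebX0.
Qed.

(** The powers of [y] of exponent [p ^ (s * n)] approach the Teichmuller representative, a root of
    ['X^q - 'X]. Two witnesses are kept: [t] stays in [S], while [z] is algebraic and close to
    [t]. *)
Lemma teichmuller y N : S y -> vleb W 0 y -> 0 <= N -> exists t z,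
  [/\ S t, vleb W 0 (k z), vpos W (y - t) & vleb W N (t - k z)].
Proof.
move=> Sy hy N0; have [s s0 hs] := Sres Sy hy.
set q := (p ^ s)%N in hs.
have q1 : (1 < q)%N by rewrite /q -(exp1n s) ltn_exp2r ?prime_gt1.
have hX n : vleb W 0 (y ^+ n) by exact: vlebX0.
have lift i : vleb W (i.+1%:R * eta) (y ^+ (q * p ^ i) - y ^+ (p ^ i)).
  elim: i => [|i IH].
    by rewrite expn0 muln1 expr1 mul1r; apply: S_vpos => //; apply: SB => //; apply: S_X.
  rewrite expnSr mulnA ![y ^+ (_ * p)]exprM -[i.+2]addn1 natrD mulrDl mul1r.
  apply: pow_p_lift => //; apply: vlebW IH.
  by apply: ler_peMl; [apply: ltW | rewrite ler1n].
have cong n : vpos W (y ^+ (p ^ (s * n)) - y).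
  elim: n => [|n IH]; first by rewrite muln0 expn0 expr1 subrr vpos0.
  apply: (vpos_trans HW _ hs); rewrite mulnS addnC expnD exprM -/q.
  exact: (vposX HW).
(* A polynomial of degree [q] is about to be solved, so precision [q * N] is needed, and each power
   of [p] gains [eta]. *)
pose n := Num.bound (q%:R * N / eta).
exists (y ^+ (p ^ (s * n))).
have h : vleb W (q%:R * N) (map_poly k ('X^q - 'X)).[y ^+ (p ^ (s * n))].
  rewrite rmorphB /= map_polyXn map_polyX !hornerE -exprM [(_ * q)%N]mulnC.
  apply: vlebW (lift _); rewrite -ler_pdivrMr //.
  apply: le_trans (ltW (archi_boundP _)) _; first by apply: divr_ge0; [apply: mulr_ge0 | apply: ltW].
  by rewrite ler_nat -/n; apply: leq_trans (leqnSn _); rewrite leq_pmull.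
have [||z _ hz] := root_approx HW (k := k) (n := q) _ _ (ltnW q1) h.
- by rewrite monicE lead_coefDl ?lead_coefXn // size_polyXn size_polyN size_polyX.
- by rewrite size_polyDl size_polyXn // size_polyN size_polyX.
exists z; split=> //; first exact: S_X.
- rewrite -[k z](subKr (y ^+ (p ^ (s * n)))); apply: (vlebB HW) => //.
  exact: vlebW hz.
by rewrite vposBC.
Qed.

(** The remainder must stay in [S] to be expanded again, so [t], and not the digit [k c], is
    subtracted before dividing by [pi]; the error is beyond precision [N]. *)
Lemma digits y N n : S y -> vleb W 0 y -> 0 <= N ->
  exists (z : nat -> algC) (y' : L), [/\ S y', vleb W 0 y', forall b, vleb W 0 (k (z b)) &
    vleb W N (y - \sum_(b < n) k (z b) * pi ^+ b - pi ^+ n * y')].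
Proof.
move=> Sy hy N0; elim: n => [|n [z [y' [Sy' hy' hz h]]]].
  exists (fun=> 0), y; split=> // [b|]; first by rewrite rmorph0 vleb0.
  by rewrite big_ord0 subr0 expr0 mul1r subrr vleb0.
have [t [c [St hc ht htc]]] := teichmuller Sy' hy' N0.
have hpi : vleb W 0 pi by rewrite vlebE // Wpi; apply: ltW.
exists (fun b => if (b < n)%N then z b else c), ((y' - t) / pi); split.
- by apply: SM; [apply: SB | apply: SV].
- have := S_vpos (SB Sy' St) ht; rewrite /vleb mulf_eq0 invr_eq0 (negPf pi0) orbF.
  have [//|d0] := eqVneq (y' - t) 0; rewrite /= (val_div HW) // Wpi subr_ge0 => h0; exact: h0.
- by move=> b; case: (b < n)%N.
rewrite big_ord_recr /= ltnn.
rewrite (eq_bigr (fun b : 'I_n => k (z b) * pi ^+ b)); last by move=> b _; rewrite ltn_ord.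
have -> : y - (\sum_(b < n) k (z b) * pi ^+ b + k c * pi ^+ n) - pi ^+ n.+1 * ((y' - t) / pi)
  = (y - \sum_(b < n) k (z b) * pi ^+ b - pi ^+ n * y') + pi ^+ n * (t - k c).
  by rewrite exprS; field.
by apply: (vlebD HW) => //; apply: (vlebM0l HW) => //; apply: vlebX0.
Qed.

(** After [e.+1] digits the remainder is divisible by [p], and the quotient is expanded in turn. The
    new digits times [p] are absorbed into the old ones, so the length stays [e.+1] for every
    precision [M]. *)
Lemma expansion y (M : nat) : S y -> vleb W 0 y ->
  exists z : nat -> algC, (forall b, vleb W 0 (k (z b))) /\
    vleb W M%:R (y - \sum_(b < e.+1) k (z b) * pi ^+ b).
Proof.
elim: M y => [|M IH] y Sy hy.
  exists (fun=> 0); split=> [b|]; first by rewrite rmorph0 vleb0.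
  by rewrite big1 ?subr0 // => b _; rewrite rmorph0 mul0r.
have [z [y' [Sy' hy' hz h]]] := digits e.+1 Sy hy (ler0n rat M.+1).
pose y1 := pi ^+ e.+1 * y' / p%:R.
have Sy1 : S y1 by apply: SM; [apply: SM => //; apply: S_X | apply/SV/S_nat].
have hy1 : vleb W 0 y1.
  have h1 : vleb W 1 (pi ^+ e.+1).
    by rewrite vlebE ?expf_neq0 // (val_exp HW) // Wpi divff // pnatr_eq0.
  have h2 : vleb W (-1) p%:R^-1 by rewrite vlebE ?invr_eq0 // (val_inv HW) // Wp.
  by have := vlebM HW (vlebM HW h1 hy') h2; rewrite addr0 subrr.
have [z1 [hz1 h1]] := IH y1 Sy1 hy1.
exists (fun b => z b + p%:R * z1 b); split.
  move=> b; rewrite rmorphD rmorphM rmorph_nat; apply: (vlebD HW) => //.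
  by apply: (vlebM0l HW) => //; apply: vleb_nat.
have -> : y - \sum_(b < e.+1) k (z b + p%:R * z1 b) * pi ^+ b =
    (y - \sum_(b < e.+1) k (z b) * pi ^+ b - pi ^+ e.+1 * y')
    + p%:R * (y1 - \sum_(b < e.+1) k (z1 b) * pi ^+ b).
  rewrite (eq_bigr (fun b : 'I_e.+1 => k (z b) * pi ^+ b + p%:R * (k (z1 b) * pi ^+ b))).
    by rewrite big_split /= -mulr_sumr /y1; field.
  by move=> b _; rewrite rmorphD rmorphM rmorph_nat; ring.
apply: (vlebD HW) => //; rewrite -addn1 natrD addrC; apply: (vlebM HW) => //.
by rewrite vlebE // Wp.
Qed.

Lemma vleb_det n (A : 'M[L]_n) : (forall i j, vleb W 0 (A i j)) -> vleb W 0 (\det A).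
Proof.
move=> hA; apply: (vleb_sum HW) => s _; apply: (vlebM0l HW).
  by apply: vlebX0 => //; rewrite (vlebN HW); apply: vleb1.
exact: (vleb_prod0 HW).
Qed.

(* Multiplication by [Y] on the approximate basis [1, pi, .., pi ^ e] is given
   by a matrix over [algC], whose characteristic polynomial nearly kills [Y]. *)
Lemma integral_approx Y (N : nat) : S Y -> vleb W 0 Y -> exists c, vleb W N%:R (Y - k c).
Proof.
(* The characteristic polynomial has degree [e.+1], and extracting a root divides the precision by
   this degree. *)
move=> SY hY; pose M := (e.+1 * N)%N.
have hpi : vleb W 0 pi by rewrite vlebE // Wpi; apply: ltW.
have /boolp.choice[z zP] : forall b : nat, exists z : nat -> algC,
   (forall b', vleb W 0 (k (z b'))) /\
    vleb W M%:R (Y * pi ^+ b - \sum_(b' < e.+1) k (z b') * pi ^+ b').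
  move=> b; apply: expansion; first by apply: SM => //; apply: S_X.
  by apply: (vlebM0l HW) => //; apply: vlebX0.
pose A : 'M[algC]_e.+1 := \matrix_(b, b') z b b'.
pose D : 'M[L]_e.+1 := Y%:M - map_mx k A.
pose P : 'cV[L]_e.+1 := \col_b pi ^+ b.
have DP b : vleb W M%:R ((D *m P) b 0).
  have := (zP b).2; congr (vleb W _ _).
  rewrite mulmxBl mul_scalar_mx !mxE; congr (_ - _).
  by apply: eq_bigr => b' _; rewrite !mxE.
have hD i j : vleb W 0 (D i j).
  rewrite !mxE; apply: (vlebB HW); last exact: (zP i).1.
  by case: (i == j); rewrite ?mulr1n ?mulr0n ?vleb0.
(* The entry of [P] at index 0 is [pi ^+ 0 = 1], so the determinant is a combination of the small
   entries of [D *m P]. *)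
have detE : \det D = \sum_b (\adj D) 0 b * (D *m P) b 0.
  have : (\adj D *m (D *m P)) 0 0 = \det D.
    by rewrite mulmxA mul_adj_mx mul_scalar_mx !mxE expr0 mulr1.
  by rewrite mxE.
have hdet : vleb W (e.+1%:R * N%:R) (\det D).
  rewrite -natrM detE; apply: (vleb_sum HW) => b _; apply: (vlebM0l HW) => //.
  rewrite mxE; apply: (vlebM0l HW).
    by apply: vlebX0 => //; rewrite (vlebN HW); apply: vleb1.
  by apply: vleb_det => i j; rewrite 2!mxE; apply: hD.
have chE : \det D = (map_poly k (char_poly A)).[Y].
  rewrite -[RHS]/((horner_eval Y \o map_poly k) (\det (char_poly_mx A))) -det_map_mx.
  congr (\det _); apply/matrixP => i j; rewrite !mxE /= /horner_eval.
  by rewrite rmorphB rmorphMn /= map_polyX map_polyC hornerD hornerN hornerMn hornerX hornerC.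
rewrite chE in hdet.
have [c _ hc] := root_approx HW (char_poly_monic A) (size_char_poly A) (ltn0Sn e) hdet.
by exists c.
Qed.

Lemma element_approx X (N : nat) : S X -> exists c, vleb W N%:R (X - k c).
Proof.
move=> SX; have [m hm] : exists m : nat, vleb W 0 (p%:R ^+ m * X).
  have [->|X0] := eqVneq X 0; first by exists 0%N; rewrite mulr0 vleb0.
  exists (Num.bound `|W X|); rewrite vlebE ?mulf_neq0 ?expf_neq0 // (val_mul HW) ?expf_neq0 //.
  rewrite (val_exp HW) // Wp mulr1 -lerBlDr sub0r.
  by apply: le_trans (ltW (archi_boundP (normr_ge0 _))); rewrite -normrN ler_norm.
have SY : S (p%:R ^+ m * X) by apply: SM => //; apply/S_X/S_nat.
have [c hc] := integral_approx (N + m)%N SY hm.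
(* The denominator [p ^ m] costs [m] units of precision, hence [N + m] above. *)
exists (c / p%:R ^+ m).
have pm0 : p%:R ^+ m != 0 :> L by apply: expf_neq0.
have -> : X - k (c / p%:R ^+ m) = (p%:R ^+ m)^-1 * (p%:R ^+ m * X - k c).
  by rewrite fmorph_div rmorphXn rmorph_nat; field.
have hi : vleb W (- m%:R) (p%:R ^+ m)^-1.
  by rewrite vlebE ?invr_eq0 // (val_inv HW) // (val_exp HW) // Wp mulr1.
by have := vlebM HW hi hc; rewrite natrD addrC addrK.
Qed.
End Approximation.

(** * The case without a best algebraic approximation *)

Section Dichotomy.
Variables (L : fieldType) (W : L -> rat) (p : nat) (k : {rmorphism algC -> L}) (X : L).
Hypotheses (HW : isVal W) (pp : prime p).
Hypothesis Wk : forall a, a != 0 -> W (k (ratr a)) = vpQ p a.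
Hypothesis Xtr : forall h : {poly algC}, h != 0 -> (map_poly k h).[X] != 0.

Local Notation gam c := (W (X - k c)).

Let Xk0 c : X - k c != 0.
Proof.
have := Xtr (monic_neq0 (monicXsubC c)).
by rewrite map_polyXsubC hornerXsubC.
Qed.

Lemma gam_diff b c : gam b < gam c -> c != b /\ W (k c - k b) = gam b.
Proof.
move=> lt; have E : X - k b + (k b - k c) = X - k c by ring.
have [E1|cb] := eqVneq c b; first by rewrite E1 ltxx in lt.
split=> //; have hn : vleb W (gam c) (- (X - k c)) by rewrite (vlebN HW) vleb_refl.
by have [_ <-] := val_addl HW (Xk0 b) hn lt; congr W; ring.
Qed.

Definition oneunit (z : L) : bool := vpos W (z - 1).

Lemma oneunit_vleb z : oneunit z -> vleb W 0 z.
Proof.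
by move=> /vpos_vleb h; rewrite -[z](subrK 1) (vlebD HW) // (vleb1 HW).
Qed.

Lemma oneunitM x y : oneunit x -> oneunit y -> oneunit (x * y).
Proof.
move=> hx hy; have -> : oneunit (x * y) = vpos W (x * (y - 1) + (x - 1)).
  by congr (vpos W _); ring.
by apply: (vposD HW) => //; apply: (vposMl HW) => //; apply: oneunit_vleb.
Qed.

Lemma oneunit_val z : oneunit z -> z != 0 /\ W z = 0.
Proof.
case/vposP => n n0 h.
have [||z0 ->] := val_near HW (oner_neq0 L) (y := z) (n := n).
- by rewrite (val_one HW).
- by rewrite (vlebBC HW).
by rewrite (val_one HW).
Qed.

Lemma oneunitV z : oneunit z -> oneunit z^-1.
Proof.
move=> hz; have [z0 vz] := oneunit_val hz; rewrite /oneunit.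
have -> : z^-1 - 1 = - (z^-1 * (z - 1)) by field.
rewrite (vposN HW); apply: (vposMl HW) => //.
by rewrite vlebE ?invr_eq0 // (val_inv HW) // vz oppr0.
Qed.

Lemma oneunit_prod (I : eqType) (r : seq I) (F : I -> L) :
  (forall i, i \in r -> oneunit (F i)) -> oneunit (\prod_(i <- r) F i).
Proof.
move=> H; rewrite big_seq; elim/big_ind: _ => //; last exact: oneunitM.
by rewrite /oneunit subrr vpos0.
Qed.

Hypothesis nomax : forall c, exists c', gam c < gam c'.

Lemma beat_all (r : seq algC) : exists c, forall b, b \in r -> gam b < gam c.
Proof.
elim: r => [|a r [c Hc]]; first by exists 0.
have [c' Hc'] := nomax (if gam a < gam c then c else a).
exists c' => b; rewrite inE; case: (ltrP (gam a) (gam c)) Hc' => [lt|le] h /orP[/eqP->//|/Hc hb].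
- exact: lt_trans lt h.
- exact: lt_trans hb h.
exact: lt_trans (lt_le_trans hb le) h.
Qed.

(** For [c] closer to [X] than every root [b] of [h], each [(X - k b) / (k c - k b)] is a unit with
    residue 1. Hence [h] at [X] and at [c] differ by such a unit, which makes the extension
    immediate. *)
Lemma ev_oneunit (h : {poly algC}) : h != 0 -> exists r : seq algC,
  forall c, (forall b, b \in r -> gam b < gam c) ->
    h.[c] != 0 /\ oneunit ((map_poly k h).[X] / k h.[c]).
Proof.
move=> h0; have [r Er] := closed_field_poly_normal h; exists r => c Hc.
have l0 : lead_coef h != 0 by rewrite lead_coef_eq0.
have d b : b \in r -> c - b != 0.
  by move=> br; rewrite subr_eq0; have [] := gam_diff (Hc b br).
have hc : h.[c] = lead_coef h * \prod_(b <- r) (c - b).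
  rewrite Er hornerZ horner_prod; congr (_ * _).
    by rewrite lead_coefZ (monicP (monic_prod_XsubC r predT id)) mulr1.
  by apply: eq_bigr => b _; rewrite !hornerE.
have pr0 : \prod_(b <- r) (c - b) != 0.
  by rewrite prodf_seq_neq0; apply/allP => b /d.
have hX : (map_poly k h).[X] = k (lead_coef h) * \prod_(b <- r) (X - k b).
  rewrite {1}Er linearZ /= hornerZ rmorph_prod horner_prod; congr (_ * _).
  by apply: eq_bigr => b _; rewrite /= map_polyXsubC !hornerE.
split; first by rewrite hc mulf_neq0.
rewrite hX hc rmorphM rmorph_prod -mulf_div divff ?fmorph_eq0 // mul1r -prodf_div.
apply: oneunit_prod => b br; have [_ E] := gam_diff (Hc b br).
have n0 : k c - k b != 0 by rewrite -rmorphB fmorph_eq0 d.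
rewrite rmorphB; have -> : oneunit ((X - k b) / (k c - k b)) = vpos W ((X - k c) / (k c - k b)).
  by congr (vpos W _); field.
rewrite /vpos (val_div HW) // E subr_gt0 Hc // orbT //.
Qed.

Let ev (f : {poly rat}) : L := (map_poly k (map_poly ratr f)).[X].
Let ev0 f : f != 0 -> ev f != 0.
Proof. by move=> f0; apply: Xtr; rewrite map_poly_eq0. Qed.
Let evM f g : ev (f * g) = ev f * ev g.
Proof. by rewrite /ev !rmorphM /= hornerM. Qed.
Let evB f g : ev (f - g) = ev f - ev g.
Proof. by rewrite /ev !rmorphB /= hornerD hornerN. Qed.

Definition ratfun (x : L) : Prop := exists f g, g != 0 /\ x = ev f / ev g.

Let kr : {rmorphism rat -> L} := k \o (ratr : rat -> algC).
Let pE : p%:R = kr p%:R :> L. Proof. by rewrite rmorph_nat. Qed.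
Let pQ0 : p%:R != 0 :> rat. Proof. by rewrite lt0r_neq0 // ltr0n prime_gt0. Qed.
Let Wp : W p%:R = 1. Proof. by rewrite pE /= Wk // vpQ_p. Qed.
Let p0 : p%:R != 0 :> L. Proof. by rewrite pE fmorph_eq0. Qed.

(** A single [c] beating the roots of numerator and denominator makes [y] congruent to an algebraic
    number, to which [algebraic_residue] applies. *)
Lemma ratfun_residue y : ratfun y -> vleb W 0 y ->
  exists2 s, (0 < s)%N & vpos W (y ^+ (p ^ s) - y).
Proof.
move=> [f [g [g0 yE]]] hy; have [f0|f0] := eqVneq f 0.
  exists 1%N => //; rewrite yE f0 /ev !rmorph0 horner0 mul0r expn1 expr0n.
  by rewrite gtn_eqF ?prime_gt0 // subrr vpos0.
have f0' : map_poly (ratr : rat -> algC) f != 0 by rewrite map_poly_eq0.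
have g0' : map_poly (ratr : rat -> algC) g != 0 by rewrite map_poly_eq0.
have [r Hr] := ev_oneunit f0'; have [r' Hr'] := ev_oneunit g0'.
have [c Hc] := beat_all (r ++ r').
have [|fc uf] := Hr c; first by move=> b br; apply: Hc; rewrite mem_cat br.
have [|gc ug] := Hr' c; first by move=> b br; apply: Hc; rewrite mem_cat br orbT.
pose b := (map_poly ratr f).[c] / (map_poly ratr g).[c].
pose z := (ev f / k (map_poly ratr f).[c]) / (ev g / k (map_poly ratr g).[c]).
have hz : oneunit z by apply: oneunitM => //; apply: oneunitV.
have yz : y = k b * z.
  rewrite yE /z /b fmorph_div; field.
  by rewrite ev0 // !fmorph_eq0 fc gc.
have [z0 vz] := oneunit_val hz.
have b0 : k b != 0 by rewrite fmorph_eq0 mulf_neq0 ?invr_eq0.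
have hb : vleb W 0 (k b).
  by move: hy; rewrite yz (vlebE W 0 (mulf_neq0 b0 z0)) (vlebE W 0 b0) (val_mul HW b0 z0) vz addr0.
have hyb : vpos W (y - k b).
  have -> : y - k b = k b * (z - 1) by rewrite yz; ring.
  exact: (vposMl HW).
have [q [Eq qm] _] := minCpolyP b.
have rb : root (map_poly kr q) (k b).
  by rewrite map_poly_comp -Eq fmorph_root root_minCpoly.
have [s s0 hs] := @algebraic_residue L W p HW pp Wp p0 kr Wk q (k b) (monic_neq0 qm) rb hb.
exists s => //; apply: (vpos_trans HW (y := k b ^+ (p ^ s))).
  exact: (vposX HW).
by apply: (vpos_trans HW hs); rewrite (vposBC HW).
Qed.

(** Discreteness on the image of Q(X) gives a uniformizer and [ratfun_residue] gives the residues
    needed to expand [X]; no bound on the approximations by constants can then persist. *)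
Theorem unbounded_approx (e : nat) : (0 < e)%N ->
  (forall f, f != 0 -> e%:R * W (ev f) \is a Num.int) ->
  forall N : nat, exists c, N%:R <= gam c.
Proof.
move=> e0 He N.
have S1 : ratfun 1 by exists 1, 1; rewrite oner_neq0 divff // ev0 // oner_neq0.
have SM x y : ratfun x -> ratfun y -> ratfun (x * y).
  move=> [f [g [g0 ->]]] [f' [g' [g0' ->]]]; exists (f * f'), (g * g').
  by rewrite mulf_neq0 // !evM mulf_div.
have SB x y : ratfun x -> ratfun y -> ratfun (x - y).
  move=> [f [g [g0 ->]]] [f' [g' [g0' ->]]]; exists (f * g' - f' * g), (g * g').
  rewrite mulf_neq0 // evB !evM; split=> //.
  by field; rewrite !ev0.
have SV x : ratfun x -> ratfun x^-1.
  move=> [f [g [g0 ->]]]; have [->|f0] := eqVneq f 0.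
    exists 0, 1; rewrite oner_neq0; split=> //.
    by rewrite /ev !rmorph0 horner0 !mul0r invr0.
  by exists g, f; rewrite f0 invf_div.
have evX : ev 'X = X by rewrite /ev !map_polyX hornerX.
have SX : ratfun X.
  by exists 'X, 1; rewrite oner_neq0 evX /ev !rmorph1 hornerC divr1.
have Sp : ratfun p%:R.
  exists (p%:R : rat)%:P, 1; rewrite oner_neq0; split=> //.
  by rewrite /ev !rmorph1 !map_polyC !hornerC divr1 /= !rmorph_nat.
have Sint x : ratfun x -> x != 0 -> e%:R * W x \is a Num.int.
  move=> [f [g [g0 ->]]] x0; have f0 : f != 0.
    by apply: contraNneq x0 => ->; rewrite /ev !rmorph0 horner0 mul0r.
  by rewrite (val_div HW) ?ev0 // mulrBr rpredB ?He.
have ex : exists x, [/\ ratfun x, x != 0 & 0 < W x] by exists p%:R; rewrite Wp.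
have [t [St t0 Wt tV]] := discrete_uniformizer HW e0 SM SV ex Sint.
(* As [p] has value 1, the uniformizer has value [1 / m], and [m] is the ramification index. *)
have [m mE] := tV _ Sp p0; rewrite Wp in mE.
have m0 : 0 < m by rewrite -(ltr0z rat) -(pmulr_lgt0 _ Wt) -mE.
have [e' e'E] : exists e' : nat, m = e'.+1%:Z.
  by exists `|m|%N.-1; rewrite prednK ?absz_gt0 ?gt_eqF // gez0_abs // ltW.
have WtE : W t = e'.+1%:R^-1.
  have m0' : e'.+1%:R != 0 :> rat by rewrite pnatr_eq0.
  by apply: (mulfI m0'); rewrite divff // [RHS]mE e'E pmulrn.
have Sdisc x : ratfun x -> x != 0 -> exists m : int, W x = m%:~R / e'.+1%:R.
  by move=> Sx x0; have [m' ->] := tV x Sx x0; exists m'; rewrite WtE.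
have [c hc] := element_approx HW pp Wp p0 k S1 SB SM SV St t0 WtE Sdisc
  ratfun_residue N SX.
by exists c; rewrite -vlebE.
Qed.
End Dichotomy.

(** * Surjectivity *)

Lemma relation_val (L : fieldType) (v : L -> rat) (n : nat) (t : 'I_n -> L) : isVal v ->
  \sum_i t i = 0 -> (exists i, t i != 0) ->
  exists i j, [/\ i != j, t i != 0, t j != 0 & v (t i) = v (t j)].
Proof.
move=> Hv sum0 ex.
have sV : is_subring (fun x => vleb v 0 x).
  by split; [exact: vleb1 | move=> x y; exact: (vlebB Hv) | move=> x y; exact: (vlebM0l Hv)].
have tot x : vleb v 0 x \/ vleb v 0 x^-1.
  have [->|x0] := eqVneq x 0; first by left; rewrite vleb0.
  rewrite !vlebE ?invr_eq0 // (val_inv Hv) // oppr_ge0.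
  by have [h|/ltW h] := lerP 0 (v x); [left|right].
have [i [j [ij ti tj [a b]]]] := sum_assoc sV tot sum0 ex.
exists i, j; split=> //; move: a b.
rewrite !vlebE ?mulf_neq0 ?invr_eq0 // !(val_div Hv) // !subr_ge0 => a b.
by apply/eqP; rewrite eq_le a b.
Qed.

Lemma fact_mul_int (n d : nat) (x : rat) : (0 < d <= n)%N -> d%:R * x \is a Num.int ->
  (n`!)%:R * x \is a Num.int.
Proof.
move=> dn h; have /dvdnP[m ->] : (d %| n`!)%N by rewrite dvdn_fact.
by rewrite natrM -mulrA rpredM // natr_int.
Qed.

Section Surjectivity.
Variables (p : nat) (K : closedFieldType) (v : K -> rat).
Hypotheses (pp : prime p) (HC : isCp p v).
Let Hv := Cp_isVal HC.

(** Q is dense in Q_p, so a polynomial over Q_p can be replaced by a rational one with the same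
    value at [a]. *)
Lemma isBr_of_rat (a : K) (e : nat) : (0 < e)%N ->
  (forall f : {poly rat}, (map_poly ratr f).[a] != 0 ->
     e%:R * v (map_poly ratr f).[a] \is a Num.int) -> isBr v a.
Proof.
move=> e0 He; exists e; split=> // f g Qf Qg fa ga.
have app h : polyOverQp v h -> h.[a] != 0 -> e%:R * v h.[a] \is a Num.int.
  move=> Qh ha.
  have [B HB] : exists B, forall i, (i < size h)%N -> vleb v B (a ^+ i).
    elim: (size h) => [|m [B HB]]; first by exists 0.
    exists (Num.min B (v (a ^+ m))) => i; rewrite ltnS leq_eqVlt => /orP[/eqP->|/HB].
      by apply: vlebW (vleb_refl _ _); rewrite ge_min lexx orbT.
    by apply: vlebW; rewrite ge_min lexx.
  (* [B] bounds the values of the powers of [a], so this precision on coefficients gives an error of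
     value at least [v h.[a] + 1]. *)
  have /boolp.choice[q qP] : forall i, exists q : rat, vleb v (v h.[a] + 1 - B) (h`_i - ratr q).
    by move=> i; have [q hq] := Qh i (v h.[a] + 1 - B); exists q; apply/vgeP.
  pose f' := \poly_(i < size h) q i.
  have [rK rKE] := ratr_rmorphism (Cp_ratr0 HC).
  have mE : map_poly ratr f' = map_poly rK f' by apply: eq_map_poly => c; rewrite rKE.
  have d : vleb v (v h.[a] + 1) (h.[a] - (map_poly ratr f').[a]).
    have -> : (map_poly ratr f').[a] = \sum_(i < size h) ratr (q i) * a ^+ i.
      rewrite mE (horner_coef_wide (n := size h)); last first.
        by rewrite size_map_poly size_poly.
      by apply: eq_bigr => i _; rewrite coef_map coef_poly ltn_ord /= rKE.
    rewrite [X in vleb _ _ (X - _)]horner_coef -sumrB; apply: (vleb_sum Hv) => i _; rewrite -mulrBl.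
    by have := vlebM Hv (qP i) (HB i (ltn_ord i)); rewrite subrK.
  have lt : v h.[a] < v h.[a] + 1 by rewrite ltrDl ltr01.
  have [n0 <-] := val_near Hv ha lt d.
  exact: He.
have /app hf := Qf; have /app hg := Qg.
apply/eqP; rewrite -Qint_def (val_div Hv) // mulrBr rpredB ?hf ?hg //.
Qed.

(** Each value of a rational polynomial at [c] lies in one number field of degree [n]. Two terms of
    its minimal equation have equal value, so some [d <= n] clears the denominator; [d] varies with
    the polynomial, and [n!] serves for all. *)
Lemma algebraic_discrete (i : {rmorphism algC -> K}) (c : algC) : exists e : nat, (0 < e)%N /\
  forall f : {poly rat}, (map_poly ratr f).[i c] != 0 ->
     e%:R * v (map_poly ratr f).[i c] \is a Num.int.
Proof.
have [Qs [QsC [[|z [|]] //= [zc] _]]] := num_field_exists [:: c].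
pose n := \dim {:Qs}; exists (n`!); split; first exact: fact_gt0.
move=> f fc.
pose y := (map_poly (in_alg Qs) f).[z].
have yE : i (QsC y) = (map_poly ratr f).[i c].
  rewrite /y -horner_map -map_poly_comp zc.
  have -> : map_poly (QsC \o in_alg Qs) f = map_poly ratr f.
    by apply: eq_map_poly => a; rewrite /= alg_num_field fmorph_rat.
  by rewrite -horner_map (embed_map_ratr HC).
have /polyOver1P[q qE] := minPolyOver 1%AS y.
have q0 : q != 0.
  by have := monic_neq0 (monic_minPoly 1%AS y); rewrite qE map_poly_eq0.
have szq : (size q <= n.+1)%N.
  rewrite -(size_map_poly (in_alg Qs)) -qE size_minPoly ltnS.
  by rewrite /adjoin_degree dimv1 divn1 prednK ?adim_gt0 // dimvS ?subvf.
have rq : root (map_poly ratr q) (QsC y).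
  have := root_minPoly 1%AS y; rewrite qE -(fmorph_root QsC) -map_poly_comp.
  congr (root _ _); apply: eq_map_poly => a; by rewrite /= alg_num_field fmorph_rat.
pose x := i (QsC y).
have x0 : x != 0 by rewrite /x yE.
pose t (j : 'I_(size q)) := ratr q`_j * x ^+ j.
have sum0 : \sum_j t j = 0.
  have : (map_poly i (map_poly ratr q)).[x] = 0.
    by apply/rootP; rewrite fmorph_root.
  rewrite horner_coef !size_map_poly => E; rewrite -[RHS]E; apply: eq_bigr => j _.
  by rewrite !coef_map /= (embed_ratr HC).
have tn j : (t j != 0) = (q`_j != 0).
  rewrite /t mulf_eq0 expf_eq0 (negPf x0) andbF orbF.
  by have [->|/(Cp_ratr0 HC)->//] := eqVneq q`_j 0; rewrite -(embed_ratr HC i) !rmorph0 eqxx.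
have ex : exists j, t j != 0.
  have lt : ((size q).-1 < size q)%N by rewrite prednK // size_poly_gt0.
  by exists (Ordinal lt); rewrite tn /= -lead_coefE lead_coef_eq0.
have [j [l [jl tj tl E]]] := relation_val Hv sum0 ex.
rewrite -yE -/x.
wlog lt : j l jl tj tl E / (j < l)%N => [H|].
  have [lt|lt|/val_inj E'] := ltngtP j l; [exact: (H j l)| |by rewrite E' eqxx in jl].
  by apply: (H l j) => //; rewrite eq_sym.
apply: (@fact_mul_int n (l - j)%N).
  rewrite subn_gt0 lt /=; apply: leq_trans (leq_subr _ _) _.
  by rewrite -ltnS; apply: leq_trans (ltn_ord l) szq.
rewrite tn in tj; rewrite tn in tl.
have vt (m : 'I_(size q)) : q`_m != 0 -> v (t m) = vpQ p q`_m + m%:R * v x.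
  move=> qm; rewrite /t (val_mul Hv (Cp_ratr0 HC qm) (expf_neq0 m x0)).
  by rewrite (Cp_ratr HC qm) (val_exp Hv).
move: E; rewrite !vt //.
rewrite natrB ?(ltnW lt) // mulrBl => E.
have -> : l%:R * v x - j%:R * v x = vpQ p q`_j - vpQ p q`_l by lra.
by rewrite rpredB // intr_int.
Qed.

Lemma rat_polyOverQp (i : {rmorphism algC -> K}) (f : {poly rat}) :
  polyOverQp v (map_poly i (map_poly ratr f)).
Proof.
by move=> j n; exists f`_j; rewrite !coef_map /= (embed_ratr HC) subrr; left.
Qed.

Lemma algebraic_algQp (i : {rmorphism algC -> K}) (c : algC) : algQp v (i c).
Proof.
have [q [E /monic_neq0 q0] _] := minCpolyP c.
exists (map_poly i (map_poly ratr q)); split; first by rewrite !map_poly_eq0.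
split; first exact: rat_polyOverQp.
by rewrite fmorph_root -E root_minCpoly.
Qed.

(** Any embedding can be corrected by an automorphism of [algC]: Gauss extensions of radius zero
    turn a statement on constants into one on polynomials, where [conj_global] applies. *)
Lemma isometric_embedding (u : algC -> rat) : isVal u ->
  (forall q, q != 0 -> u (ratr q) = vpQ p q) ->
  exists i : {rmorphism algC -> K}, forall c, c != 0 -> v (i c) = u c.
Proof.
move=> Hu uQ; have [i0 _] := algC_embedding (Cp_ratr0 HC).
have Hi : isVal (v \o i0) := isVal_map (fmorph_inj i0) Hv.
have [|t Ht] := conj_global (isVal_gaussv Hi 0) (isVal_gaussv Hu 0).
  move=> f f0; apply: eq_gaussv => j; rewrite coef_map /= fmorph_eq0 => fj.
  by rewrite (embed_ratr HC) (Cp_ratr HC) // uQ.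
exists (i0 \o t : {rmorphism algC -> K}) => c c0.
have := Ht c%:P; rewrite polyC_eq0 map_polyC /= => /(_ c0).
by rewrite !gaussvC ?fmorph_eq0 // => ->.
Qed.

Lemma isVal_ev (L : fieldType) (W : L -> rat) (k : {rmorphism algC -> L}) (X : L) : isVal W ->
  (forall h : {poly algC}, h != 0 -> (map_poly k h).[X] != 0) ->
  isVal (fun h : {poly algC} => W (map_poly k h).[X]).
Proof.
move=> HW Xtr; have inj : injective (horner_eval X \o map_poly k).
  move=> f g E; apply/eqP; rewrite -subr_eq0; apply: contraT => /Xtr.
  by move: E; rewrite /= /horner_eval rmorphB hornerD hornerN => ->; rewrite subrr eqxx.
exact: (isVal_map inj HW).
Qed.

Theorem realize_valuation (L : fieldType) (W : L -> rat) (k : {rmorphism algC -> L}) (X : L)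
    (e : nat) :
  isVal W -> (forall q, q != 0 -> W (k (ratr q)) = vpQ p q) ->
  (forall h : {poly algC}, h != 0 -> (map_poly k h).[X] != 0) -> (0 < e)%N ->
  (forall f : {poly rat}, f != 0 ->
     e%:R * W (map_poly k (map_poly ratr f)).[X] \is a Num.int) ->
  exists (a : K) (d : option rat) (i : {rmorphism algC -> K}),
    admBr v a d /\ forall h, h != 0 -> wA v i a d h = W (map_poly k h).[X].
Proof.
move=> HW Wk Xtr e0 He.
have Hwb := isVal_ev HW Xtr.
have Hu : isVal (W \o k) := isVal_map (fmorph_inj k) HW.
have [i iE] := isometric_embedding Hu Wk.
have XcE c : (map_poly k ('X - c%:P)).[X] = X - k c by rewrite map_polyXsubC !hornerE.
have Xc0 c : X - k c != 0 by rewrite -XcE Xtr // monic_neq0 ?monicXsubC.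
(* Constants already match through the isometry [i], so only the values at [X - c] remain to be
   compared. *)
have final a d : transc_if_infinite a d ->
    (forall c, vlin v d (a - i c) = W (X - k c)) ->
    forall h, h != 0 -> wA v i a d h = W (map_poly k h).[X].
  move=> ta Hl; apply: (closed_val_eq (isVal_wA HC i ta) Hwb).
    by move=> c c0; rewrite (wA_C _ _ _ _ c0) iE // map_polyC hornerC.
  by move=> c; rewrite (wA_XsubC HC) Hl XcE.
case: (boolp.pselect (exists c0, forall c, W (X - k c) <= W (X - k c0))) => [[c0 max]|nomax].
  (* At the maximum, [W (X - k c)] is the minimum of [r] and the value of [c0 - c]: strict
     domination decides when [c0 - c] has the smaller value, and maximality bounds it by [r]
     otherwise. *)
  pose r := W (X - k c0).
  exists (i c0), (Some r), i; split.
    split; last exact: algebraic_algQp.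
    by have [e' [e'0 He']] := algebraic_discrete i c0; apply: isBr_of_rat e'0 He'.
  apply: final => // c; rewrite /vlin /vmin -rmorphB fmorph_eq0.
  case: eqP => [/eqP|/eqP] d0; first by rewrite subr_eq0 in d0; rewrite /r (eqP d0).
  rewrite iE // -[(W \o k) _]/(W (k (c0 - c))); have E : X - k c = (X - k c0) + k (c0 - c) by rewrite rmorphB; ring.
  have kd : k (c0 - c) != 0 by rewrite fmorph_eq0.
  apply/eqP; rewrite eq_le; apply/andP; split.
    by rewrite minC E; apply: (proj2 HW) => //; rewrite -E.
  rewrite le_min max andbT /= leNgt; apply/negP => lt.
  have [hr|hr] := ltrP (W (k (c0 - c))) r.
    have := val_addl HW kd (vleb_refl W (X - k c0)) hr.
    by rewrite addrC -E => -[_ E2]; rewrite E2 ltxx in lt.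
  by have := le_lt_trans hr lt; rewrite ltNge max.
have nomax' c : exists c', W (X - k c) < W (X - k c').
  apply: boolp.contrapT => H; apply: nomax; exists c => c'.
  by rewrite leNgt; apply/negP => lt; apply: H; exists c'.
have big : forall N : nat, exists c, N%:R <= W (X - k c).
  exact: (unbounded_approx HW pp Wk Xtr nomax' e0 He).
have [c cP] := boolp.choice big.
have near n : exists N, forall m, (N <= m)%N -> n <= W (X - k (c m)).
  exists (Num.bound `|n|) => m Nm; apply: le_trans (cP m).
  apply: le_trans (ler_norm _) _; apply: le_trans (ltW (archi_boundP (normr_ge0 _))) _.
  by rewrite ler_nat.
have iW n (b b' : algC) : vleb v n (i b - i b') = vleb W n (k b - k b').
  rewrite -!rmorphB; have [->|d0] := eqVneq (b - b') 0; first by rewrite !rmorph0 !vleb0.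
  by rewrite !vlebE ?fmorph_eq0 // iE.
have kk n b b' : n <= W (X - k b) -> n <= W (X - k b') -> vleb W n (k b - k b').
  rewrite -!vlebE // => h h'; apply: (vleb_trans HW (y := X)) => //.
  by rewrite (vlebBC HW).
have [|a aP] := Cp_complete HC (u := fun m => i (c m)).
  move=> n; have [N HN] := near n; exists N => m m' Nm Nm'.
  by rewrite iW kk // HN.
have close n b : n <= W (X - k b) -> vleb v n (a - i b).
  move=> hb; have [N HN] := near n; have [M HM] := aP n.
  apply: (vleb_trans Hv (y := i (c (maxn N M)))).
    by rewrite (vlebBC Hv) HM // leq_maxr.
  by rewrite iW kk // HN // leq_maxl.
(* Some [b'] approximates [X] better than [b] does, so both [v (a - i b)] and [W (X - k b)] equal
   the value of [b' - b]. In particular [a] is never algebraic. *)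
have aE b : a - i b != 0 /\ v (a - i b) = W (X - k b).
  have [b' lt] := nomax' b.
  have h1 : vleb v (W (X - k b')) (a - i b') by apply: close.
  have [bb E] := gam_diff HW Xtr lt.
  have db : i b' - i b != 0 by rewrite -rmorphB fmorph_eq0 subr_eq0.
  have vb : v (i b' - i b) = W (X - k b) by rewrite -rmorphB iE ?subr_eq0 //= rmorphB.
  rewrite -vb in lt; have := val_addl Hv db h1 lt.
  by rewrite addrC subrKA vb.
have ta : transcQ a.
  move=> f f0 rf; have [||b ab] := @root_embed K i (map_poly ratr f) a.
  - by rewrite map_poly_eq0.
  - by rewrite (embed_map_ratr HC).
  by have [] := aE b; rewrite ab subrr eqxx.
have wE := final a None ta (fun b => (aE b).2).
exists a, None, i; split=> //; split=> //.
apply: (isBr_of_rat e0) => f fa; have [f0|f0] := eqVneq f 0.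
  by move: fa; rewrite f0 -(embed_map_ratr HC i) !rmorph0 horner0 eqxx.
have := wE (map_poly ratr f); rewrite map_poly_eq0 => /(_ f0); rewrite (wA_ratr HC) /wQ => ->.
exact: He.
Qed.

Theorem surj_of_val (w : {poly rat} -> rat) (e : nat) : isVal w -> extends_vpQ p w ->
  (0 < e)%N -> (forall f, f != 0 -> e%:R * w f \is a Num.int) ->
  exists (a : K) (d : option rat),
    admBr v a d /\ forall f, f != 0 -> wQ v a d f = w f.
Proof.
move=> Hw Ew e0 He.
have pQ0 : p%:R != 0 :> rat by rewrite lt0r_neq0 // ltr0n prime_gt0.
have wp : w (p%:R)%:P = 1 by rewrite Ew // vpQ_p.
have pP0 : (p%:R : rat)%:P != 0 by rewrite polyC_eq0.
have [W [HW EW]] := extend_to_algC_poly Hw wp pP0.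
pose k : {rmorphism algC -> {fraction {poly algC}}} := @FracField.tofrac _ \o polyC.
pose X : {fraction {poly algC}} := ('X : {poly algC})%:F.
have evE (h : {poly algC}) : (map_poly k h).[X] = h%:F.
  by rewrite map_poly_comp horner_map /= -[h in RHS]comp_polyXr.
have Xtr (h : {poly algC}) : h != 0 -> (map_poly k h).[X] != 0 by rewrite evE tofrac_eq0.
have ratP0 (q : rat) : q != 0 -> q%:P != 0 by rewrite polyC_eq0.
have Wk q : q != 0 -> W (k (ratr q)) = vpQ p q.
  by move=> q0; rewrite -(Ew q q0) -(EW _ (ratP0 q q0)) map_polyC.
have He' (f : {poly rat}) : f != 0 -> e%:R * W (map_poly k (map_poly ratr f)).[X] \is a Num.int.
  by move=> f0; rewrite evE (EW f f0); apply: He.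
have [a [d [i [adm wE]]]] := realize_valuation HW Wk Xtr e0 He'.
exists a, d; split; first exact: adm.
move=> f f0; rewrite -(wA_ratr HC i) wE; last by rewrite map_poly_eq0.
by rewrite evE (EW f f0).
Qed.
End Surjectivity.

Theorem mainTheorem7 (p : nat) (K : closedFieldType) (v : K -> rat) :
  prime p -> isCp p v ->
  [/\ (* Theta_p lands in W_p *)
      (forall (a : K) (d : option rat), admBr v a d -> isWp p (Zring v a d)),
      (* well defined on orbits *)
      (forall (a a' : K) (d d' : option rat), admBr v a d -> admBr v a' d' ->
          sameOrbit v a d a' d' ->
          forall phi, Zring v a d phi <-> Zring v a' d' phi),
      (* injective *)
      (forall (a a' : K) (d d' : option rat), admBr v a d -> admBr v a' d' ->
          (forall phi, Zring v a d phi <-> Zring v a' d' phi) ->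
          sameOrbit v a d a' d') &
      (* surjective *)
      (forall W, isWp p W -> exists (a : K) (d : option rat),
          admBr v a d /\ forall phi, Zring v a d phi <-> W phi)].
Proof.
move=> pp HC; have [i _] := algC_embedding (Cp_ratr0 HC).
split.
- by move=> a d; apply: (Zring_isWp pp HC i).
- by move=> a a' d d' adm adm' orb phi; rewrite (Zring_orbit pp HC i adm adm' orb).
- by move=> a a' d d'; apply: (Zring_inj pp HC i).
move=> W /(isWp_val pp)[w [e [Hw Ew e0 He HW]]].
have [a [d [adm wE]]] := surj_of_val pp HC Hw Ew e0 He.
exists a, d; split=> // phi; rewrite (Zring_Zw HC i (admBr_transc adm)).
apply: (iff_trans _ (iff_sym (HW phi))).
split=> -[f [g [g0 [E h]]]]; exists f, g; do 2!split=> //;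
  have [->|f0] := eqVneq f 0; [by left | | by left |];
  by case: h => [|h]; [left|right]; rewrite ?wE // -?wE.
Qed.
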